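(* Let $1\le k\le n-1$. Given $f\in L^2\Lambda^k(\Omega)$, there is a unique $(\omega_h,\zeta_h,\sigma_h,\vartheta_h)\in\mathcal{P}_0\Lambda^k(\mathcal{G}_h)\times\mathbf{W}^*_{h0}\Lambda^{k+1}\times\mathbf{W}^{\rm nc}_h\Lambda^{k-1}\times\mathfrak{H}^{\rm nc}_h\Lambda^k$ such that, for all $(\mu_h,\eta_h,\tau_h,\varsigma_h)$ in the same product space, $$\begin{aligned} \langle\omega_h,\varsigma_h\rangle_{L^2\Lambda^k}&=0,\\ \langle\mathbf{P}^{k+1}_h\zeta_h,\mathbf{P}^{k+1}_h\eta_h\rangle_{L^2\Lambda^{k+1}}-\langle\omega_h,\delta_{k+1}\eta_h\rangle_{L^2\Lambda^k}&=0,\\ \langle\mathbf{P}^{k-1}_h\sigma_h,\mathbf{P}^{k-1}_h\tau_h\rangle_{L^2\Lambda^{k-1}}-\langle\omega_h,d^{k-1}_h\tau_h\rangle_{L^2\Lambda^k}&=0,\\ \langle\vartheta_h,\mu_h\rangle_{L^2\Lambda^k}+\langle\delta_{k+1}\zeta_h,\mu_h\rangle_{L^2\Lambda^k}+\langle d^{k-1}_h\sigma_h,\mu_h\rangle_{L^2\Lambda^k}&=\langle f,\mu_h\rangle_{L^2\Lambda^k}, \end{aligned}$$ and $$\|\omega_h\|_{L^2\Lambda^k}+\|\zeta_h\|_{\delta_{k+1}}+\|\sigma_h\|_{d^{k-1}_h}+\|\vartheta_h\|_{L^2\Lambda^k}\le C\|f\|_{L^2\Lambda^k},$$ where the constant $C$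 depends on $\mathsf{icr}(\delta_{k+1},\mathbf{W}^*_{h0}\Lambda^{k+1})$ and $\mathsf{icr}(d^{k-1}_h,\mathbf{W}^{\rm nc}_h\Lambda^{k-1})$.
   Context: Let $n\ge 2$, let $\Omega\subset\mathbb{R}^n$ be a bounded polyhedral domain and $\mathcal{G}_h$ a simplicial subdivision of $\Omega$. Forms. $d^k$ is the exterior derivative on $k$-forms, $\star$ the Hodge star, $\langle\cdot,\cdot\rangle_{L^2\Lambda^k}$ the $L^2(\Omega)$ inner product, and $\delta_k$ the codifferential on $k$-forms, i.e. the formal adjoint of $d^{k-1}$: $\langle d^{k-1}\mu,\eta\rangle_{L^2\Lambda^k}=\langle\mu,\delta_k\eta\rangle_{L^2\Lambda^{k-1}}$ whenever one of the smooth forms $\mu,\eta$ has compact support (thus $\delta_k=\pm\star d^{n-k}\star$). $H^*\Lambda^k(\Omega)=\{\mu\in L^2\Lambda^k(\Omega):\delta_k\mu\in L^2\Lambda^{k-1}(\Omega)\}$ with the graph norm, and $H^*_0\Lambda^k(\Omega)$ is the closure in it of smooth compactly supported forms. Whitney forms. $\mathcal{P}_0\Lambda^k$ denotes constant-coefficient $k$-forms. The Koszul operator is $\kappa(dx^{\alpha_1}\wedge\dots\wedge dx^{\alpha_k})=\sum_{j=1}^k(-1)^{j+1}x^{\alpha_j}dx^{\alpha_1}\wedge\dots\wedge\widehat{dx^{\alpha_j}}\wedge\dots\wedge dx^{\alpha_k}$; $\mathcal{P}_1^-\Lambda^k=\mathcal{P}_0\Lambda^k+\kappa(\mathcal{P}_0\Lambda^{k+1})$,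 $\mathcal{P}_1^{*,-}\Lambda^k=\star(\mathcal{P}_1^-\Lambda^{n-k})$. $\mathcal{P}_0\Lambda^k(\mathcal{G}_h)$, $\mathcal{P}_1^-\Lambda^k(\mathcal{G}_h)$, $\mathcal{P}_1^{*,-}\Lambda^k(\mathcal{G}_h)$ are the corresponding piecewise spaces (no inter-element continuity). $d^k_h$ is $d^k$ applied cell by cell. $\mathbf{P}^k_h$ is the $L^2\Lambda^k(\Omega)$ projection onto $\mathcal{P}_0\Lambda^k(\mathcal{G}_h)$. Spaces. $\mathbf{W}^*_{h0}\Lambda^k=\mathcal{P}_1^{*,-}\Lambda^k(\mathcal{G}_h)\cap H^*_0\Lambda^k(\Omega)$; for $0\le k\le n-1$, $\mathbf{W}^{\rm nc}_h\Lambda^k=\{\omega_h\in\mathcal{P}_1^-\Lambda^k(\mathcal{G}_h):\langle\omega_h,\delta_{k+1}\eta_h\rangle_{L^2\Lambda^k}-\langle d^k_h\omega_h,\eta_h\rangle_{L^2\Lambda^{k+1}}=0\ \forall\,\eta_h\in\mathbf{W}^*_{h0}\Lambda^{k+1}\}$. $\mathfrak{H}^{\rm nc}_h\Lambda^k$ is the $L^2$-orthogonal complement of $d^{k-1}_h(\mathbf{W}^{\rm nc}_h\Lambda^{k-1})$ in $\{\omega_h\in\mathbf{W}^{\rm nc}_h\Lambda^k:d^k_h\omega_h=0\}$. Norms: $\|\zeta\|_{\delta_{k+1}}=(\|\zeta\|^2_{L^2}+\|\delta_{k+1}\zeta\|^2_{L^2})^{1/2}$, $\|\sigma\|_{d^{k-1}_h}=(\|\sigma\|^2_{L^2}+\|d^{k-1}_h\sigma\|_{L^2}^2)^{1/2}$.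 Poincaré criterion: for a linear operator $T$ on a finite-dimensional subspace $D$ of a Hilbert space $X$ with values in a Hilbert space $Y$, let $D^{\lrcorner}$ be the orthogonal complement in $D$ of $\ker T$; $\mathsf{icr}(T,D)=\sup_{0\ne v\in D^{\lrcorner}}\|v\|_X/\|Tv\|_Y$ if $D^{\lrcorner}\ne\{0\}$, and $0$ otherwise (all norms here are $L^2$ norms). *)

(* Defs.v *)
From HB Require Import structures.
From mathcomp Require Import all_boot all_order all_algebra.
From mathcomp Require Import all_classical all_reals all_analysis.
Import Order.TTheory GRing.Theory Num.Theory.
Import numFieldNormedType.Exports.

Set Implicit Arguments.
Unset Strict Implicit.
Unset Printing Implicit Defensive.

Local Open Scope classical_set_scope.
Local Open Scope ring_scope.

(** * Lebesgue measure on R^n *)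

(* 'rV[R]_n carries the sigma-algebra generated by the coordinates, which is
   the Borel one; this is what the library does for n.-tuple R. *)
Definition rV_display : measure_display -> measure_display.
Proof. exact. Qed.

Section measurable_rV.
Context {R : realType} {n : nat}.

Let coors : 'I_n -> 'rV[R]_n -> R := fun i x => x ord0 i.

Let rV_set0 : g_sigma_preimage coors set0.
Proof. exact: sigma_algebra0. Qed.

Let rV_setC A : g_sigma_preimage coors A -> g_sigma_preimage coors (~` A).
Proof. exact: sigma_algebraC. Qed.

Let rV_bigcup (F : _^nat) : (forall i, g_sigma_preimage coors (F i)) ->
  g_sigma_preimage coors (\bigcup_i (F i)).
Proof. exact: sigma_algebra_bigcup. Qed.

HB.instance Definition _ :=
  @isMeasurable.Build (rV_display default_measure_display) 'rV[R]_n
    (g_sigma_preimage coors) rV_set0 rV_setC rV_bigcup.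

Lemma measurable_coord (i : 'I_n) :
  measurable_fun [set: 'rV[R]_n] (fun x : 'rV[R]_n => x ord0 i).
Proof.
move=> _ Y mY; rewrite setTI; apply: sub_sigma_algebra => /=.
rewrite -bigcup_seq/=; exists i => /=; first by rewrite mem_index_enum.
by exists Y => //; rewrite setTI.
Qed.

Lemma measurable_fun_coordP d (T : measurableType d) (f : T -> 'rV[R]_n) :
  (forall i, measurable_fun [set: T] (fun x => f x ord0 i)) ->
  measurable_fun [set: T] f.
Proof.
move=> mf.
suff h : g_sigma_preimage (fun i => coors i \o f) `<=` measurable.
  move: h; rewrite g_sigma_preimage_comp => h _ A mA.
  by apply: h; exists A.
apply: smallest_sub; first exact: sigma_algebra_measurable.
apply: (big_ind (fun X : set (set T) => X `<=` measurable)).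
- exact: sub0set.
- by move=> A B; rewrite subUset.
by move=> i _ A [B mB <-]; exact: mf.
Qed.

End measurable_rV.

Section lebesgue_rV.
Context {R : realType}.

Definition rV_cons n (p : R * 'rV[R]_n) : 'rV[R]_n.+1 :=
  \row_i oapp (p.2 ord0) p.1 (unlift ord0 i).

Definition rV_uncons n (x : 'rV[R]_n.+1) : R * 'rV[R]_n :=
  (x ord0 ord0, \row_i x ord0 (lift ord0 i)).

Lemma rV_consK n : cancel (@rV_cons n) (@rV_uncons n).
Proof.
move=> [a v]; congr (_, _); rewrite /= ?mxE ?unlift_none//.
by apply/rowP => i; rewrite !mxE liftK.
Qed.

Lemma rV_unconsK n : cancel (@rV_uncons n) (@rV_cons n).
Proof.
move=> x; apply/rowP => i; rewrite mxE.
by case: unliftP => [j|] -> //=; rewrite mxE.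
Qed.

Lemma measurable_rV_cons n :
  measurable_fun [set: measurableTypeR R * 'rV[R]_n] (@rV_cons n).
Proof.
apply: measurable_fun_coordP => i; under eq_fun do rewrite mxE.
case: (unlift ord0 i) => [j|] /=; last exact: measurable_fst.
by apply: (measurableT_comp (measurable_coord j)); exact: measurable_snd.
Qed.

Lemma measurable_rV_uncons n :
  measurable_fun [set: 'rV[R]_n.+1]
    (@rV_uncons n : _ -> measurableTypeR R * 'rV[R]_n).
Proof.
apply/measurable_fun_pair => /=; first exact: measurable_coord.
apply: measurable_fun_coordP => i.
by under eq_fun do rewrite mxE; exact: measurable_coord.
Qed.

Section step.
Context (n : nat) (mu : {sigma_finite_measure set 'rV[R]_n -> \bar R}).

Definition rV_measureS : set 'rV[R]_n.+1 -> \bar R :=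
  pushforward (@lebesgue_measure R \x mu)%E (@rV_cons n).

Let rV_measureS_measure : {measure set 'rV[R]_n.+1 -> \bar R} :=
  measure_function_pushforward__canonical__measure_function_Measure
    (@lebesgue_measure R \x mu)%E (@measurable_rV_cons n).

HB.instance Definition _ := Measure.copy rV_measureS rV_measureS_measure.

Let rV_measureS_sigma_finite : sigma_finite setT rV_measureS.
Proof.
have /sigma_finiteP[F [TF ndF Foo]] := sigma_finiteT (@lebesgue_measure R).
have /sigma_finiteP[G [TG ndG Goo]] := sigma_finiteT mu.
exists (fun k => @rV_uncons n @^-1` (F k `*` G k)).
  rewrite -preimage_bigcup; apply/esym/seteqP; split=> // x _ /=.
  have [a _ Fa] : (\bigcup_k F k) (rV_uncons x).1 by rewrite -TF.
  have [b _ Gb] : (\bigcup_k G k) (rV_uncons x).2 by rewrite -TG.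
  exists (maxn a b) => //; split.
  - by move: Fa; exact/subsetPset/ndF/leq_maxl.
  - by move: Gb; exact/subsetPset/ndG/leq_maxr.
move=> k; have [mF Fk] := Foo k; have [mG Gk] := Goo k; split.
  rewrite -[X in measurable X]setTI; apply: measurable_rV_uncons => //.
  exact: measurableX.
rewrite /rV_measureS /pushforward -comp_preimage.
rewrite (_ : _ \o _ = id); last by apply/funext => x /=; rewrite rV_consK.
by rewrite preimage_id product_measure1E// lte_mul_pinfty// ge0_fin_numE.
Qed.

HB.instance Definition _ :=
  Measure_isSigmaFinite.Build _ _ _ rV_measureS rV_measureS_sigma_finite.
End step.

(* n-fold product of the Lebesgue measure on R, carried over to row vectors *)
Fixpoint rV_lebesgue (n : nat) :
    {sigma_finite_measure set 'rV[R]_n -> \bar R} :=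
  match n with
  | 0%N => \d_(0 : 'rV[R]_0)
  | m.+1 => rV_measureS (rV_lebesgue m)
  end.

End lebesgue_rV.
Arguments rV_lebesgue R n : clear implicits.

(** * Differential forms *)

(* A form on R^n is the family of its components in the basis
   dx^S = dx^(s_1) /\ ... /\ dx^(s_k), for S = {s_1 < ... < s_k}; it is a
   k-form when the components with #|S| != k vanish. *)
Definition dform (R : realType) (n : nat) := {set 'I_n} -> 'rV[R]_n -> R.

Section forms.
Context {R : realType} {n : nat}.
Implicit Types (u v : dform R n) (S : {set 'I_n}) (k : nat).

Definition kform k : set (dform R n) :=
  [set u | forall S x, #|S| != k -> u S x = 0].

Definition partial (i : 'I_n) (f : 'rV[R]_n -> R) : 'rV[R]_n -> R :=
  fun x => 'D_(delta_mx ord0 i) f x.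

Definition smooth (f : 'rV[R]_n -> R) : Prop :=
  forall s : seq 'I_n, let g := foldr partial f s in
    continuous g /\ forall i x, derivable g x (delta_mx ord0 i).

(* dx^i /\ dx^(S :\ i) = wsgn i S dx^S for i \in S *)
Definition wsgn (i : 'I_n) S : R := (-1) ^+ #|[set j in S | (j < i)%N]%SET|.

Definition extd u : dform R n :=
  fun S x => \sum_(i in S) wsgn i S * partial i (u (S :\ i)) x.

Definition koszul u : dform R n :=
  fun S x => \sum_(i | i \notin S) wsgn i S * x ord0 i * u (i |: S) x.

(* dx^S /\ dx^(~: S) = hsgn S dx^[set: 'I_n] *)
Definition hsgn S : R :=
  (-1) ^+ #|[set p : 'I_n * 'I_n |
             [&& p.1 \in S, p.2 \notin S & (p.2 < p.1)%N]]%SET|.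

(* star dx^S = hsgn S dx^(~: S) *)
Definition star u : dform R n := fun S x => hsgn (~: S) * u (~: S) x.

Definition P0 k : set (dform R n) :=
  [set u | kform k u /\ forall S x y, u S x = u S y].

Definition P1minus k : set (dform R n) :=
  [set a + koszul b | a in P0 k & b in P0 k.+1].

Definition P1starminus k : set (dform R n) := star @` P1minus (n - k).

End forms.

(** * L^2 forms and the codifferential on an open set Om *)

Section l2.
Context {R : realType} {n : nat} (Om : set 'rV[R]_n).
Implicit Types (u v : dform R n) (k : nat).

(* Elements of L^2 are represented by functions; only their restriction to Om,
   up to a null set, is relevant. *)
Definition L2form k : set (dform R n) :=
  [set u | kform k u /\ forall S, measurable_fun Om (u S) /\
     (rV_lebesgue R n).-integrable Om (fun x => (u S x ^+ 2)%:E)].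

Definition L2ip u v : R :=
  \int[rV_lebesgue R n]_(x in Om) \sum_(S : {set 'I_n}) u S x * v S x.

Definition L2norm u : R := Num.sqrt (L2ip u u).

Definition test_form k : set (dform R n) :=
  [set u | kform k u /\ forall S, smooth (u S) /\
     exists K, [/\ compact K, K `<=` Om & forall x, ~ K x -> u S x = 0]].

(* v = delta_k u, of degree k - 1, as the formal adjoint of d^(k-1) *)
Definition is_codiff k u v : Prop :=
  L2form k.-1 v /\
  forall phi, test_form k.-1 phi -> L2ip (extd phi) u = L2ip phi v.

Definition codiff k u : dform R n := xget 0 [set v | is_codiff k u v].

Definition Hstar k : set (dform R n) :=
  [set u | L2form k u /\ exists v, is_codiff k u v].

Definition codiff_norm k u : R :=
  Num.sqrt (L2norm u ^+ 2 + L2norm (codiff k u) ^+ 2).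

Definition Hstar0 k : set (dform R n) :=
  [set u | Hstar k u /\
     forall e : R, 0 < e ->
       exists2 phi, test_form k phi & codiff_norm k (u - phi) < e].

End l2.

(** * Polyhedral domains and simplicial subdivisions *)

Section mesh.
Context {R : realType} {n : nat}.

(* Convex hull of the rows of V indexed by J *)
Definition face m (V : 'M[R]_(m, n)) (J : {set 'I_m}) : set 'rV[R]_n :=
  [set t *m V | t in [set t : 'rV[R]_m | [/\ forall i, 0 <= t ord0 i,
     forall i, i \notin J -> t ord0 i = 0 & \sum_i t ord0 i = 1]]].

Definition simplex m (V : 'M[R]_(m, n)) : set 'rV[R]_n := face V [set: 'I_m]%SET.

Definition affinely_independent m (V : 'M[R]_(m, n)) : bool :=
  row_free (row_mx V (const_mx 1 : 'cV[R]_m)).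

(* The boundary is a finite union of (n-1)-simplices. *)
Definition bounded_polyhedral_domain (Om : set 'rV[R]_n) : Prop :=
  [/\ Om !=set0, open Om, connected Om, bounded_set Om &
    exists F : seq 'M[R]_n, all (@affinely_independent n) F /\
      closure Om `\` Om = \bigcup_(V in [set` F]) simplex V].

(* vtx t lists the vertices of the cell t *)
Definition simplicial_subdivision (Om : set 'rV[R]_n) (T : finType)
    (vtx : T -> 'M[R]_(n.+1, n)) : Prop :=
  [/\ forall t, affinely_independent (vtx t),
      closure Om = \bigcup_t simplex (vtx t),
      forall t, (simplex (vtx t))^° `<=` Om,
      forall t t', t != t' ->
        (simplex (vtx t))^° `&` (simplex (vtx t'))^° = set0 &
      forall t t', exists J J',
        simplex (vtx t) `&` simplex (vtx t') = face (vtx t) J /\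
        face (vtx t) J = face (vtx t') J'].

End mesh.

(** * Poincare criterion *)

Section icr.
Context {R : realType} {V W : Type} (ipX : V -> V -> R) (ipY : W -> W -> R).

(* Equality to 0 in the Hilbert spaces X and Y is expressed by the norm, since
   V and W may consist of representatives. *)
Definition ker_complement (op : V -> W) (D : set V) : set V :=
  [set v | D v /\ forall u, D u -> ipY (op u) (op u) = 0 -> ipX v u = 0].

(* The supremum is 0 when the complement of the kernel is trivial, because
   [sup set0 = 0]. *)
Definition icr (op : V -> W) (D : set V) : R :=
  sup [set Num.sqrt (ipX v v) / Num.sqrt (ipY (op v) (op v)) |
       v in [set v | ker_complement op D v /\ ipX v v != 0]].

End icr.

(** * Discrete spaces *)

Section discrete.
Context {R : realType} {n : nat} (Om : set 'rV[R]_n).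
Context {T : finType} (vtx : T -> 'M[R]_(n.+1, n)).
Implicit Types (u v w : T -> dform R n) (k : nat).

(* A piecewise polynomial form is the family of its polynomial restrictions to
   the cells; [pw_form] is the form that it represents almost everywhere on
   Om. *)
Definition pw_form w : dform R n :=
  fun S x => \sum_(t : T) w t S x * \1_((simplex (vtx t))^°) x.

Definition ip u v : R := L2ip Om (pw_form u) (pw_form v).

Definition piecewise (P : set (dform R n)) : set (T -> dform R n) :=
  [set w | forall t, P (w t)].

Definition extd_h w : T -> dform R n := fun t => extd (w t).

Definition codiff_h k w : dform R n := codiff Om k (pw_form w).

Definition P0h k := piecewise (P0 k).

Definition proj_h k w : T -> dform R n :=
  xget 0 [set p | P0h k p /\ forall q, P0h k q -> ip p q = ip w q].

Definition Wstar0 k : set (T -> dform R n) :=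
  [set w | piecewise (P1starminus k) w /\ Hstar0 Om k (pw_form w)].

Definition Wnc k : set (T -> dform R n) :=
  [set w | piecewise (P1minus k) w /\ forall eta, Wstar0 k.+1 eta ->
     L2ip Om (pw_form w) (codiff_h k.+1 eta) - ip (extd_h w) eta = 0].

(* For k > 0 *)
Definition harmonic_nc k : set (T -> dform R n) :=
  [set w | [/\ Wnc k w, extd_h w = 0 &
     forall tau, Wnc k.-1 tau -> ip w (extd_h tau) = 0]].

Definition icr_codiff k : R := icr ip (L2ip Om) (codiff_h k) (Wstar0 k).

Definition icr_extd k : R := icr ip ip extd_h (Wnc k).

Definition extd_h_norm w : R :=
  Num.sqrt (L2norm Om (pw_form w) ^+ 2 + L2norm Om (pw_form (extd_h w)) ^+ 2).

Definition mixed_space k (w z s h : T -> dform R n) : Prop :=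
  [/\ P0h k w, Wstar0 k.+1 z, Wnc k.-1 s & harmonic_nc k h].

Definition mixed_solution k (f : dform R n) (w z s h : T -> dform R n) : Prop :=
  mixed_space k w z s h /\
  forall mu eta tau vs, mixed_space k mu eta tau vs ->
  [/\ ip w vs = 0,
      ip (proj_h k.+1 z) (proj_h k.+1 eta)
        - L2ip Om (pw_form w) (codiff_h k.+1 eta) = 0,
      ip (proj_h k.-1 s) (proj_h k.-1 tau) - ip w (extd_h tau) = 0 &
      ip h mu + L2ip Om (codiff_h k.+1 z) (pw_form mu) + ip (extd_h s) mu
        = L2ip Om f (pw_form mu)].

End discrete.

(* Main.v *)
(* Write S for the cellwise formal codifferential and T for d_h. A function of
   W*_{h0} has S as its weak codifferential, because the cell interiors are open
   and cover Om up to a null set. By the homotopy formula d kappa = k + 1 on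
   constant forms (and its Hodge dual), S and T map Whitney forms to piecewise
   constants, and their kernels consist of piecewise constants. Since
   delta delta = 0, S maps W*_{h0} Lambda^(k+1) into W*_{h0} Lambda^k, so the
   definition of W^nc makes the images of S and T orthogonal, and
     P_0 Lambda^k(G_h) = S(W*_{h0}) + T(W^nc) + H^nc
   is an orthogonal decomposition: a piecewise constant form lies in W^nc as soon
   as it is orthogonal to the image of S. The last equation thus determines
   S zeta, T sigma and theta; as the projections P_h are the identity on ker S
   and ker T, testing the second and third equations with these kernels puts
   zeta and sigma in their orthogonal complements, where the Poincare criteria
   apply. The remaining tests determine omega by its three components. *)

Require Import Defs.
From mathcomp Require Import all_boot all_order all_algebra.
From mathcomp Require Import all_classical all_reals all_analysis.
From mathcomp Require Import measurable_realfun.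
From mathcomp Require Import ring lra zify.
Import Order.TTheory GRing.Theory Num.Theory.
Import numFieldNormedType.Exports.
Set Implicit Arguments.
Unset Strict Implicit.
Unset Printing Implicit Defensive.
Local Open Scope classical_set_scope.
Local Open Scope ring_scope.

(** * Finite-dimensional inner product spaces *)

Section subspace.
Context {R : realType} {V : lmodType R}.
Implicit Types (D G : set V).

Definition subspace D := D 0 /\ forall a u v, D u -> D v -> D (a *: u + v).

Lemma subspace0 D : subspace D -> D 0. Proof. by case. Qed.

Lemma subspaceD D u v : subspace D -> D u -> D v -> D (u + v).
Proof. by move=> [_ h] Du Dv; rewrite -(scale1r u); exact: h. Qed.

Lemma subspaceZ D a u : subspace D -> D u -> D (a *: u).
Proof. by move=> [D0 h] Du; rewrite -(addr0 (a *: u)); exact: h. Qed.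

Lemma subspaceB D u v : subspace D -> D u -> D v -> D (u - v).
Proof.
by move=> lD Du Dv; rewrite -scaleN1r; apply: subspaceD => //; exact: subspaceZ.
Qed.

Lemma subspace_sum D m (b : 'I_m -> V) : subspace D -> (forall i, D (b i)) ->
  D (\sum_i b i).
Proof.
move=> lD Db; elim/big_ind: _ => //; first exact: subspace0.
by move=> u v; exact: subspaceD.
Qed.

Lemma subspaceI D G : subspace D -> subspace G -> subspace (D `&` G).
Proof.
move=> [D0 lD] [G0 lG]; split=> // a u v [Du Gu] [Dv Gv].
by split; [exact: lD|exact: lG].
Qed.

Definition spanned_by N (e : 'I_N -> V) D :=
  forall v, D v -> exists c : 'I_N -> R, v = \sum_i c i *: e i.

Definition finite_dim D := exists N (e : 'I_N -> V), spanned_by e D.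

Lemma sub_finite_dim D G : D `<=` G -> finite_dim G -> finite_dim D.
Proof. by move=> DG [N [e h]]; exists N, e => v /DG; exact: h. Qed.

Definition linear_on D (W : lmodType R) (L : V -> W) :=
  forall a u v, D u -> D v -> L (a *: u + v) = a *: L u + L v.

Section linear_on.
Context {D : set V} {W : lmodType R} {L : V -> W}.
Hypotheses (lD : subspace D) (lL : linear_on D L).

Lemma linear_on0 : L 0 = 0.
Proof.
have [D0 _] := lD; have := lL (-1) D0 D0.
by rewrite scaler0 addr0 scaleN1r addNr.
Qed.

Lemma linear_onD u v : D u -> D v -> L (u + v) = L u + L v.
Proof. by move=> Du Dv; rewrite -(scale1r u) lL// !scale1r. Qed.

Lemma linear_onZ a u : D u -> L (a *: u) = a *: L u.
Proof.
by move=> Du; rewrite -[LHS]addr0 -linear_on0 -[in LHS](addr0 (a *: u)) lL ?linear_on0 ?addr0//; case: lD.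
Qed.

Lemma linear_onB u v : D u -> D v -> L (u - v) = L u - L v.
Proof.
move=> Du Dv; have DNv : D (-1 *: v) by exact: subspaceZ.
by rewrite -scaleN1r linear_onD// linear_onZ// scaleN1r.
Qed.

Lemma linear_on_sum m (c : 'I_m -> R) (b : 'I_m -> V) : (forall i, D (b i)) ->
  L (\sum_i c i *: b i) = \sum_i c i *: L (b i).
Proof.
move=> Db.
suff [//] : D (\sum_i c i *: b i) /\
  L (\sum_i c i *: b i) = \sum_i c i *: L (b i).
elim/big_rec2: _ => [|i y1 y2 _ [Dy <-]].
  by split; [case: lD|exact: linear_on0].
have Dci : D (c i *: b i) by exact: subspaceZ.
by split; [exact: subspaceD|rewrite linear_onD// linear_onZ].
Qed.

End linear_on.

Lemma linear_on_sub D G (W : lmodType R) (L : V -> W) : D `<=` G ->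
  linear_on G L -> linear_on D L.
Proof. by move=> DG h a u v /DG Gu /DG; exact: h. Qed.

Definition form_on D (f : V -> V -> R) :=
  [/\ forall a u v w, D u -> D v -> D w ->
        f (a *: u + v) w = a * f u w + f v w,
      forall u v, D u -> D v -> f u v = f v u &
      forall u, D u -> 0 <= f u u].

Definition definite_on D (f : V -> V -> R) :=
  forall u, D u -> f u u = 0 -> u = 0.

Section form_on.
Context {D : set V} {f : V -> V -> R}.
Hypotheses (lD : subspace D) (hf : form_on D f).

Lemma form_linearl w : D w -> linear_on D (W := R^o) (f^~ w).
Proof. by move=> Dw a u v Du Dv /=; case: hf => -> //. Qed.

Lemma form_linearr w : D w -> linear_on D (W := R^o) (f w).
Proof.
move=> Dw a u v Du Dv /=; case: hf => h s _.
have Da : D (a *: u + v) by case: lD => _; exact.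
by rewrite s// h// !(s w).
Qed.

Lemma formDl u v w : D u -> D v -> D w -> f (u + v) w = f u w + f v w.
Proof. by move=> Du Dv /form_linearl/linear_onD; exact. Qed.
Lemma formBl u v w : D u -> D v -> D w -> f (u - v) w = f u w - f v w.
Proof. by move=> Du Dv /form_linearl/(linear_onB lD); exact. Qed.
Lemma formZl a u w : D u -> D w -> f (a *: u) w = a * f u w.
Proof. by move=> Du /form_linearl/(linear_onZ lD); exact. Qed.
Lemma formDr u v w : D u -> D v -> D w -> f w (u + v) = f w u + f w v.
Proof. by move=> Du Dv /form_linearr/linear_onD; exact. Qed.
Lemma formBr u v w : D u -> D v -> D w -> f w (u - v) = f w u - f w v.
Proof. by move=> Du Dv /form_linearr/(linear_onB lD); exact. Qed.
Lemma formZr a u w : D u -> D w -> f w (a *: u) = a * f w u.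
Proof. by move=> Du /form_linearr/(linear_onZ lD); exact. Qed.
Lemma form0l w : D w -> f 0 w = 0.
Proof. by move=> /form_linearl/(linear_on0 lD). Qed.
Lemma form0r w : D w -> f w 0 = 0.
Proof. by move=> /form_linearr/(linear_on0 lD). Qed.
Lemma formC u v : D u -> D v -> f u v = f v u.
Proof. by case: hf => _ + _; exact. Qed.
Lemma form_ge0 u : D u -> 0 <= f u u.
Proof. by case: hf => _ _; exact. Qed.

Lemma cauchy_schwarz_sqr u v : D u -> D v -> f u v ^+ 2 <= f u u * f v v.
Proof.
move=> Du Dv.
have key (t : R) : 0 <= t ^+ 2 * f u u - 2 * t * f u v + f v v.
  have Dt : D (t *: u) by exact: subspaceZ.
  have := form_ge0 (subspaceB lD Dt Dv).
  have Dtv := subspaceB lD Dt Dv.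
  rewrite formBl// !formBr// !formZl// !formZr// (formC Dv Du); nra.
have := form_ge0 Du; have := form_ge0 Dv.
have [uu0|uu0] := eqVneq (f u u) 0.
  have [-> _ _|uv0] := eqVneq (f u v) 0; first by rewrite expr0n/= uu0 mul0r.
  have := key ((f v v + 1) / (2 * f u v)); rewrite uu0 mulr0.
  have -> : 2 * ((f v v + 1) / (2 * f u v)) * f u v = f v v + 1 by field.
  by lra.
move=> vv uu; have := key (f u v / f u u).
have -> : (f u v / f u u) ^+ 2 * f u u - 2 * (f u v / f u u) * f u v + f v v =
  f v v - f u v ^+ 2 / f u u by field.
by rewrite subr_ge0 ler_pdivrMr ?lt_neqAle 1?eq_sym ?uu0// (mulrC (f v v)).
Qed.

Lemma cauchy_schwarz u v : D u -> D v ->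
  `|f u v| <= Num.sqrt (f u u) * Num.sqrt (f v v).
Proof.
move=> Du Dv; rewrite -sqrtrM ?form_ge0// -sqrtr_sqr ler_wsqrtr//.
exact: cauchy_schwarz_sqr.
Qed.

Lemma form_norm_triangle u v : D u -> D v ->
  Num.sqrt (f (u + v) (u + v)) <= Num.sqrt (f u u) + Num.sqrt (f v v).
Proof.
move=> Du Dv; have Duv : D (u + v) by exact: subspaceD.
rewrite -(@ler_pXn2r _ 2) ?nnegrE ?addr_ge0 ?sqrtr_ge0//.
rewrite sqr_sqrtr ?form_ge0// sqrrD !sqr_sqrtr ?form_ge0//.
rewrite formDl// !formDr// (formC Dv Du).
have := cauchy_schwarz Du Dv; rewrite ler_norml => /andP[_]; lra.
Qed.

Lemma form_normZ a u : D u ->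
  Num.sqrt (f (a *: u) (a *: u)) = `|a| * Num.sqrt (f u u).
Proof.
move=> Du; have Dau : D (a *: u) by exact: subspaceZ.
rewrite formZl// formZr// mulrA -expr2 sqrtrM ?sqr_ge0//.
by rewrite sqrtr_sqr.
Qed.

Lemma form_norm_sum m (b : 'I_m -> V) : (forall i, D (b i)) ->
  Num.sqrt (f (\sum_i b i) (\sum_i b i)) <= \sum_i Num.sqrt (f (b i) (b i)).
Proof.
move=> Db.
suff [//] : D (\sum_i b i) /\
  Num.sqrt (f (\sum_i b i) (\sum_i b i)) <= \sum_i Num.sqrt (f (b i) (b i)).
elim/big_rec2: _ => [|i y1 y2 _ [Dy h]].
  by rewrite form0l ?sqrtr0//; case: lD.
split; first exact: subspaceD.
by rewrite (le_trans (form_norm_triangle _ _))// lerD2l.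
Qed.

End form_on.

Lemma sub_form_on D G f : D `<=` G -> form_on G f -> form_on D f.
Proof.
move=> DG [h1 h2 h3]; split.
- by move=> a u v w /DG Gu /DG Gv /DG; exact: h1.
- by move=> u v /DG Gu /DG; exact: h2.
- by move=> u /DG; exact: h3.
Qed.

Lemma sub_definite_on D G f : D `<=` G -> definite_on G f -> definite_on D f.
Proof. by move=> DG h u /DG; exact: h. Qed.

Lemma orthonormal_coord f m (b : 'I_m -> V) (c : 'I_m -> R) j :
  (forall i j, f (b i) (b j) = (i == j)%:R) ->
  \sum_i c i *: (f (b i) (b j) : R^o) = c j.
Proof.
move=> bb; rewrite (bigD1 j)//= bb eqxx big1 => [|l /negbTE lj].
  by rewrite addr0; exact: mulr1.
by rewrite bb lj scaler0.
Qed.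

(* Orthonormal families in [D] have bounded length, and one of maximal length
   is a basis. *)
Lemma orthonormal_basis D f : subspace D -> finite_dim D -> form_on D f ->
  definite_on D f ->
  exists m (b : 'I_m -> V), [/\ forall i, D (b i),
    forall i j, f (b i) (b j) = (i == j)%:R &
    forall v, D v -> v = \sum_i f v (b i) *: b i].
Proof.
move=> lD [N [e he]] hf df.
pose P m := `[< exists b : 'I_m -> V, (forall i, D (b i)) /\
    forall i j, f (b i) (b j) = (i == j)%:R >].
have P0 : P 0%N by apply/asboolP; exists (fun=> 0); split; case.
have PN m : P m -> (m <= N)%N.
  move=> /asboolP[b [Db bb]].
  have /choice[c hc] i := he _ (Db i).
  pose B : 'M[R]_(m, N) := \matrix_(i, j) c i j.
  suff /eqP <- : row_free B by exact: rank_leq_col.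
  rewrite -kermx_eq0; apply/eqP/row_matrixP => i; rewrite row0.
  have /sub_kermxP hB := row_sub i (kermx B); move: (row i _) hB => x hB.
  have x0 : \sum_l x ord0 l *: b l = 0.
    transitivity (\sum_j (x *m B) ord0 j *: e j); last first.
      by rewrite hB big1// => j _; rewrite mxE scale0r.
    under eq_bigr do rewrite hc scaler_sumr.
    rewrite exchange_big; apply: eq_bigr => j _; rewrite mxE scaler_suml.
    by apply: eq_bigr => l _; rewrite scalerA [B l j]mxE.
  apply/rowP => j; rewrite [RHS]mxE.
  have := form0l lD hf (Db j).
  rewrite -x0 (linear_on_sum lD (form_linearl hf (Db j)))//.
  by rewrite orthonormal_coord.
have [m /asboolP[b [Db bb]] mmax] := @ex_maxnP P N (ex_intro (fun m => P m) 0%N P0) PN.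
exists m, b; split=> // v Dv.
set p := \sum_i _; apply: contrapT => vp.
have Dp : D p by apply: subspace_sum => // i; exact: subspaceZ.
have Dr : D (v - p) by exact: subspaceB.
have rb j : f (v - p) (b j) = 0.
  rewrite (formBl lD hf)// (linear_on_sum lD (form_linearl hf (Db j)))//.
  by rewrite orthonormal_coord// subrr.
have rr : 0 < f (v - p) (v - p).
  rewrite lt_neqAle (form_ge0 hf)// andbT eq_sym; apply/eqP => /(df _ Dr).
  by move/eqP; rewrite subr_eq0 => /eqP.
set s := Num.sqrt (f (v - p) (v - p)).
have s0 : 0 < s by rewrite sqrtr_gt0.
pose b' (i : 'I_m.+1) := oapp b (s^-1 *: (v - p)) (unlift ord0 i).
have Ds : D (s^-1 *: (v - p)) by exact: subspaceZ.
suff /mmax : P m.+1 by rewrite ltnn.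
apply/asboolP; exists b'; split=> [i|i j]; rewrite /b'.
  by case: unliftP => [j _|_] /=.
case: unliftP => [i' ->|->] /=; case: unliftP => [j' ->|->] /=.
- by rewrite bb (inj_eq lift_inj).
- by rewrite (formC hf)// (formZl lD hf)// rb mulr0.
- by rewrite (formZl lD hf)// rb mulr0.
- rewrite (formZl lD hf)// (formZr lD hf)// mulrA -invfM -expr2.
  by rewrite sqr_sqrtr ?mulVf ?gt_eqF// (form_ge0 hf).
Qed.

Lemma riesz D f (L : V -> R) : subspace D -> finite_dim D -> form_on D f ->
  definite_on D f -> linear_on D (W := R^o) L ->
  exists2 r, D r & forall v, D v -> f r v = L v.
Proof.
move=> lD fD hf df lL; have [m [b [Db bb hb]]] := orthonormal_basis lD fD hf df.
exists (\sum_i L (b i) *: b i).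
  by apply: subspace_sum => // i; exact: subspaceZ.
move=> v Dv; rewrite (linear_on_sum lD (form_linearl hf Dv))// {2}(hb v)//.
rewrite (linear_on_sum lD lL)//; apply: eq_bigr => i _; rewrite (formC hf)//.
exact: mulrC.
Qed.

End subspace.

(** * Mixed problems for two operators with orthogonal images *)

Section kernel_complement.
Context {R : realType} {V : lmodType R} {ip : V -> V -> R} {G : set V}.
Hypotheses (lG : subspace G) (fG : finite_dim G).
Hypotheses (hip : form_on G ip) (dip : definite_on G ip).
Context {D : set V} {T : V -> V}.
Hypotheses (lD : subspace D) (DG : D `<=` G).
Hypotheses (lT : linear_on D T) (TG : forall v, D v -> G (T v)).

Let nrm u := Num.sqrt (ip u u).

Definition kernel_perp : set V :=
  [set v | D v /\ forall u, D u -> T u = 0 -> ip v u = 0].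

Lemma kernel_perp_subspace : subspace kernel_perp.
Proof.
split; first split; first exact: subspace0.
  by move=> u /DG Gu _; rewrite (form0l lG hip).
move=> a u v [Du hu] [Dv hv]; split; first by case: lD => _; exact.
move=> w Dw Tw; have [h _ _] := hip.
by rewrite h ?hu ?hv ?mulr0 ?addr0//; exact: DG.
Qed.

Lemma kernel_split v : D v ->
  exists u, [/\ D u, T u = 0 & kernel_perp (v - u)].
Proof.
move=> Dv; pose K := [set u | D u /\ T u = 0].
have lK : subspace K.
  split; first by split; [exact: subspace0|exact: (linear_on0 lD lT)].
  move=> a x y [Dx Tx] [Dy Ty]; split; first by case: lD => _; exact.
  by rewrite lT// Tx Ty scaler0 addr0.
have KG : K `<=` G by move=> x [/DG].
have [r [Dr Tr] hr] := riesz lK (sub_finite_dim KG fG) (sub_form_on KG hip)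
  (sub_definite_on KG dip)
  (linear_on_sub (fun x Kx => KG x Kx) (form_linearr lG hip (DG Dv))).
exists r; split=> //; split; first exact: subspaceB.
move=> u Du Tu; rewrite (formBl lG hip) ?hr ?subrr//; exact: DG.
Qed.

Lemma image_form_on : form_on D (fun u v => ip (T u) (T v)).
Proof.
have [h s g] := hip; split.
- by move=> a u v w Du Dv Dw; rewrite lT// h//; exact: TG.
- by move=> u v Du Dv; rewrite s//; exact: TG.
- by move=> u Du; exact/g/TG.
Qed.

Let perpD : kernel_perp `<=` D. Proof. by move=> x []. Qed.

Lemma image_definite_on :
  definite_on kernel_perp (fun u v => ip (T u) (T v)).
Proof.
move=> u [Du hu] /dip Tu; apply: dip; first exact: DG.
exact/hu/Tu/TG.
Qed.

Let perp_riesz L : linear_on kernel_perp (W := R^o) L ->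
  exists2 r, kernel_perp r & forall v, kernel_perp v -> ip (T r) (T v) = L v.
Proof.
move=> lL; apply: (riesz (f := fun u v => ip (T u) (T v))) => //.
- exact: kernel_perp_subspace.
- by apply: sub_finite_dim fG => x /perpD/DG.
- exact: sub_form_on image_form_on.
- exact: image_definite_on.
Qed.

Lemma image_riesz L : linear_on D (W := R^o) L ->
  (forall u, D u -> T u = 0 -> L u = 0) ->
  exists2 r, kernel_perp r & forall v, D v -> ip (T r) (T v) = L v.
Proof.
move=> lL L0; have [r kr hr] := perp_riesz (linear_on_sub perpD lL).
exists r => // v Dv; have [u [Du Tu kvu]] := kernel_split Dv.
have Dvu := perpD kvu.
rewrite -[v in LHS](subrK u) (linear_onD lT)// Tu addr0 hr//.
by rewrite (linear_onB lD lL)// (L0 u)// subr0.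
Qed.

Lemma kernel_perp_bound :
  exists c, forall v, kernel_perp v -> nrm v <= c * nrm (T v).
Proof.
have [m [b [kb bb hb]]] := orthonormal_basis kernel_perp_subspace
  (sub_finite_dim (subset_trans perpD DG) fG) (sub_form_on perpD image_form_on)
  image_definite_on.
exists (\sum_i nrm (b i)) => v kv; have Dv := perpD kv.
have Gb i : G (b i) by exact/DG/perpD.
rewrite /nrm [in leLHS](hb v kv) (le_trans (form_norm_sum lG hip _))//.
  by move=> i; exact: subspaceZ.
rewrite mulr_suml ler_sum// => i _; rewrite (form_normZ lG hip)// mulrC.
rewrite ler_wpM2l ?sqrtr_ge0// (le_trans (cauchy_schwarz lG hip _ _))//.
- exact: TG.
- exact/TG/perpD.
- by rewrite bb eqxx sqrtr1 mulr1.
Qed.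

Lemma kernel_perp_icr v : kernel_perp v ->
  nrm v <= sup [set nrm u / nrm (T u) |
    u in [set u | kernel_perp u /\ ip u u != 0]] * nrm (T v).
Proof.
move=> kv; have Gv : G v by exact/DG/perpD.
have [vv0|vv0] := eqVneq (ip v v) 0.
  have -> : v = 0 by exact: dip.
  by rewrite (linear_on0 lD lT) /nrm (form0l lG hip) ?sqrtr0 ?mulr0//; case: lG.
have [c hc] := kernel_perp_bound.
have pos u : kernel_perp u -> ip u u != 0 -> 0 < nrm (T u).
  move=> ku uu; have Du := perpD ku.
  rewrite sqrtr_gt0 lt_neqAle (form_ge0 hip (TG Du)) andbT eq_sym.
  apply: contra uu => /eqP /(image_definite_on ku) ->.
  by rewrite (form0l lG hip)//; case: lG.
rewrite -ler_pdivrMr ?pos//; apply: sup_upper_bound; last by exists v.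
split; first by exists (nrm v / nrm (T v)), v.
by exists c => _ [u [ku uu] <-]; rewrite ler_pdivrMr ?pos// hc.
Qed.

End kernel_complement.

Lemma le_of_sqr_le {R : realType} (x c : R) : 0 <= c -> x * x <= c * x -> x <= c.
Proof. by move=> c0 h; rewrite leNgt; apply/negP => cx; nra. Qed.

Section mixed_problem.
Context {R : realType} {V : lmodType R} {ip : V -> V -> R} {G : set V}.
Hypotheses (lG : subspace G) (fG : finite_dim G).
Hypotheses (hip : form_on G ip) (dip : definite_on G ip).
Context {P D B : set V} {S T : V -> V}.
Hypotheses (lP : subspace P) (PG : P `<=` G).
Hypotheses (lD : subspace D) (DG : D `<=` G).
Hypotheses (lB : subspace B) (BG : B `<=` G).
Hypotheses (lS : linear_on D S) (SP : forall v, D v -> P (S v)).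
Hypotheses (lT : linear_on B T) (TP : forall v, B v -> P (T v)).
Hypothesis ST_orth : forall u v, D u -> B v -> ip (S u) (T v) = 0.
Context {p q : V -> V -> R}.
Hypotheses (p_linr : forall u, D u -> linear_on D (W := R^o) (p u)).
Hypotheses (q_linr : forall u, B u -> linear_on B (W := R^o) (q u)).
Hypothesis p_ker : forall u v, D u -> D v -> S v = 0 -> p u v = ip u v.
Hypothesis q_ker : forall u v, B u -> B v -> T v = 0 -> q u v = ip u v.

Let nrm u := Num.sqrt (ip u u).

Definition harmonic_on : set V := [set h | [/\ P h,
  forall u, D u -> ip h (S u) = 0 & forall v, B v -> ip h (T v) = 0]].

Let SG v : D v -> G (S v). Proof. by move=> /SP/PG. Qed.
Let TG v : B v -> G (T v). Proof. by move=> /TP/PG. Qed.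
Let nrm_ge0 u : 0 <= nrm u. Proof. exact: sqrtr_ge0. Qed.
Let nrmE u : G u -> nrm u * nrm u = ip u u.
Proof. by move=> Gu; rewrite -expr2 sqr_sqrtr// (form_ge0 hip). Qed.
Let CS u v : G u -> G v -> `|ip u v| <= nrm u * nrm v.
Proof. exact: cauchy_schwarz. Qed.

Lemma harmonic_on_subspace : subspace harmonic_on.
Proof.
split; first split; first exact: subspace0.
- by move=> u Du; rewrite (form0l lG hip)//; exact: SG.
- by move=> u Du; rewrite (form0l lG hip)//; exact: TG.
move=> a u v [Pu hu1 hu2] [Pv hv1 hv2]; have [h _ _] := hip.
split; first by case: lP => _; exact.
- by move=> x Dx; rewrite h ?hu1 ?hv1 ?mulr0 ?addr0//; [exact: PG|exact: PG|exact: SG].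
- by move=> x Dx; rewrite h ?hu2 ?hv2 ?mulr0 ?addr0//; [exact: PG|exact: PG|exact: TG].
Qed.

Lemma hodge_decomposition m : P m ->
  exists u v, [/\ kernel_perp (ip := ip) (D := D) (T := S) u,
    kernel_perp (ip := ip) (D := B) (T := T) v & harmonic_on (m - S u - T v)].
Proof.
move=> Pm; have Gm := PG Pm.
have [||u ku hu] := image_riesz lG fG hip dip lD DG lS SG
  (L := fun x => ip m (S x)).
- by move=> a x y Bx By; rewrite lS// (form_linearr lG hip Gm)//; exact: SG.
- by move=> x Bx ->; rewrite (form0r lG hip).
have [||v kv hv] := image_riesz lG fG hip dip lB BG lT TG
  (L := fun x => ip m (T x)).
- by move=> a x y Bx By; rewrite lT// (form_linearr lG hip Gm)//; exact: TG.
- by move=> x Bx ->; rewrite (form0r lG hip).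
have [Du _] := ku; have [Bv _] := kv.
have Gmu : G (m - S u) by apply: subspaceB => //; exact: SG.
exists u, v; split=> //; split.
- by apply: subspaceB; [|apply: subspaceB|]; auto.
- move=> x Dx; rewrite !(formBl lG hip)//; do ?[exact: SG|exact: TG].
  rewrite hu// subrr (formC hip) ?ST_orth ?subrr//; do ?[exact: SG|exact: TG].
- move=> x Bx; rewrite !(formBl lG hip)//; do ?[exact: SG|exact: TG].
  by rewrite hv// ST_orth// subr0 subrr.
Qed.

Definition mixed_sol (F : V -> R) (w z s h : V) : Prop :=
  [/\ P w, D z, B s & harmonic_on h] /\
  [/\ forall x, harmonic_on x -> ip w x = 0,
      forall x, D x -> p z x = ip w (S x),
      forall x, B x -> q s x = ip w (T x) &
      forall x, P x -> ip h x + ip (S z) x + ip (T s) x = F x].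

Lemma mixed_sol_exists F : linear_on P (W := R^o) F ->
  exists w z s h, mixed_sol F w z s h.
Proof.
move=> lF.
have [||z kz hz] := image_riesz lG fG hip dip lD DG lS SG
  (L := fun x => F (S x)).
- by move=> a x y Bx By; rewrite lS// lF//; exact: SP.
- by move=> x Bx ->; rewrite (linear_on0 lP lF).
have [||s ks hs] := image_riesz lG fG hip dip lB BG lT TG
  (L := fun x => F (T x)).
- by move=> a x y Bx By; rewrite lT// lF//; exact: TP.
- by move=> x Bx ->; rewrite (linear_on0 lP lF).
have HP : harmonic_on `<=` P by move=> x [].
have HG : harmonic_on `<=` G by move=> x /HP/PG.
have [h Hh hh] := riesz harmonic_on_subspace (sub_finite_dim HG fG)
  (sub_form_on HG hip) (sub_definite_on HG dip) (linear_on_sub HP lF).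
have [[Dz kzP] [Bs ksP]] := (kz, ks).
have [||y ky hy] := image_riesz lG fG hip dip lD DG lS SG (L := p z).
- exact: p_linr.
- by move=> x Dx Sx; rewrite p_ker// kzP.
have [||t kt ht] := image_riesz lG fG hip dip lB BG lT TG (L := q s).
- exact: q_linr.
- by move=> x Bx Tx; rewrite q_ker// ksP.
have [[Dy _] [Bt _]] := (ky, kt).
have [Hh1 Hh2 Hh3] := Hh.
exists (S y + T t), z, s, h; split; split=> //.
- by apply: subspaceD => //; [exact: SP|exact: TP].
- move=> x [/PG Gx xS xT]; have [Gy Gt] := (SG Dy, TG Bt).
  by rewrite (formDl hip)// !(formC hip _ Gx)// xS// xT// addr0.
- move=> x Dx; have [[Gy Gt] Gx] := (SG Dy, TG Bt, SG Dx).
  by rewrite (formDl hip)// hy// (formC hip Gt Gx) ST_orth// addr0.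
- move=> x Bx; have [[Gy Gt] Gx] := (SG Dy, TG Bt, TG Bx).
  by rewrite (formDl hip)// ht// ST_orth// add0r.
move=> x Px; have [u [v [[Du _] [Bv _] hx]]] := hodge_decomposition Px.
set r := x - S u - T v in hx.
have xE : x = S u + T v + r by rewrite addrC /r -[_ - T v]addrA -opprD subrK.
clearbody r.
have [[[Gu Gv] Gz] Gs] := (SG Du, TG Bv, SG Dz, TG Bs).
have [Gr Gh] := (HG _ hx, HG _ Hh).
have [[Pu Pv] Pr] := (SP Du, TP Bv, HP _ hx).
have Guv : G (S u + T v) by exact: subspaceD.
have Puv : P (S u + T v) by exact: subspaceD.
have [_ rS rT] := hx.
rewrite {1 2 3}xE !(formDr lG hip)//.
rewrite Hh2// Hh3// hz// ST_orth// (formC hip Gs Gu) ST_orth// hs//.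
rewrite (formC hip Gz Gr) rS// (formC hip Gs Gr) rT// hh//.
rewrite !addr0 !add0r xE !(linear_onD lF)//.
by rewrite -addrA addrC.
Qed.

Context {a b : R}.
Hypotheses (a_ge0 : 0 <= a) (b_ge0 : 0 <= b).
Hypothesis a_bound : forall v,
  kernel_perp (ip := ip) (D := D) (T := S) v -> nrm v <= a * nrm (S v).
Hypothesis b_bound : forall v,
  kernel_perp (ip := ip) (D := B) (T := T) v -> nrm v <= b * nrm (T v).
Hypothesis p_le : forall u v, D u -> D v -> `|p u v| <= nrm u * nrm v.
Hypothesis q_le : forall u v, B u -> B v -> `|q u v| <= nrm u * nrm v.

Lemma mixed_sol_bound F N w z s h : 0 <= N ->
  (forall x, P x -> `|F x| <= N * nrm x) -> mixed_sol F w z s h ->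
  [/\ nrm w <= (a * a + b * b) * N, nrm z <= a * N, nrm (S z) <= N,
      nrm s <= b * N /\ nrm (T s) <= N & nrm h <= N].
Proof.
move=> N0 FN [[Pw Dz Bs [Ph hS hT]] [e1 e2 e3 e4]].
have [[Gw Gz] Gs] := (PG Pw, SG Dz, TG Bs).
have Gh : G h by exact: PG.
have bnd x : P x -> ip x x = F x -> nrm x <= N.
  move=> Px xx; apply: le_of_sqr_le => //; rewrite nrmE ?xx; last exact: PG.
  by rewrite (le_trans (ler_norm _))// FN.
have hN : nrm h <= N.
  apply: bnd => //; rewrite -e4// (formC hip Gz)// hS// (formC hip Gs)// hT//.
  by rewrite !addr0.
have SzN : nrm (S z) <= N.
  apply: bnd; first exact: SP.
  by rewrite -e4 ?hS// ?(formC hip Gs)// ?ST_orth// ?add0r ?addr0//; exact: SP.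
have TsN : nrm (T s) <= N.
  apply: bnd; first exact: TP.
  by rewrite -e4 ?hT// ?ST_orth// ?add0r//; exact: TP.
have kz : kernel_perp (ip := ip) (D := D) (T := S) z.
  by split=> // u Du Su; rewrite -p_ker// e2// Su (form0r lG hip).
have ks : kernel_perp (ip := ip) (D := B) (T := T) s.
  by split=> // u Du Tu; rewrite -q_ker// e3// Tu (form0r lG hip).
have zN : nrm z <= a * N by rewrite (le_trans (a_bound kz))// ler_wpM2l.
have sN : nrm s <= b * N by rewrite (le_trans (b_bound ks))// ler_wpM2l.
split=> //.
have [u [v [ku kv hx]]] := hodge_decomposition Pw.
have [[Du _] [Bv _]] := (ku, kv).
set r := w - S u - T v in hx.
have wE : w = S u + T v + r by rewrite addrC /r -[_ - T v]addrA -opprD subrK.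
clearbody r.
have [Gu Gv] := (SG Du, TG Bv); have [/PG Gr rS rT] := hx.
have Guv : G (S u + T v) by exact: subspaceD.
have wSu : ip (S u) (S u) = ip w (S u).
  rewrite {1}wE !(formDl hip)// rS// (formC hip Gv Gu) ST_orth//.
  by rewrite !addr0.
have wTv : ip (T v) (T v) = ip w (T v).
  by rewrite {1}wE !(formDl hip)// rT// ST_orth// addr0 add0r.
have ww : ip w w = p z u + q s v.
  rewrite {2}wE !(formDr lG hip)// (e1 r)// addr0 e2// e3//.
have Su_le : nrm (S u) <= nrm w.
  apply: le_of_sqr_le; rewrite // nrmE// wSu (le_trans (ler_norm _))//.
  exact: CS.
have Tv_le : nrm (T v) <= nrm w.
  apply: le_of_sqr_le; rewrite // nrmE// wTv (le_trans (ler_norm _))//.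
  exact: CS.
apply: le_of_sqr_le; first by rewrite mulr_ge0// addr_ge0// mulr_ge0.
rewrite nrmE// ww.
have bound1 : p z u <= a * a * N * nrm w.
  rewrite (le_trans (ler_norm _))// (le_trans (p_le Dz Du))//.
  rewrite (@le_trans _ _ ((a * N) * (a * nrm w)))//; last first.
    by rewrite le_eqVlt; apply/orP; left; apply/eqP; ring.
  by rewrite ler_pM// (le_trans (a_bound ku))// ler_wpM2l.
have bound2 : q s v <= b * b * N * nrm w.
  rewrite (le_trans (ler_norm _))// (le_trans (q_le Bs Bv))//.
  rewrite (@le_trans _ _ ((b * N) * (b * nrm w)))//; last first.
    by rewrite le_eqVlt; apply/orP; left; apply/eqP; ring.
  by rewrite ler_pM// (le_trans (b_bound kv))// ler_wpM2l.
by rewrite (le_trans (lerD bound1 bound2))// -mulrDl -mulrDl.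
Qed.

Hypotheses (p_linl : forall u, D u -> linear_on D (W := R^o) (p^~ u)).
Hypotheses (q_linl : forall u, B u -> linear_on B (W := R^o) (q^~ u)).

Lemma mixed_sol_unique F w z s h w' z' s' h' :
  mixed_sol F w z s h -> mixed_sol F w' z' s' h' ->
  [/\ w' = w, z' = z, s' = s & h' = h].
Proof.
move=> [[Pw Dz Bs Hh] [e1 e2 e3 e4]] [[Pw' Dz' Bs' Hh'] [e1' e2' e3' e4']].
have HG : harmonic_on `<=` G by move=> x [/PG].
have Gw := PG Pw; have Gw' := PG Pw'.
have eq0 u v : G u -> G v -> nrm (v - u) <= 0 -> v = u.
  move=> Gu Gv; rewrite -sqrtr0 ler_sqrt// => h0; apply/eqP; rewrite -subr_eq0.
  have Gvu : G (v - u) by exact: subspaceB.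
  by apply/eqP/dip => //; apply/le_anti; rewrite h0 (form_ge0 hip).
suff sol : mixed_sol (fun=> 0) (w' - w) (z' - z) (s' - s) (h' - h).
  have [|h1 h2 _ [h3 _] h4] := mixed_sol_bound (lexx 0) _ sol.
    by move=> x Px; rewrite normr0 mul0r.
  rewrite !mulr0 in h1 h2 h3.
  by split; apply: eq0 => //; do ?[exact: DG|exact: BG|exact: HG].
split; split.
- exact: subspaceB.
- exact: subspaceB.
- exact: subspaceB.
- exact: (subspaceB harmonic_on_subspace).
- by move=> x Hx; rewrite (formBl lG hip) ?e1 ?e1' ?subrr//; exact: HG.
- move=> x Dx; rewrite (linear_onB lD (p_linl Dx))// e2// e2'//.
  by rewrite (formBl lG hip)//; exact: SG.
- move=> x Bx; rewrite (linear_onB lB (q_linl Bx))// e3// e3'//.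
  by rewrite (formBl lG hip)//; exact: TG.
- move=> x Px; have Gx := PG Px.
  rewrite (linear_onB lD lS)// (linear_onB lB lT)// !(formBl lG hip)//;
    do ?[exact: SG|exact: TG|exact: HG].
  by move: (e4 x Px) (e4' x Px); lra.
Qed.

End mixed_problem.

(** * Open sets, boxes and hyperplanes *)

Section continuous_fun.
Context {R : realType} {T : topologicalType}.
Implicit Types f g : T -> R.

Lemma fun_continuousD f g : continuous f -> continuous g ->
  continuous (fun x => f x + g x).
Proof. by move=> cf cg x; apply: cvgD; [exact: cf|exact: cg]. Qed.

Lemma fun_continuousM f g : continuous f -> continuous g ->
  continuous (fun x => f x * g x).
Proof. by move=> cf cg x; apply: cvgM; [exact: cf|exact: cg]. Qed.

End continuous_fun.

Section boxes.
Context {R : realType} {n : nat}.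
Implicit Types (a b x : 'rV[R]_n) (U : set 'rV[R]_n).

Definition box a b : set 'rV[R]_n :=
  [set x | forall i, a ord0 i < x ord0 i < b ord0 i].

Definition cbox a b : set 'rV[R]_n :=
  [set x | forall i, a ord0 i <= x ord0 i <= b ord0 i].

Lemma box_cbox a b : box a b `<=` cbox a b.
Proof. by move=> x h i; case/andP: (h i) => /ltW -> /ltW ->. Qed.

Lemma continuous_coord (i : 'I_n) : continuous (fun x : 'rV[R]_n => x ord0 i).
Proof. exact: coord_continuous. Qed.

Lemma compact_cbox a b : compact (cbox a b).
Proof.
have := @rV_compact R n (fun i => `[a ord0 i, b ord0 i]%classic)
  (fun i => @segment_compact _ _ _).
by congr compact; apply/seteqP; split=> x h i; have := h i; rewrite /= in_itv.
Qed.

Lemma measurable_box a b : measurable (box a b).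
Proof.
rewrite (_ : box a b = \bigcap_(i in [set: 'I_n])
    ((fun x : 'rV[R]_n => x ord0 i) @^-1` `]a ord0 i, b ord0 i[%classic)).
  apply: fin_bigcap_measurable => // i _; rewrite -[X in measurable X]setTI.
  exact: measurable_coord.
apply/seteqP; split=> x h i; first by move=> _ /=; rewrite in_itv/=; exact: h.
by have := h i I; rewrite /= in_itv.
Qed.

Lemma measurable_cbox a b : measurable (cbox a b).
Proof.
rewrite (_ : cbox a b = \bigcap_(i in [set: 'I_n])
    ((fun x : 'rV[R]_n => x ord0 i) @^-1` `[a ord0 i, b ord0 i]%classic)).
  apply: fin_bigcap_measurable => // i _; rewrite -[X in measurable X]setTI.
  exact: measurable_coord.
apply/seteqP; split=> x h i; first by move=> _ /=; rewrite in_itv/=; exact: h.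
by have := h i I; rewrite /= in_itv.
Qed.

Definition ratv (q : 'rV[rat]_n) : 'rV[R]_n := \row_i ratr (q ord0 i).

Lemma open_box_sub U x : open U -> U x ->
  exists q1 q2, box (ratv q1) (ratv q2) x /\ cbox (ratv q1) (ratv q2) `<=` U.
Proof.
move=> oU Ux; have /nbhs_ballP[e /= e0 xeU] := open_nbhs_nbhs (conj oU Ux).
have h i : exists p : rat * rat, [/\ x ord0 i - e < ratr p.1,
    ratr p.1 < x ord0 i, x ord0 i < ratr p.2 & ratr p.2 < x ord0 i + e].
  have [|q1] := @rat_in_itvoo R (x ord0 i - e) (x ord0 i).
    by rewrite ltrBlDr ltrDl.
  have [|q2] := @rat_in_itvoo R (x ord0 i) (x ord0 i + e).
    by rewrite ltrDl.
  rewrite !in_itv/= => /andP[h1 h2] /andP[h3 h4].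
  by exists (q1, q2).
have [p hp] := choice h.
exists (\row_i (p i).1), (\row_i (p i).2); split.
  by move=> i; rewrite !mxE; case: (hp i) => _ -> ->.
move=> y hy; apply: xeU; split=> // i j; rewrite (ord1 i).
have := hy j; rewrite !mxE /ball/= => /andP[h1 h2].
case: (hp j) => h3 h4 h5 h6; rewrite ltr_norml; lra.
Qed.

Lemma open_bigcup_box U : open U -> U = \bigcup_(q in
    [set q : 'rV[rat]_n * 'rV[rat]_n | cbox (ratv q.1) (ratv q.2) `<=` U])
  box (ratv q.1) (ratv q.2).
Proof.
move=> oU; apply/seteqP; split=> [x Ux|x [q /= qU /box_cbox/qU//]].
by have [q1 [q2 [xq qU]]] := open_box_sub oU Ux; exists (q1, q2).
Qed.

Lemma measurable_open U : open U -> measurable U.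
Proof.
move=> /open_bigcup_box ->; rewrite bigcup_mkcond.
apply: countable_bigcupT_measurable => // q; case: ifPn => // _.
exact: measurable_box.
Qed.

Lemma measurable_continuous (f : 'rV[R]_n -> R) (D : set 'rV[R]_n) :
  continuous f -> measurable D -> measurable_fun D f.
Proof.
move=> cf mD; apply: (measurable_funS measurableT) => //.
apply: (measurability _ (RGenOpens.measurableE R)).
move=> _ [_ [a [b ->]] <-]; rewrite setTI; apply: measurable_open.
by apply: open_comp; [move=> x _; exact: cf|exact: interval_open].
Qed.

Lemma bounded_cbox (A : set 'rV[R]_n) : bounded_set A ->
  exists2 M, 0 <= M & A `<=` cbox (const_mx (- M)) (const_mx M).
Proof.
move=> [M [Mreal hM]]; exists (`|M| + 1); first by rewrite addr_ge0.
move=> x Ax i; rewrite !mxE -ler_norml.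
have : `|x| <= `|M| + 1.
  by apply: (hM (`|M| + 1)) => //; rewrite (le_lt_trans (ler_norm _))// ltrDl.
apply: le_trans; have /mapP[j Hj ->] : `|x ord0 i| \in
    [seq `|x z.1 z.2| | z : 'I_1 * 'I_n].
  by apply/mapP; exists (ord0, i) => //=; rewrite mem_enum.
by rewrite [leRHS]/Num.Def.normr /= mx_normrE; apply/bigmax_geP; right => /=; exists j.
Qed.

End boxes.

Section lebesgue.
Context {R : realType}.

Lemma rV_lebesgueS n (A : set 'rV[R]_n.+1) :
  rV_lebesgue R n.+1 A =
  (@lebesgue_measure R \x rV_lebesgue R n)%E (@rV_cons R n @^-1` A).
Proof. by []. Qed.

Lemma rV_cons0 n (p : R * 'rV[R]_n) : rV_cons p ord0 ord0 = p.1.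
Proof. by rewrite mxE unlift_none. Qed.

Lemma rV_consS n (p : R * 'rV[R]_n) i : rV_cons p ord0 (lift ord0 i) = p.2 ord0 i.
Proof. by rewrite mxE liftK. Qed.

Lemma lebesgue_cbox n (a b : 'rV[R]_n) :
  rV_lebesgue R n (cbox a b) = (\prod_(i < n) Num.max (b ord0 i - a ord0 i) 0)%:E.
Proof.
elim: n a b => [|n IH] a b.
  by rewrite big_ord0 /= diracE mem_set//; case.
rewrite rV_lebesgueS.
have -> : @rV_cons R n @^-1` cbox a b = `[a ord0 ord0, b ord0 ord0]%classic `*`
    cbox (rV_uncons a).2 (rV_uncons b).2.
  apply/seteqP; split=> p /=.
    move=> h; split; first by rewrite /= in_itv/=; have := h ord0; rewrite rV_cons0.
    by move=> i; have := h (lift ord0 i); rewrite rV_consS !mxE.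
  move=> [/= + h] i; rewrite in_itv/= => h0.
  case: (unliftP ord0 i) => [j|] ->; last by rewrite rV_cons0.
  by rewrite rV_consS; have := h j; rewrite !mxE.
rewrite product_measure1E//; last exact: measurable_cbox.
rewrite IH big_ord_recl EFinM; congr (_ * _)%E.
  apply: (etrans (lebesgue_measure_itv `[a ord0 ord0, b ord0 ord0])) => /=.
  rewrite lte_fin; case: ltP => h.
    by rewrite -EFinB max_l// subr_ge0 ltW.
  by rewrite max_r// subr_le0.
by congr (_%:E); apply: eq_bigr => i _; rewrite !mxE.
Qed.

Lemma lebesgue_box_gt0 n (a b : 'rV[R]_n) : (forall i, a ord0 i < b ord0 i) ->
  (0 < rV_lebesgue R n (box a b))%E.
Proof.
move=> ab; pose m := \row_i ((2 * a ord0 i + b ord0 i) / 3).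
pose p := \row_i ((a ord0 i + 2 * b ord0 i) / 3).
have sub : cbox m p `<=` box a b.
  by move=> x h i; have := h i; have := ab i; rewrite !mxE; lra.
rewrite (@lt_le_trans _ _ (rV_lebesgue R n (cbox m p)))//; last first.
  by apply: le_measure => //; rewrite inE; [exact: measurable_cbox|exact: measurable_box].
rewrite lebesgue_cbox lte_fin prodr_gt0// => i _.
by rewrite lt_max !mxE; have := ab i => h; apply/orP; left; lra.
Qed.

Lemma lebesgue_open_gt0 n (U : set 'rV[R]_n) : open U -> U !=set0 ->
  (0 < rV_lebesgue R n U)%E.
Proof.
move=> oU [x Ux]; have [q1 [q2 [xq qU]]] := open_box_sub oU Ux.
rewrite (@lt_le_trans _ _ (rV_lebesgue R n (box (ratv q1) (ratv q2))))//.
  by apply: lebesgue_box_gt0 => i; have /andP[] := xq i; exact: lt_trans.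
apply: le_measure; rewrite ?inE//; do ?exact: measurable_box.
  exact: measurable_open.
by move=> y /box_cbox /qU.
Qed.

Lemma lebesgue_bounded n (A : set 'rV[R]_n) : measurable A -> bounded_set A ->
  (rV_lebesgue R n A < +oo)%E.
Proof.
move=> mA /bounded_cbox[M M0 AM].
rewrite (@le_lt_trans _ _ (rV_lebesgue R n (cbox (const_mx (- M)) (const_mx M))))//.
  by apply: le_measure => //; rewrite inE//; exact: measurable_cbox.
by rewrite lebesgue_cbox ltry.
Qed.

Definition affine_fun n (g : 'rV[R]_n -> R) := exists c (a : 'rV[R]_n),
  forall x, g x = c + \sum_i a ord0 i * x ord0 i.

Lemma affine_continuous n (g : 'rV[R]_n -> R) : affine_fun g -> continuous g.
Proof.
move=> [c [a /funext ->]]; apply: fun_continuousD; first exact: cst_continuous.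
apply: continuous_big => [|i _]; first exact: add_continuous.
apply: fun_continuousM; first exact: cst_continuous.
exact: continuous_coord.
Qed.

Lemma lebesgue_hyperplane n (c : R) (a : 'rV[R]_n) : a != 0 ->
  rV_lebesgue R n [set x | c + \sum_i a ord0 i * x ord0 i = 0] = 0%E.
Proof.
elim: n c a => [|n IH] c a a0; first by case/eqP: a0; apply/rowP; case.
have mH m (d : R) (e : 'rV[R]_m) :
    measurable [set x : 'rV[R]_m | d + \sum_i e ord0 i * x ord0 i = 0].
  rewrite (_ : mkset _ = (fun x : 'rV_m => d + \sum_i e ord0 i * x ord0 i) @^-1` [set 0]).
    rewrite -[X in measurable X]setTI; apply: measurable_continuous => //.
    by apply: affine_continuous; exists d, e.
  by [].
rewrite rV_lebesgueS.
set A := _ @^-1` _.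
have mA : measurable A.
  rewrite -[A]setTI; apply: measurable_rV_cons => //; exact: mH.
have aE (p : R * 'rV[R]_n) : c + \sum_i a ord0 i * rV_cons p ord0 i =
    c + a ord0 ord0 * p.1 + \sum_i (rV_uncons a).2 ord0 i * p.2 ord0 i.
  rewrite big_ord_recl rV_cons0 addrA; congr (_ + _).
  by apply: eq_bigr => i _; rewrite rV_consS !mxE.
have [a'0|a'0] := eqVneq (rV_uncons a).2 0; last first.
  rewrite /product_measure1; apply: integral0_eq => t _ /=.
  rewrite -[RHS](IH (c + a ord0 ord0 * t) _ a'0); congr (rV_lebesgue R n _).
  by apply/seteqP; split=> v; rewrite /xsection/= inE /A/= aE.
have a00 : a ord0 ord0 != 0.
  apply: contra a0 => /eqP a00; apply/eqP/rowP => i; rewrite mxE.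
  case: (unliftP ord0 i) => [j|] ->; last by rewrite a00.
  by have /rowP/(_ j) := a'0; rewrite !mxE.
have -> : A = [set - c / a ord0 ord0] `*` [set: 'rV[R]_n].
  apply/seteqP; split=> p; rewrite /A /= aE a'0 big1 ?addr0;
    do ?[by move=> i _; rewrite mxE mul0r].
    move=> h; split=> //; apply: (mulfI a00).
    by rewrite [RHS]mulrC divfK//; lra.
  by move=> [-> _]; rewrite [_ * (_ / _)]mulrC divfK// subrr.
rewrite product_measure1E//.
by rewrite -[RHS](mul0e (rV_lebesgue R n setT)); congr (_ * _)%E; exact: lebesgue_measure_set1.
Qed.


End lebesgue.

(** * Integration of partial derivatives *)

Section slices.
Context {R : realType} {n : nat}.
Implicit Types (t : R) (v : 'rV[R]_n).

Lemma rV_cons_headD h t v :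
  rV_cons (h + t, v) = h *: delta_mx ord0 ord0 + rV_cons (t, v).
Proof.
apply/rowP => i; rewrite !mxE eqxx /=.
case: unliftP => [j|] -> /=; first by rewrite mulr0 add0r.
by rewrite mulr1.
Qed.

Lemma rV_cons_tailD h j t v : rV_cons (t, h *: delta_mx ord0 j + v) =
  h *: delta_mx ord0 (lift ord0 j) + rV_cons (t, v).
Proof.
apply/rowP => i; rewrite !mxE eqxx /=.
case: unliftP => [l|] -> /=; last by rewrite mulr0 add0r.
by rewrite !mxE eqxx (inj_eq lift_inj).
Qed.

Lemma rV_cons_head_continuous v : continuous (fun t => rV_cons (t, v)).
Proof.
move=> t A /nbhs_ballP[e /= e0 eA]; apply/nbhs_ballP; exists e => //= s ts.
apply: eA; split=> // i j; rewrite !(ord1 i) !mxE.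
by case: unliftP => [l|] _ //=; exact: ballxx.
Qed.

Lemma rV_cons_tail_continuous t : continuous (fun v => rV_cons (t, v)).
Proof.
move=> v A /nbhs_ballP[e /= e0 eA]; apply/nbhs_ballP; exists e => //= w [_ vw].
apply: eA; split=> // i j; rewrite !(ord1 i) !mxE.
by case: unliftP => [l|] _ /=; [exact: vw|exact: ballxx].
Qed.

Context (f : 'rV[R]_n.+1 -> R).

Let quotient_head t v :
  (fun h : R => h^-1 *: (((fun s => f (rV_cons (s, v))) \o shift t) (h *: 1) -
    f (rV_cons (t, v)))) =
  (fun h : R => h^-1 *: ((f \o shift (rV_cons (t, v)))
    (h *: delta_mx ord0 ord0) - f (rV_cons (t, v)))).
Proof. by apply/funext => h /=; rewrite -rV_cons_headD [h *: 1]mulr1. Qed.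

Let quotient_tail j t v :
  (fun h : R => h^-1 *: (((fun w => f (rV_cons (t, w))) \o shift v)
    (h *: delta_mx ord0 j) - f (rV_cons (t, v)))) =
  (fun h : R => h^-1 *: ((f \o shift (rV_cons (t, v)))
    (h *: delta_mx ord0 (lift ord0 j)) - f (rV_cons (t, v)))).
Proof. by apply/funext => h /=; rewrite -rV_cons_tailD. Qed.

Lemma derivable_head t v :
  derivable f (rV_cons (t, v)) (delta_mx ord0 ord0) ->
  derivable (fun s => f (rV_cons (s, v))) t 1.
Proof. by rewrite /derivable quotient_head. Qed.

Lemma derive_head t v :
  'D_1 (fun s => f (rV_cons (s, v))) t = partial ord0 f (rV_cons (t, v)).
Proof. by rewrite /partial /derive quotient_head. Qed.

Lemma derivable_tail j t v :
  derivable f (rV_cons (t, v)) (delta_mx ord0 (lift ord0 j)) ->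
  derivable (fun w => f (rV_cons (t, w))) v (delta_mx ord0 j).
Proof. by rewrite /derivable quotient_tail. Qed.

Lemma partial_tail j t v : partial j (fun w => f (rV_cons (t, w))) v =
  partial (lift ord0 j) f (rV_cons (t, v)).
Proof. by rewrite /partial /derive quotient_tail. Qed.

End slices.

Section fubini.
Context {R : realType} {n : nat} (g : 'rV[R]_n.+1 -> \bar R).
Hypothesis ig : (rV_lebesgue R n.+1).-integrable setT g.

Let ig' : (@lebesgue_measure R \x rV_lebesgue R n)%E.-integrable setT
  (g \o @rV_cons R n).
Proof.
have [mg goo] := integrableP _ _ _ ig; apply/integrableP; split.
  by apply: (measurable_comp measurableT _ mg) => //; exact: measurable_rV_cons.
move: goo; rewrite (@ge0_integral_pushforward _ _ _ _ R _
  (@measurable_rV_cons R n) (@lebesgue_measure R \x rV_lebesgue R n)%E)//.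
exact: measurableT_comp.
Qed.

Let gE : (\int[rV_lebesgue R n.+1]_x g x =
  \int[(@lebesgue_measure R \x rV_lebesgue R n)]_p (g \o @rV_cons R n) p)%E.
Proof.
have [mg _] := integrableP _ _ _ ig.
by rewrite (@integral_pushforward _ _ _ _ R _ (@measurable_rV_cons R n)
  (@lebesgue_measure R \x rV_lebesgue R n)%E).
Qed.

Lemma rV_fubini_head : (\int[rV_lebesgue R n.+1]_x g x =
  \int[@lebesgue_measure R]_t \int[rV_lebesgue R n]_v g (rV_cons (t, v)))%E.
Proof. by rewrite gE -integral12_prod_meas1. Qed.

Lemma rV_fubini_tail : (\int[rV_lebesgue R n.+1]_x g x =
  \int[rV_lebesgue R n]_v \int[@lebesgue_measure R]_t g (rV_cons (t, v)))%E.
Proof. by rewrite gE -integral21_prod_meas1. Qed.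

End fubini.

Section integral_partial.
Context {R : realType}.

Definition supported n (M : R) (f : 'rV[R]_n -> R) :=
  forall (x : 'rV[R]_n) i, M < `|x ord0 i| -> f x = 0.

Lemma open_norm_gt (M : R) : open [set t : R | M < `|t|].
Proof.
apply: (open_comp (f := fun t : R => `|t|) (D := [set t : R | M < t])).
  by move=> t _; exact: norm_continuous.
exact: open_gt.
Qed.

Lemma supported_partial n M (f : 'rV[R]_n -> R) i :
  supported M f -> supported M (partial i f).
Proof.
move=> sf x j xj; rewrite /partial.
rewrite (@near_eq_derive _ _ _ _ (cst 0)) ?derive_cst//.
have : open ((fun y : 'rV[R]_n => y ord0 j) @^-1` [set t | M < `|t|]).
  by apply: open_comp => [y _|]; [exact: continuous_coord|exact: open_norm_gt].
rewrite openE => /(_ x xj).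
by apply: filterS => y; exact: sf.
Qed.

Lemma integrable_supported n M (f : 'rV[R]_n -> R) : continuous f ->
  supported M f -> (rV_lebesgue R n).-integrable setT (EFin \o f).
Proof.
move=> cf sf; pose K : set 'rV[R]_n := cbox (const_mx (- M)) (const_mx M).
have mK : measurable K by exact: measurable_cbox.
have Koo : (rV_lebesgue R n K < +oo)%E by rewrite lebesgue_cbox ltry.
have -> : EFin \o f = (EFin \o f) \_ K.
  apply/funext => x; rewrite patchE; case: ifPn => //= /negP xK.
  have [i xi] : exists i, M < `|x ord0 i|.
    apply: contrapT => /forallNP h; apply: xK; rewrite inE => i; rewrite !mxE.
    by rewrite -ler_norml leNgt; apply/negP/h.
  by rewrite (sf x i).
apply/(integrable_mkcond _ mK)/measurable_bounded_integrable => //.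
- exact: measurable_continuous.
have [|N [Nr hN]] := @compact_bounded R R^o (f @` K).
  apply: continuous_compact; first exact: continuous_subspaceT.
  exact: compact_cbox.
by exists N; split=> // e Ne x Kx; apply: hN => //; exists x.
Qed.

Lemma integral_derive_supported (M : R) (f : R -> R) :
  (forall t, derivable f t 1) -> continuous ('D_1 f) ->
  (forall t, M < `|t| -> f t = 0) ->
  (\int[@lebesgue_measure R]_t ('D_1 f t)%:E = 0)%E.
Proof.
move=> df cdf sf; pose N : R := `|M| + 1.
have MN : M < N by rewrite (le_lt_trans (ler_norm _))// ltrDl.
have N0 : 0 < N by rewrite ltr_wpDl.
have sdf t : M < `|t| -> 'D_1 f t = 0.
  move=> Mt; rewrite (@near_eq_derive _ _ _ _ (cst 0)) ?derive_cst//.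
  have := @open_norm_gt M.
  by rewrite openE => /(_ t); move=> /(_ Mt); apply: filterS => s; exact: sf.
transitivity (\int[@lebesgue_measure R]_(t in `[(- N)%R, N]) ('D_1 f t)%:E)%E.
  rewrite [RHS]integral_mkcond; apply: eq_integral => t _.
  rewrite patchE; case: ifPn => //= /negP tN; rewrite sdf//.
  rewrite ltNge; apply/negP => tM; apply: tN; rewrite inE/= in_itv/=.
  by rewrite -ler_norml (le_trans tM)// ltW.
have cf : continuous f.
  move=> t; apply/differentiable_continuous; exact/derivable1_diffP.
rewrite (@continuous_FTC2 _ _ f) ?gtrN//.
- rewrite !sf ?normrN ?subee// gtr0_norm//.
- exact: continuous_subspaceT.
- split; first by move=> t _; exact: df.
    by apply: cvg_at_right_filter; exact: cf.
  by apply: cvg_at_left_filter; exact: cf.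
- by move=> t _; rewrite derive1E.
Qed.

Lemma integral_partial n M (f : 'rV[R]_n -> R) i : continuous f ->
  (forall x, derivable f x (delta_mx ord0 i)) -> continuous (partial i f) ->
  supported M f -> (\int[rV_lebesgue R n]_x (partial i f x)%:E = 0)%E.
Proof.
elim: n => [|n IH] in f i *; first by case: i.
move=> cf df cdf sf.
have ig := integrable_supported cdf (supported_partial i sf).
case: (unliftP ord0 i) => [j|] iE; subst i.
  rewrite rV_fubini_head//; apply: integral0_eq => t _.
  rewrite -[RHS](IH (fun v => f (rV_cons (t, v))) j).
  - by apply: eq_integral => v _; rewrite /= partial_tail.
  - by move=> v; apply: continuous_comp; [exact: rV_cons_tail_continuous|exact: cf].
  - by move=> v; exact: derivable_tail.
  - move=> v; rewrite (_ : partial _ _ = fun v => partial (lift ord0 j) f (rV_cons (t, v))).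
      by apply: continuous_comp; [exact: rV_cons_tail_continuous|exact: cdf].
    by apply/funext => w; rewrite partial_tail.
  - by move=> v l vl; apply: (sf _ (lift ord0 l)); rewrite rV_consS.
rewrite rV_fubini_tail//; apply: integral0_eq => v _.
rewrite -[RHS](@integral_derive_supported M (fun t => f (rV_cons (t, v)))).
- by apply: eq_integral => t _; rewrite /= derive_head.
- by move=> t; exact: derivable_head.
- move=> t; rewrite (_ : 'D_1 (fun t : R => f (rV_cons (t, v))) = fun t : R => partial ord0 f (rV_cons (t, v))).
    by apply: continuous_comp; [exact: rV_cons_head_continuous|exact: cdf].
  by apply/funext => s; rewrite derive_head.
- by move=> t vl; apply: (sf _ ord0); rewrite rV_cons0.
Qed.

End integral_partial.

(** * Smooth functions *)

Section smooth_closure.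
Context {R : realType} {n : nat}.
Implicit Types (f g : 'rV[R]_n -> R) (x : 'rV[R]_n) (i j : 'I_n).

Lemma smooth_coind (A : set ('rV[R]_n -> R)) :
  (forall f, A f -> [/\ continuous f,
     forall i x, derivable f x (delta_mx ord0 i) & forall i, A (partial i f)]) ->
  forall f, A f -> smooth f.
Proof.
move=> hA f Af s /=; suff /hA[] : A (foldr partial f s) by [].
by elim: s => //= i s /hA[_ _]; exact.
Qed.

Lemma smooth_continuous f : smooth f -> continuous f.
Proof. by move=> /(_ [::])[]. Qed.

Lemma smooth_derivable f i x : smooth f -> derivable f x (delta_mx ord0 i).
Proof. by move=> /(_ [::])[_]; exact. Qed.

Lemma smooth_partial f i : smooth f -> smooth (partial i f).
Proof. by move=> sf s; have := sf (rcons s i); rewrite foldr_rcons. Qed.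

Inductive smooth_alg : ('rV[R]_n -> R) -> Prop :=
| SmoothBase f : smooth f -> smooth_alg f
| SmoothAdd f g : smooth_alg f -> smooth_alg g -> smooth_alg (f + g)
| SmoothMul f g : smooth_alg f -> smooth_alg g -> smooth_alg (f * g).

Lemma partialD f g i : (forall x, derivable f x (delta_mx ord0 i)) ->
  (forall x, derivable g x (delta_mx ord0 i)) ->
  partial i (f + g) = partial i f + partial i g.
Proof. by move=> df dg; apply/funext => x; rewrite /partial deriveD. Qed.

Lemma partialM f g i : (forall x, derivable f x (delta_mx ord0 i)) ->
  (forall x, derivable g x (delta_mx ord0 i)) ->
  partial i (f * g) = f * partial i g + g * partial i f.
Proof. by move=> df dg; apply/funext => x; rewrite /partial deriveM. Qed.

Lemma smooth_alg_smooth f : smooth_alg f -> smooth f.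
Proof.
move: f; apply: smooth_coind => f.
elim=> {f} [f sf|f g _ [cf df hf] _ [cg dg hg]|f g sf [cf df hf] sg [cg dg hg]].
- split; [exact: smooth_continuous|by move=> i x; exact: smooth_derivable|].
  by move=> i; apply/SmoothBase/smooth_partial.
- split=> [|i x|i]; first exact: fun_continuousD.
    exact: derivableD.
  by rewrite partialD//; exact: SmoothAdd.
- split=> [|i x|i]; first exact: fun_continuousM.
    exact: derivableM.
  by rewrite partialM//; apply: SmoothAdd; exact: SmoothMul.
Qed.

Lemma smoothD f g : smooth f -> smooth g -> smooth (f + g).
Proof.
by move=> sf sg; apply: smooth_alg_smooth; apply: SmoothAdd; exact: SmoothBase.
Qed.

Lemma smoothM f g : smooth f -> smooth g -> smooth (f * g).
Proof.
by move=> sf sg; apply: smooth_alg_smooth; apply: SmoothMul; exact: SmoothBase.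
Qed.

Lemma is_derive_affine c (a x : 'rV[R]_n) i :
  is_derive x (delta_mx ord0 i) (fun y => c + \sum_j a ord0 j * y ord0 j)
    (a ord0 i).
Proof.
have h : (fun h : R => h^-1 *: (((fun y => c + \sum_j a ord0 j * y ord0 j) \o
      shift x) (h *: delta_mx ord0 i) - (c + \sum_j a ord0 j * x ord0 j)))
    @ 0^' --> a ord0 i.
  apply: cvg_near_cst; near=> h; rewrite /= opprD addrACA subrr add0r.
  rewrite -sumrB (bigD1 i)//= big1 => [|j /negbTE ji].
    have h0 : h != 0 by near: h; exact: nbhs_dnbhs_neq.
    by rewrite !mxE !eqxx mulr1 addr0 -[LHS]/(h^-1 * _); field.
  by rewrite !mxE eqxx ji mulr0 add0r subrr.
by apply: DeriveDef; [apply/cvg_ex; eexists; exact: h|exact: cvg_lim h].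
Unshelve. all: by end_near. Qed.

Lemma affine_derivable f x i : affine_fun f -> derivable f x (delta_mx ord0 i).
Proof.
move=> [c [a /funext ->]]; by case: (is_derive_affine c a x i).
Qed.

Lemma partial_affine c (a : 'rV[R]_n) i :
  partial i (fun y => c + \sum_j a ord0 j * y ord0 j) = cst (a ord0 i).
Proof.
apply/funext => x; by rewrite /partial; case: (is_derive_affine c a x i).
Qed.

Lemma affine_cst c : affine_fun (cst c : 'rV[R]_n -> R).
Proof.
by exists c, 0 => x; rewrite big1 ?addr0// => i _; rewrite mxE mul0r.
Qed.

Lemma affine_smooth f : affine_fun f -> smooth f.
Proof.
move: f; apply: smooth_coind => f af; split; first exact: affine_continuous.
  by move=> i x; exact: affine_derivable.
move=> i; move: af => [c [a /funext ->]]; rewrite partial_affine.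
exact: affine_cst.
Qed.

Lemma smooth_cst c : smooth (cst c : 'rV[R]_n -> R).
Proof. exact/affine_smooth/affine_cst. Qed.

Lemma smoothN f : smooth f -> smooth (- f).
Proof.
move=> sf; rewrite (_ : - f = cst (-1) * f); first exact: smoothM (smooth_cst _) sf.
by apply/funext => x; rewrite !fctE mulN1r.
Qed.

Lemma smooth_sum (I : Type) (r : seq I) (P : pred I) (F : I -> 'rV[R]_n -> R) :
  (forall k, P k -> smooth (F k)) -> smooth (fun x => \sum_(k <- r | P k) F k x).
Proof.
move=> sF; elim: r => [|k r IH].
  rewrite [X in smooth X](_ : _ = cst 0); first exact: smooth_cst.
  by apply/funext => x; rewrite big_nil.
have [Pk|Pk] := boolP (P k).
  rewrite [X in smooth X](_ : _ = F k + (fun x => \sum_(k <- r | P k) F k x)).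
    exact: smoothD (sF _ Pk) IH.
  by apply/funext => x; rewrite big_cons Pk.
rewrite [X in smooth X](_ : _ = fun x => \sum_(k <- r | P k) F k x)//.
by apply/funext => x; rewrite big_cons (negbTE Pk).
Qed.

Lemma smooth_prod (I : Type) (r : seq I) (F : I -> 'rV[R]_n -> R) :
  (forall k, smooth (F k)) -> smooth (fun x => \prod_(k <- r) F k x).
Proof.
move=> sF; elim: r => [|k r IH].
  rewrite [X in smooth X](_ : _ = cst 1); first exact: smooth_cst.
  by apply/funext => x; rewrite big_nil.
rewrite [X in smooth X](_ : _ = F k * (fun x => \prod_(k <- r) F k x)).
  exact: smoothM (sF _) IH.
by apply/funext => x; rewrite big_cons.
Qed.

End smooth_closure.

Section schwarz.
Context {R : realType} {n : nat}.
Implicit Types (f : 'rV[R]_n -> R) (x v w : 'rV[R]_n) (i j : 'I_n).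

Lemma is_derive_line f x v (s : R) : derivable f (x + s *: v) v ->
  is_derive s 1 (fun t : R => f (x + t *: v)) ('D_v f (x + s *: v)).
Proof.
move=> df.
have E : (fun h : R => h^-1 *: (((fun t : R => f (x + t *: v)) \o shift s)
      (h *: 1) - f (x + s *: v))) =
    (fun h : R => h^-1 *: ((f \o shift (x + s *: v)) (h *: v) - f (x + s *: v))).
  apply/funext => h /=; rewrite [h *: 1]mulr1 scalerDl.
  by rewrite [_ + (x + _)]addrCA [x + (_ + _)]addrC addrC.
by apply: DeriveDef; rewrite /derivable /derive E.
Qed.

Lemma mvt_line f x i (v := delta_mx ord0 i) (h : R) : 0 < h ->
  (forall y, derivable f y v) ->
  exists2 s, 0 < s < h & f (x + h *: v) - f x = h * partial i f (x + s *: v).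
Proof.
move=> h0 df.
have dl (s : R) : is_derive s 1 (fun t : R => f (x + t *: v)) ('D_v f (x + s *: v)).
  exact: is_derive_line.
have [|s sh] := MVT h0 (fun s _ => dl s).
  apply: continuous_subspaceT => s; apply/differentiable_continuous.
  exact/derivable1_diffP/(@ex_derive _ _ _ _ _ _ _ (dl s)).
rewrite subr0 scale0r addr0 mulrC => ->; exists s => //.
Qed.

Lemma mvt_square f x i j (v := delta_mx ord0 i) (w := delta_mx ord0 j) (h : R) :
  0 < h -> (forall y, derivable f y v) -> (forall y, derivable (partial i f) y w) ->
  exists s t, [/\ 0 < s < h, 0 < t < h &
    f (x + h *: v + h *: w) - f (x + h *: v) - (f (x + h *: w) - f x) =
    h * (h * partial j (partial i f) (x + s *: v + t *: w))].
Proof.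
move=> h0 df ddf.
pose fw y := f (y + h *: w).
have E y : (fun k : R => k^-1 *: ((fw \o shift y) (k *: v) - fw y)) =
    (fun k : R => k^-1 *: ((f \o shift (y + h *: w)) (k *: v) - f (y + h *: w))).
  by apply/funext => k /=; rewrite /fw addrA.
have dfw y : derivable fw y v by rewrite /derivable E; exact: df.
have pfw y : partial i fw y = partial i f (y + h *: w).
  by rewrite /partial /derive E.
have dg y : derivable (fw - f) y v by exact: derivableB.
have pg y : partial i (fw - f) y = partial i f (y + h *: w) - partial i f y.
  by rewrite -pfw /partial; apply: deriveB.
have [s sh e] := @mvt_line (fw - f) x i h h0 dg.
have [t th e'] := @mvt_line (partial i f) (x + s *: v) j h h0 ddf.
by exists s, t; split=> //; rewrite -e' -pg -e.
Qed.

Let square_cancel (a b c d h p q : R) : 0 < h ->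
  a - b - (c - d) = h * (h * p) -> a - c - (b - d) = h * (h * q) -> p = q.
Proof.
move=> h0 e1 e2; apply: (mulfI (lt0r_neq0 h0)); apply: (mulfI (lt0r_neq0 h0)).
by rewrite -e1 -e2; ring.
Qed.

Let eq_of_close (a b : R) :
  (forall e : R, 0 < e -> exists c, `|a - c| < e /\ `|b - c| < e) -> a = b.
Proof.
move=> h; apply/eqP; rewrite -subr_eq0; apply/negPn/negP => ab.
have [|c [ac bc]] := h (`|a - b| / 2); first by rewrite divr_gt0 ?normr_gt0.
have : `|a - b| <= `|a - c| + `|b - c|.
  by rewrite (le_trans _ (ler_normB _ _))// opprB addrA subrK.
by move: ac bc; lra.
Qed.

Let continuous_close f x : continuous f -> forall e : R, 0 < e ->
  exists2 d : R, 0 < d & forall y : 'rV[R]_n, ball x d y -> `|f x - f y| < e.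
Proof.
move=> cf e e0; have /cvgrPdist_lt/(_ _ e0)/nbhs_ballP[d /= d0 h] := cf x.
by exists d => // y xy; exact: h.
Qed.

Lemma partialC f i j : smooth f ->
  partial i (partial j f) = partial j (partial i f).
Proof.
move=> sf; apply/funext => x.
have cij := @smooth_continuous _ _ _ (smooth_partial i (smooth_partial j sf)).
have cji := @smooth_continuous _ _ _ (smooth_partial j (smooth_partial i sf)).
have [->//|ij] := eqVneq i j.
apply: eq_of_close => eps e2.
have [d2 d20 h2] := continuous_close x cij e2.
have [d1 d10 h1] := continuous_close x cji e2.
pose h : R := Num.min d1 d2.
have h0 : 0 < h by rewrite lt_min d10.
have near_x k l s t : 0 < s < h -> 0 < t < h -> k != l ->
    forall d, h <= d -> ball x d (x + s *: delta_mx ord0 k + t *: delta_mx ord0 l).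
  move=> /andP[s0 sh] /andP[t0 th] kl d hd; split.
    exact: lt_le_trans hd.
  move=> a b; rewrite (ord1 a) !mxE eqxx /= /ball /= distrC.
  rewrite -addrA addrAC subrr add0r.
  have [->|bk] := eqVneq b k.
    by rewrite (negbTE kl) mulr1 mulr0 addr0 gtr0_norm// (lt_le_trans sh).
  rewrite mulr0 add0r; case: (b == l).
    by rewrite mulr1 gtr0_norm// (lt_le_trans th).
  by rewrite mulr0 normr0 (lt_le_trans h0).
have [s [t [sh th e1]]] := mvt_square (j := j) x h0
  (fun y => @smooth_derivable R n f i y sf)
  (fun y => @smooth_derivable R n _ j y (smooth_partial i sf)).
have [s' [t' [sh' th' e2']]] := mvt_square (j := i) x h0
  (fun y => @smooth_derivable R n f j y sf)
  (fun y => @smooth_derivable R n _ i y (smooth_partial j sf)).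
have hd1 : h <= d1 by rewrite ge_min lexx.
have hd2 : h <= d2 by rewrite ge_min lexx orbT.
have b1 := h1 _ (near_x i j s t sh th ij _ hd1).
have ji : j != i by rewrite eq_sym.
have b2 := h2 _ (near_x j i s' t' sh' th' ji _ hd2).
have e : partial j (partial i f) (x + s *: delta_mx ord0 i + t *: delta_mx ord0 j) =
    partial i (partial j f) (x + s' *: delta_mx ord0 j + t' *: delta_mx ord0 i).
  by rewrite (addrAC x (h *: _)) in e1; exact: (square_cancel h0 e1 e2').
rewrite -e in b2.
exists (partial j (partial i f) (x + s *: delta_mx ord0 i + t *: delta_mx ord0 j)).
split; [exact: b2|exact: b1].
Qed.

End schwarz.

(** * The flat function exp(-1/t) *)

Section flat.
Context {R : realType}.
Implicit Types (p : {poly R}) (t u : R).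

(* These functions are stable under differentiation, up to a constant factor when
   composed with an affine map; this makes [flat 1] smooth at [0]. *)
Definition flat p t : R := if 0 < t then p.[t^-1] * expR (- t^-1) else 0.

Lemma poly_expR_bound p : exists C, forall y, 0 <= y ->
  `|p.[y] * expR (- y)| <= C.
Proof.
exists (\sum_(i < size p) `|p`_i| * i`!%:R) => y y0.
rewrite normrM [`|expR _|]gtr0_norm ?expR_gt0// expRN.
rewrite ler_pdivrMr ?expR_gt0// horner_coef (le_trans (ler_norm_sum _ _ _))//.
rewrite mulr_suml ler_sum// => i _; rewrite normrM -mulrA ler_wpM2l//.
rewrite normrX (ger0_norm y0) mulrC -ler_pdivrMr ?ltr0n ?fact_gt0//.
case: (i : nat) => [|k].
  by rewrite expr0 fact0 divr1; have := expR_ge1Dx y; lra.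
by have := expR_ge1Dxn k y0; lra.
Qed.

Lemma is_derive_flat p t : is_derive t 1 (flat p) (flat ('X^2 * (p - p^`())) t).
Proof.
have [t0|t0|->] := ltgtP t 0.
- have nt : \near t, cst (0 : R) t = flat p t.
    have : \forall u \near t, u < 0 by exact: lt_nbhsl.
    by apply: filterS => u u0; rewrite /flat ltNge (ltW u0).
  apply: (near_eq_is_derive nt); rewrite /flat ltNge (ltW t0)/=.
  exact: is_derive_cst.
- have nt : \near t, (fun u => p.[u^-1] * expR (- u^-1)) t = flat p t.
    have : \forall u \near t, 0 < u by exact: lt_nbhsr.
    by apply: filterS => u u0; rewrite /flat u0.
  apply: (near_eq_is_derive nt); rewrite /flat t0.
  have tn0 : t != 0 by rewrite gt_eqF.
  have dV : is_derive t (1 : R) (fun u : R => u^-1) (- t ^- 2 *: (1 : R)).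
    exact: is_deriveV.
  have d1 := is_derive1_comp (is_derive_poly p t^-1) dV.
  have dN : is_derive t (1 : R) (- (fun u : R => u^-1)) (- (- t ^- 2 *: (1 : R))).
    exact: is_deriveN.
  have d2 := is_derive1_comp (is_derive_expR ((- (fun u : R => u^-1)) t)) dN.
  have d3 := is_deriveM d1 d2.
  apply: (@trigger_derive _ _ _ _ _ d3) => /=.
  rewrite !hornerE /= !scaler1 [_ *: _]mulrC [X in _ + X]mulrC.
  rewrite -!exprVn; ring.
rewrite {2}/flat ltxx.
have [C hC] := poly_expR_bound ('X^2 * p).
have C0 : 0 <= C by rewrite (le_trans _ (hC 0 _)).
suff h : (fun k : R => k^-1 *: ((flat p \o shift 0) (k *: 1) - flat p 0)) @ 0^'
    --> (0 : R).
  by apply: DeriveDef; [apply/cvg_ex; eexists; exact: h|exact: cvg_lim h].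
apply/cvgr0Pnorm_le => e e0.
have Ce : 0 < e / (C + 1) by rewrite divr_gt0// ltr_wpDl.
near=> k.
rewrite /= addr0 {2}/flat ltxx subr0 [k *: 1]mulr1 /flat.
case: ltP => k0; last by rewrite scaler0 normr0 ltW.
have := hC k^-1 (ltW _); rewrite invr_gt0 => /(_ k0).
rewrite hornerM hornerXn.
have -> : k^-1 ^+ 2 * p.[k^-1] * expR (- k^-1) =
  k^-1 * (k^-1 *: (p.[k^-1] * expR (- k^-1))) by rewrite /GRing.scale/=; ring.
rewrite normrM gtr0_norm ?invr_gt0// mulrC ler_pdivrMr// => h.
rewrite (le_trans h)//.
have kC : k <= e / (C + 1).
  rewrite (le_trans (ler_norm _))//.
  by near: k; exact: dnbhs0_le.
rewrite (le_trans (ler_wpM2l C0 kC))// mulrA ler_pdivrMr ?ltr_wpDl//.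
by rewrite mulrDr mulr1 (mulrC C) lerDl ltW.
Unshelve. all: by end_near. Qed.

Lemma is_derive_flat_affine p s a t :
  is_derive t 1 (fun u => flat p (s * u + a))
    (flat (s *: ('X^2 * (p - p^`()))) (s * t + a)).
Proof.
have da : is_derive t (1 : R) (fun u => s * u + a) s.
  have h := is_deriveD (is_deriveZ s (is_derive_id t (1 : R))) (is_derive_cst a t 1).
  by apply: (@trigger_derive _ _ _ _ _ h); rewrite addr0 [_ *: _]mulr1.
apply: (@trigger_derive _ _ _ _ _ (is_derive1_comp (is_derive_flat p _) da)).
by rewrite /flat; case: ifP => _; [rewrite hornerZ; ring|rewrite mul0r].
Qed.

Lemma flat1_gt0 t : 0 < t -> flat 1 t = expR (- t^-1).
Proof. by move=> t0; rewrite /flat t0 hornerC mul1r. Qed.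

Lemma flat1_le0 t : t <= 0 -> flat 1 t = 0.
Proof. by move=> t0; rewrite /flat ltNge t0. Qed.

Lemma flat1_ge0 t : 0 <= flat 1 t.
Proof.
by have [t0|t0] := leP t 0; [rewrite flat1_le0|rewrite flat1_gt0// expR_ge0].
Qed.

Lemma flat1_le1 t : flat 1 t <= 1.
Proof.
have [t0|t0] := leP t 0; first by rewrite flat1_le0.
by rewrite flat1_gt0// -[leRHS]expR0 ler_expR oppr_le0 invr_ge0 ltW.
Qed.

Lemma flat1_cvg t :
  (fun m : nat => flat 1 (m.+1%:R * t)) @ \oo --> ((0 < t)%R%:R : R).
Proof.
have [t0|t0] := ltP 0 t; last first.
  by apply: cvg_near_cst; apply: nearW => m; rewrite flat1_le0// mulr_ge0_le0.
have -> : (fun m : nat => flat 1 (m.+1%:R * t)) =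
    (fun u => expR (- (u * t^-1))) \o @harmonic R.
  apply/funext => m /=; rewrite flat1_gt0 ?mulr_gt0//.
  by rewrite /harmonic/= invfM.
apply: cvg_comp; first exact: cvg_harmonic.
have -> : (true%:R : R) = expR (- (0 * t^-1)) by rewrite mul0r oppr0 expR0.
have c : continuous (fun u : R => - (u * t^-1)).
  by move=> u; apply: cvgN; apply: cvgMl; exact: cvg_id.
have ce : continuous (fun u : R => expR (- (u * t^-1))).
  move=> u; apply: (@continuous_comp _ _ _ (fun u : R => - (u * t^-1)) expR).
    exact: c.
  exact: continuous_expR.
exact: ce.
Qed.

End flat.

Section bump.
Context {R : realType} {n : nat}.

Lemma smooth_flat p (s a : R) (i : 'I_n) :
  smooth (fun x : 'rV[R]_n => flat p (s * x ord0 i + a)).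
Proof.
pose A : set ('rV[R]_n -> R) :=
  [set f | exists q, f = fun x : 'rV[R]_n => flat q (s * x ord0 i + a)].
apply: (@smooth_coind _ _ A); last by exists p.
move=> _ [q ->].
have E j (x : 'rV[R]_n) : (fun h : R => h^-1 *: (((fun x : 'rV[R]_n => flat q (s * x ord0 i + a))
      \o shift x) (h *: delta_mx ord0 j) - flat q (s * x ord0 i + a))) =
    (fun h : R => h^-1 *: (((fun u : R => flat q (s * u + a)) \o shift (x ord0 i))
      (h *: (i == j)%:R) - flat q (s * x ord0 i + a))).
  by apply/funext => h /=; rewrite !mxE eqxx.
have dE j (x : 'rV[R]_n) : is_derive x (delta_mx ord0 j)
    (fun x : 'rV[R]_n => flat q (s * x ord0 i + a))
    (flat ((i == j)%:R *: (s *: ('X^2 * (q - q^`())))) (s * x ord0 i + a)).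
  have d0 := is_derive_flat_affine q s a (x ord0 i).
  suff h : is_derive (x ord0 i) ((i == j)%:R : R) (fun u : R => flat q (s * u + a))
    (flat ((i == j)%:R *: (s *: ('X^2 * (q - q^`())))) (s * x ord0 i + a)).
    by case: h => h1 h2; apply: DeriveDef; [rewrite /derivable E|rewrite /derive E].
  case: (i == j); first by rewrite scale1r.
  rewrite scale0r.
  have -> : flat (0 : {poly R}) (s * x ord0 i + a) = 0.
    by rewrite /flat horner0 mul0r if_same.
  have h : (fun h : R => h^-1 *: (((fun u : R => flat q (s * u + a)) \o
      shift (x ord0 i)) (h *: (0 : R)) - flat q (s * x ord0 i + a))) = cst 0.
    by apply/funext => h /=; rewrite scaler0 add0r subrr scaler0.
  apply: DeriveDef; rewrite /derivable /derive h; first exact: is_cvg_cst.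
  exact: lim_cst.
split.
- move=> x; apply: (@continuous_comp _ _ _ (fun x : 'rV[R]_n => x ord0 i)
    (fun u => flat q (s * u + a))); first exact: continuous_coord.
  apply/differentiable_continuous/derivable1_diffP.
  by case: (is_derive_flat_affine q s a (x ord0 i)).
- by move=> j x; case: (dE j x).
- move=> j; exists ((i == j)%:R *: (s *: ('X^2 * (q - q^`())))).
  by apply/funext => x; rewrite /partial; case: (dE j x).
Qed.

End bump.

(** * The fundamental lemma of the calculus of variations *)

Section box_bump.
Context {R : realType} {n : nat}.
Implicit Types (a b x : 'rV[R]_n) (U : set 'rV[R]_n).

Definition box_bump a b (m : nat) : 'rV[R]_n -> R := fun x =>
  \prod_(i < n) (flat 1 (m.+1%:R * x ord0 i + m.+1%:R * - a ord0 i) *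
                 flat 1 (- m.+1%:R * x ord0 i + m.+1%:R * b ord0 i)).

Lemma smooth_box_bump a b m : smooth (box_bump a b m).
Proof.
apply: smooth_prod => i.
have := smoothM (smooth_flat 1 m.+1%:R (m.+1%:R * - a ord0 i) i)
                (smooth_flat 1 (- m.+1%:R) (m.+1%:R * b ord0 i) i).
exact.
Qed.

Lemma box_bump_supp a b m x : ~ cbox a b x -> box_bump a b m x = 0.
Proof.
move=> /existsNP[i /negP]; rewrite negb_and -!ltNge => h.
rewrite /box_bump (bigD1 i)//= -!mulrDr mulNr -mulrN -mulrDr.
case/orP: h => h.
  by rewrite flat1_le0 ?mul0r// mulr_ge0_le0// subr_le0 ltW.
rewrite (@flat1_le0 _ (_ * (- _ + _))) ?mulr0 ?mul0r//.
by rewrite mulr_ge0_le0// addrC subr_le0 ltW.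
Qed.

Lemma box_bump_ge0 a b m x : 0 <= box_bump a b m x.
Proof. by apply: prodr_ge0 => i _; rewrite mulr_ge0// flat1_ge0. Qed.

Lemma box_bump_le1 a b m x : box_bump a b m x <= 1.
Proof.
by apply: prodr_ile1 => i _; rewrite mulr_ge0 ?mulr_ile1 ?flat1_ge0 ?flat1_le1.
Qed.

Lemma box_bump_cvg a b x :
  (fun m => box_bump a b m x) @ \oo --> (\1_(box a b) x : R).
Proof.
have -> : (\1_(box a b) x : R) =
    \prod_(i < n) ((0 < x ord0 i - a ord0 i)%R%:R * (0 < b ord0 i - x ord0 i)%R%:R).
  rewrite indicE; have [xab|xab] := boolP (x \in box a b).
    rewrite inE in xab; rewrite big1// => i _.
    by case/andP: (xab i); rewrite !subr_gt0 => -> ->; rewrite mulr1.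
  move: xab; rewrite notin_setE => /existsNP[i /negP]; rewrite (bigD1 i)//=.
  rewrite !subr_gt0; case: (_ < _); case: (_ < _) => //= _;
  by rewrite ?(mul0r, mulr0).
have -> : (fun m => box_bump a b m x) = (fun m => \prod_(i < n)
    (flat 1 (m.+1%:R * (x ord0 i - a ord0 i)) *
     flat 1 (m.+1%:R * (b ord0 i - x ord0 i)))).
  apply/funext => m; apply: eq_bigr => i _; rewrite -mulrDr mulNr -mulrN -mulrDr.
  by rewrite [- x _ _ + _]addrC.
apply: cvg_big => [|i _]; first exact: mul_continuous.
by apply: cvgM; exact: flat1_cvg.
Qed.

Lemma box_measurableE :
  (@measurable _ 'rV[R]_n) = <<s [set A | exists a b : 'rV[R]_n, A = box a b] >>.
Proof.
apply/seteqP; split; last first.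
  apply: smallest_sub; first exact: sigma_algebra_measurable.
  by move=> _ [a [b ->]]; exact: measurable_box.
have openS U : open U ->
    <<s [set A | exists a b : 'rV[R]_n, A = box a b] >> U.
  move=> /open_bigcup_box ->; rewrite bigcup_mkcond.
  pose T := g_sigma_algebraType [set A | exists a b : 'rV[R]_n, A = box a b].
  apply: (@countable_bigcupT_measurable _ T) => // q; case: ifPn => _.
    by apply: sub_sigma_algebra; exists (ratv q.1), (ratv q.2).
  exact: (@measurable0 _ T).
apply: smallest_sub; first exact: smallest_sigma_algebra.
apply: (big_ind (fun X : set (set 'rV[R]_n) =>
  X `<=` <<s [set A | exists a b : 'rV[R]_n, A = box a b] >>)).
- exact: sub0set.
- by move=> A B; rewrite subUset.
move=> i _ A [B mB <-]; rewrite setTI.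
pose T := g_sigma_algebraType [set A | exists a b : 'rV[R]_n, A = box a b].
suff h : measurable_fun [set: T] (fun x : T => (x : 'rV[R]_n) ord0 i).
  by rewrite -[X in <<s _ >> X]setTI; exact: h.
apply: (measurability _ (RGenOpens.measurableE R)).
move=> _ [_ [a [b ->]] <-]; rewrite setTI; apply: openS.
apply: (open_comp (f := fun x : 'rV[R]_n => x ord0 i)).
  by move=> x _; exact: continuous_coord.
exact: interval_open.
Qed.

Lemma box_setI a b a' b' : exists c d, box a b `&` box a' b' = box c d /\
  cbox c d `<=` cbox a' b'.
Proof.
exists (\row_i Num.max (a ord0 i) (a' ord0 i)).
exists (\row_i Num.min (b ord0 i) (b' ord0 i)); split; last first.
  move=> x h i; have := h i; rewrite !mxE ge_max le_min.
  by case/andP => /andP[h1 h2] /andP[h3 h4]; apply/andP.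
apply/seteqP; split=> x.
  move=> [h h'] i; rewrite !mxE gt_max lt_min.
  by move: (h i) (h' i) => /andP[h1 h2] /andP[h3 h4]; rewrite h1 h2 h3 h4.
move=> h; split=> i; have := h i; rewrite !mxE gt_max lt_min;
by case/andP => /andP[h1 h2] /andP[h3 h4]; apply/andP.
Qed.

End box_bump.

Section fundamental_lemma.
Context {R : realType} {n : nat} (U : set 'rV[R]_n) (g : 'rV[R]_n -> R).
Hypotheses (oU : open U).
Let mu := rV_lebesgue R n.
Hypothesis ig : mu.-integrable U (EFin \o g).
Hypothesis g0 : forall phi : 'rV[R]_n -> R, smooth phi ->
  (exists K, [/\ compact K, K `<=` U & forall x, ~ K x -> phi x = 0]) ->
  (\int[mu]_(x in U) (phi x * g x)%:E = 0)%E.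

Let mU : measurable U. Proof. exact: measurable_open. Qed.

Let mg : measurable_fun U g.
Proof. by apply/measurable_EFinP; case/integrableP: ig. Qed.

Lemma integral_box0 a b : cbox a b `<=` U ->
  (\int[mu]_(x in box a b) (g x)%:E = 0)%E.
Proof.
move=> abU.
have bm m : measurable_fun U (box_bump a b m).
  by apply: measurable_continuous => //; exact/smooth_continuous/smooth_box_bump.
have ib : measurable_fun U (\1_(box a b) : 'rV[R]_n -> R).
  by apply: measurable_indic; exact: measurable_box.
have [|||||_ _ h] := @dominated_convergence _ _ _ mu U mU
  (fun m x => (box_bump a b m x * g x)%:E) (fun x => (\1_(box a b) x * g x)%:E)
  (fun x => `|(g x)%:E|%E).
- by move=> m; apply/measurable_EFinP; exact: measurable_funM.
- by apply/measurable_EFinP; exact: measurable_funM.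
- apply: aeW => x _; apply: cvg_EFin; first exact: nearW.
  apply: cvgMl; exact: box_bump_cvg.
- exact: integrable_abse.
- apply: aeW => x m _; rewrite lee_fin normrM ger0_norm ?box_bump_ge0//.
  by rewrite ler_piMl// box_bump_le1.
have h0 : (fun m => \int[mu]_(x in U) (box_bump a b m x * g x)%:E)%E @ \oo --> 0%E.
  apply: cvg_near_cst; apply: nearW => m; apply: g0.
    exact: smooth_box_bump.
  exists (cbox a b); split=> //; first exact: compact_cbox.
  by move=> x; exact: box_bump_supp.
rewrite -[RHS](cvg_unique _ h h0)//.
have -> : box a b = U `&` box a b by apply/esym/setIidr => x /box_cbox/abU.
rewrite integral_mkcondr; apply: eq_integral => x xU; rewrite patchE !indicE.
by rewrite in_setI xU/=; case: ifPn => _; rewrite ?mul1r ?mul0r.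
Qed.

Lemma integral_cbox_measurable0 a b A : cbox a b `<=` U -> measurable A ->
  (\int[mu]_(x in A `&` box a b) (g x)%:E = 0)%E.
Proof.
move=> abU mA.
have boxU : box a b `<=` U by move=> x /box_cbox/abU.
have mab := measurable_box a b.
have igA B : measurable B -> mu.-integrable (B `&` box a b) (EFin \o g).
  move=> mB; apply: integrableS ig => //; first exact: measurableI.
  by move=> x [_ /boxU].
move: A mA; rewrite /measurable/=.
pose G : set (set 'rV[R]_n) := [set A | exists a b : 'rV[R]_n, A = box a b].
suff h A : <<s G >> A -> (\int[mu]_(x in A `&` box a b) (g x)%:E = 0)%E.
  by move=> A mA; apply: h; rewrite -box_measurableE.
move: A; apply: dynkin_induction.
- exact: box_measurableE.
- move=> _ _ [c [d ->]] [c' [d' ->]]; have [e [f [-> _]]] := box_setI c d c' d'.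
  by exists e, f.
- by rewrite setTI integral_box0.
- move=> _ [c [d ->]]; have [e [f [-> efab]]] := box_setI c d a b.
  by apply: integral_box0 => x /efab/abU.
- move=> S mS hS; rewrite -[RHS](integral_box0 abU).
  have E : box a b = (S `&` box a b) `|` (~` S `&` box a b).
    by rewrite -setIUl setUv setTI.
  rewrite [in RHS]E integral_setU.
  + by rewrite hS add0e.
  + exact: measurableI.
  + by apply: measurableI => //; exact: measurableC.
  + by rewrite -E; apply/measurable_EFinP; exact: measurable_funS mg.
  + by apply/disj_setPS => x [[Sx _] [/(_ Sx)]].
- move=> F mF tF hF; rewrite setI_bigcupl integral_bigcup.
  + by rewrite eseries0// => i _ _; exact: hF.
  + exact: trivIset_setIr.
  + by move=> k; exact: measurableI.
  + by rewrite -setI_bigcupl; apply: igA; exact: bigcup_measurable.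
Qed.

Lemma fundamental_lemma_ae : \forall x \ae mu, U x -> g x = 0.
Proof.
pose Q := ('rV[rat]_n * 'rV[rat]_n)%type.
pose B (q : Q) := box (@ratv R n q.1) (ratv q.2).
pose N (q : Q) := [set x | B q x /\ g x != 0].
have hN (q : Q) : cbox (@ratv R n q.1) (ratv q.2) `<=` U -> mu.-negligible (N q).
  move=> qU; have mB : measurable (B q) by exact: measurable_box.
  have BU : B q `<=` U by move=> x /box_cbox/qU.
  have iB : mu.-integrable (B q) (EFin \o g) by exact: integrableS ig.
  have := @integral_ae_eq _ _ _ mu (B q) mB (cst 0%E) (EFin \o g) iB.
  move=> /(_ (measurable_cst _)) [].
    move=> E EB mE; rewrite integral_cst// mul0e -(setIidl EB).
    exact: integral_cbox_measurable0.
  move=> Z [mZ Z0 hZ]; exists Z; split=> // x [Bx gx]; apply: hZ => /= h.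
  by have := h Bx; rewrite /= => -[/eqP]; exact/negP.
pose F (k : nat) : set 'rV[R]_n := if (unpickle k : option Q) is Some q then
  [set x | cbox (@ratv R n q.1) (ratv q.2) `<=` U /\ N q x] else set0.
have hF k : mu.-negligible (F k).
  rewrite /F; case: (unpickle k : option Q) => [q|]; last exact: negligible_set0.
  have [/hN|qU] := pselect (cbox (@ratv R n q.1) (ratv q.2) `<=` U).
    by apply: negligibleS; move=> x [].
  by apply: negligibleS (negligible_set0 mu); move=> x [].
have [Z [mZ Z0 hZ]] := negligible_bigcup hF.
exists Z; split=> // x /not_implyP[Ux /eqP gx]; apply: hZ.
have [q1 [q2 [xq qU]]] := open_box_sub oU Ux.
by exists (pickle ((q1, q2) : Q)) => //; rewrite /F pickleK.
Qed.

End fundamental_lemma.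

(** * Whitney forms *)

Section signs.
Context {R : realType} {n : nat}.
Implicit Types (S T A : {set 'I_n}) (i j : 'I_n).
Local Notation wsgn := (@wsgn R n).
Local Notation hsgn := (@hsgn R n).

Lemma wsgn_setD1 i S : wsgn i (S :\ i) = wsgn i S.
Proof.
rewrite /Defs.wsgn; congr (_ ^+ #|pred_of_set _|); apply/setP => j; rewrite !inE.
by have [->|] := eqVneq j i; rewrite ?ltnn ?andbF.
Qed.

Lemma wsgn_setD1_ne i j S : i \in S -> j != i ->
  wsgn j (S :\ i) = (-1) ^+ (i < j)%N * wsgn j S.
Proof.
move=> iS ji; rewrite /Defs.wsgn.
have [ij|ij] := ltnP i j; last first.
  rewrite mul1r; congr (_ ^+ #|pred_of_set _|); apply/setP => l; rewrite !inE.
  by have [->|_] := eqVneq l i; rewrite //= ltnNge ij andbF.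
rewrite [in RHS](cardsD1 i [set l in S | (l < j)%N]%SET) inE iS ij exprD mulrA.
rewrite -expr2 sqrr_sign mul1r; congr (_ ^+ #|pred_of_set _|).
by apply/setP => l; rewrite !inE andbA.
Qed.

Lemma wsgn_sqr i S : wsgn i S * wsgn i S = 1.
Proof. by rewrite /Defs.wsgn -expr2 sqrr_sign. Qed.

Lemma hsgn_sqr S : hsgn S * hsgn S = 1.
Proof. by rewrite /Defs.hsgn -expr2 sqrr_sign. Qed.

Lemma sum_ltn_ord i : (\sum_(j < n) (j < i)%N = i)%N.
Proof.
have inn : (i <= n)%N by exact: ltnW.
rewrite -[RHS](card_ord i) -[RHS]sum1_card.
rewrite -(big_ord_narrow inn (F := fun=> 1%N)) [RHS]big_mkcond/=.
by apply: eq_bigr => j _; case: ltnP.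
Qed.

Lemma card_set_sum (T : finType) (P : pred T) : (#|[set x | P x]%SET| = \sum_x P x)%N.
Proof.
by rewrite -sum1dep_card big_mkcond; apply: eq_bigr => x _; case: (P x).
Qed.

Lemma wsgn_setC i S : wsgn i S * wsgn i (~: S) = (-1) ^+ i.
Proof.
rewrite /Defs.wsgn -exprD !card_set_sum; congr (_ ^+ _).
rewrite -big_split/= -[RHS]sum_ltn_ord; apply: eq_bigr => j _; rewrite inE.
by case: (j \in S); case: ltnP.
Qed.

(* Modulo 2, the inversions counted by [hsgn A] are the sum of the elements of
   [A] plus the number of pairs in [A]. *)
Let pairs A := (\sum_(p in A) \sum_(q in A) (q < p)%N)%N.

Let pairsD1 A i : i \in A -> pairs A = (pairs (A :\ i) + #|A :\ i|)%N.
Proof.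
move=> iA.
have E (F : 'I_n -> nat) : (\sum_(q in A) F q = F i + \sum_(q in A :\ i) F q)%N.
  rewrite (bigD1 i)//=; congr addn; apply: eq_bigl => q.
  by rewrite !inE andbC.
rewrite /pairs E// E// ltnn add0n.
under [X in (_ + X)%N = _]eq_bigr do rewrite E.
rewrite big_split/= addnA addnC; congr addn.
rewrite -big_split/= -sum1_card; apply: eq_bigr => q.
by rewrite !inE => /andP[qi _]; case: ltngtP qi => // /val_inj ->; rewrite eqxx.
Qed.

Lemma hsgnE A : hsgn A = (-1) ^+ (pairs A + \sum_(p in A) p).
Proof.
rewrite /Defs.hsgn card_set_sum -(pair_bigA _ (fun p q =>
  ([&& p \in A, q \notin A & (q < p)%N] : nat)))/=.
rewrite -[RHS]signr_odd -[LHS]signr_odd; congr (_ ^+ nat_of_bool _).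
have -> : (\sum_(p in A) p = pairs A +
    \sum_p \sum_q [&& p \in A, q \notin A & (q < p)%N])%N.
  rewrite /pairs [in RHS]big_mkcond/= -big_split/= [LHS]big_mkcond/=.
  apply: eq_bigr => p _; case: (p \in A) => /=; last by rewrite big1.
  rewrite -[LHS]sum_ltn_ord [X in (X + _)%N]big_mkcond/= -big_split/=.
  apply: eq_bigr => q _; by case: (q \in A); case: ltnP.
by rewrite addnA !oddD addbb.
Qed.

Lemma hsgn_setD1 A i : i \in A -> hsgn (A :\ i) * (-1) ^+ i = hsgn A * (-1) ^+ #|A|.+1.
Proof.
move=> iA; rewrite !hsgnE -!exprD (pairsD1 iA) [in RHS](cardsD1 i A) iA.
rewrite [in RHS](bigD1 i)//=.
have -> : (\sum_(p in A | p != i) p = \sum_(p in A :\ i) p)%N.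
  by apply: eq_bigl => p; rewrite !inE andbC.
rewrite -[RHS]signr_odd -[LHS]signr_odd; congr (_ ^+ nat_of_bool _).
rewrite !oddD add1n /= negbK.
by move: (odd _) (odd _) (odd _) (odd _) => [] [] [] [].
Qed.

End signs.

Section affine_forms.
Context {R : realType} {n : nat}.
Implicit Types (u v a b w : dform R n) (S T : {set 'I_n}) (i j : 'I_n) (k : nat).

Lemma dformD u v S x : (u + v) S x = u S x + v S x. Proof. by []. Qed.
Lemma dformZ c u S x : (c *: u) S x = c * u S x. Proof. by []. Qed.
Lemma dform0 S x : (0 : dform R n) S x = 0. Proof. by []. Qed.
Lemma fun_rVD (f g : 'rV[R]_n -> R) x : (f + g) x = f x + g x. Proof. by []. Qed.
Lemma fun_rVZ c (f : 'rV[R]_n -> R) x : (c *: f) x = c * f x. Proof. by []. Qed.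
Definition dformE := (dformD, dformZ, dform0, fun_rVD, fun_rVZ).

Definition smooth_form : set (dform R n) := [set u | forall S, smooth (u S)].

Definition affine_form : set (dform R n) := [set u | forall S, affine_fun (u S)].

(* The formal adjoint of [extd], i.e. the codifferential of a smooth form. *)
Definition cod u : dform R n := fun T x =>
  - \sum_(i | i \notin T) wsgn i (i |: T) * partial i (u (i |: T)) x.

Lemma affine_smooth_form u : affine_form u -> smooth_form u.
Proof. by move=> au S; exact: affine_smooth. Qed.

Lemma affine_funD (f g : 'rV[R]_n -> R) c : affine_fun f -> affine_fun g ->
  affine_fun (c *: f + g).
Proof.
move=> [c1 [a1 h1]] [c2 [a2 h2]]; exists (c * c1 + c2), (c *: a1 + a2) => x.
rewrite !dformE h1 h2 mulrDr addrACA mulr_sumr -big_split/=.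
by congr (_ + _); apply: eq_bigr => i _; rewrite !mxE mulrDl mulrA.
Qed.

Lemma affine_form_subspace : subspace affine_form.
Proof.
split; first by move=> S; exact: (affine_cst 0).
by move=> c u v au av S; exact: affine_funD.
Qed.

Lemma kform_subspace k : subspace (@kform R n k).
Proof.
split; first by move=> S x _.
by move=> c u v ku kv S x Sk; rewrite !dformE ku// kv// mulr0 addr0.
Qed.

Lemma P0_subspace k : subspace (@P0 R n k).
Proof.
split; first by split=> //; case: (kform_subspace k).
move=> c u v [ku hu] [kv hv]; split; first by case: (kform_subspace k) => _; exact.
by move=> S x y; rewrite !dformE (hu S x y) (hv S x y).
Qed.

Lemma koszulD c a b : koszul (c *: a + b) = c *: koszul a + koszul b.
Proof.
apply/funext => S; apply/funext => x; rewrite /koszul !dformE.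
rewrite mulr_sumr -big_split/=; apply: eq_bigr => i _.
by rewrite !dformE; ring.
Qed.

Lemma starD c a b : star (c *: a + b) = c *: star a + star b.
Proof.
apply/funext => S; apply/funext => x; rewrite /star !dformE.
by ring.
Qed.

Lemma star0 : star 0 = 0 :> dform R n.
Proof. by apply/funext => S; apply/funext => x; rewrite /star !dformE mulr0. Qed.

Lemma koszul0 : koszul 0 = 0 :> dform R n.
Proof.
apply/funext => S; apply/funext => x; rewrite /koszul big1// => i _.
by rewrite !dformE mulr0.
Qed.

Lemma P0_sub_P1minus k : @P0 R n k `<=` P1minus k.
Proof.
move=> a Pa; exists a => //; exists 0; first by case: (P0_subspace k.+1).
by rewrite koszul0 addr0.
Qed.

Lemma P1minus_subspace k : subspace (@P1minus R n k).
Proof.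
split; first by apply: P0_sub_P1minus; case: (P0_subspace k).
move=> c _ _ [a Pa [b Pb <-]] [a' Pa' [b' Pb' <-]].
exists (c *: a + a'); first by case: (P0_subspace k) => _; exact.
exists (c *: b + b'); first by case: (P0_subspace k.+1) => _; exact.
by rewrite koszulD scalerDr addrACA.
Qed.

Lemma P1starminus_subspace k : subspace (@P1starminus R n k).
Proof.
split; first by exists 0; [case: (P1minus_subspace (n - k))|exact: star0].
move=> c _ _ [a Pa <-] [b Pb <-]; exists (c *: a + b); last exact: starD.
by case: (P1minus_subspace (n - k)) => _; exact.
Qed.

Lemma partial_lin (f g : 'rV[R]_n -> R) c i : smooth f -> smooth g ->
  partial i (c *: f + g) = c *: partial i f + partial i g.
Proof.
move=> sf sg; apply/funext => x; rewrite /partial deriveD.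
- by rewrite deriveZ//; exact: smooth_derivable.
- by apply: derivableZ; exact: smooth_derivable.
- exact: smooth_derivable.
Qed.

Lemma extd_linear : linear_on smooth_form (@extd R n).
Proof.
move=> c u v su sv; apply/funext => S; apply/funext => x; rewrite /extd !dformE.
rewrite mulr_sumr -big_split/=; apply: eq_bigr => i _.
rewrite -[(c *: u + v) (S :\ i)]/(c *: u (S :\ i) + v (S :\ i)) partial_lin//.
by rewrite !dformE; ring.
Qed.

Lemma cod_linear : linear_on smooth_form cod.
Proof.
move=> c u v su sv; apply/funext => S; apply/funext => x; rewrite /cod !dformE.
rewrite mulrN -opprD mulr_sumr -big_split/=; congr (- _).
apply: eq_bigr => i _.
rewrite -[(c *: u + v) (i |: S)]/(c *: u (i |: S) + v (i |: S)) partial_lin//.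
by rewrite !dformE; ring.
Qed.

Definition koszul_row b S : 'rV[R]_n :=
  \row_j (if j \notin S then wsgn j S * b (j |: S) 0 else 0).

Lemma P1minusE k a b S : P0 k a -> P0 k.+1 b ->
  (a + koszul b) S = fun x => a S 0 + \sum_j koszul_row b S ord0 j * x ord0 j.
Proof.
move=> [_ ha] [_ hb]; apply/funext => x; rewrite /koszul !dformE (ha S x 0).
congr (_ + _); rewrite big_mkcond; apply: eq_bigr => j _; rewrite mxE.
by case: ifP => _; rewrite ?mul0r// (hb _ x 0) mulrAC.
Qed.

Lemma starP1minusE k a b S : P0 k a -> P0 k.+1 b ->
  star (a + koszul b) S = fun x => hsgn (~: S) * a (~: S)%SET 0 +
    \sum_j (hsgn (~: S) *: koszul_row b (~: S)) ord0 j * x ord0 j.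
Proof.
move=> Pa Pb; apply/funext => x; rewrite /star (P1minusE _ Pa Pb) mulrDr mulr_sumr.
by congr (_ + _); apply: eq_bigr => j _; rewrite [in RHS]mxE mulrA.
Qed.

Lemma P1minus_affine k : @P1minus R n k `<=` affine_form.
Proof.
by move=> _ [a Pa [b Pb <-]] S; rewrite (P1minusE S Pa Pb); do 2!eexists.
Qed.

Lemma P1starminus_affine k : @P1starminus R n k `<=` affine_form.
Proof.
by move=> _ [_ [a Pa [b Pb <-]] <-] S; rewrite (starP1minusE S Pa Pb); do 2!eexists.
Qed.

Lemma koszul_kform k b : kform k.+1 b -> kform k (koszul b).
Proof.
move=> kb S x Sk; rewrite /koszul big1// => i iS.
by rewrite kb ?mulr0// cardsU1 iS add1n eqSS.
Qed.

Lemma P1minus_kform k : @P1minus R n k `<=` kform k.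
Proof.
move=> _ [a [ka _] [b [kb _] <-]].
exact: (subspaceD (kform_subspace k) ka (koszul_kform kb)).
Qed.

Lemma star_kform k u : (k <= n)%N -> kform (n - k) u -> kform k (star u).
Proof.
move=> kn ku S x Sk; rewrite /star ku ?mulr0//.
apply: contra Sk => /eqP Sn; apply/eqP.
by move: (cardsC S); rewrite card_ord Sn; lia.
Qed.

Lemma P1starminus_kform k : (k <= n)%N -> @P1starminus R n k `<=` kform k.
Proof. by move=> kn _ [u /P1minus_kform ku <-]; exact: star_kform. Qed.

Lemma P0_sub_P1starminus k : (k <= n)%N -> @P0 R n k `<=` P1starminus k.
Proof.
move=> kn u [ku hu]; exists (fun S x => hsgn S * u (~: S)%SET x); last first.
  by apply/funext => S; apply/funext => x; rewrite /star mulrA hsgn_sqr mul1r finset.setCK.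
apply: P0_sub_P1minus; split; last by move=> S x y; rewrite (hu _ x y).
move=> S x Sk; rewrite ku ?mulr0//; apply: contra Sk => /eqP Sn; apply/eqP.
by move: (cardsC S); rewrite card_ord Sn; lia.
Qed.

(* The homotopy formula [d kappa + kappa d = k + 1] on constant (k+1)-forms. *)
Lemma extd_P1minus k a b : P0 k a -> P0 k.+1 b ->
  extd (a + koszul b) = k.+1%:R *: b.
Proof.
move=> Pa Pb; have [kb hb] := Pb; apply/funext => S; apply/funext => x.
rewrite /extd !dformE (eq_bigr (fun=> b S x)) => [|i iS].
  rewrite sumr_const; have [Sk|Sk] := eqVneq #|S| k.+1.
    by rewrite Sk mulr_natl.
  by rewrite kb// mulr0 mul0rn.
rewrite (P1minusE _ Pa Pb) partial_affine mxE !inE eqxx/= finset.setD1K// mulrA.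
by rewrite wsgn_setD1 wsgn_sqr mul1r (hb _ 0 x).
Qed.

(* The Hodge dual of the homotopy formula. *)
Lemma cod_starP1minus k a b : P0 (n - k.+1) a -> P0 (n - k.+1).+1 b ->
  (k < n)%N ->
  cod (star (a + koszul b)) =
  (- ((-1) ^+ (n - k).+1 * (n - k)%:R)) *: (fun T x => hsgn (~: T) * b (~: T)%SET x).
Proof.
move=> Pa Pb kn; have [kb hb] := Pb; apply/funext => T; apply/funext => x.
have nk : (n - k.+1).+1 = (n - k)%N by lia.
rewrite /cod !dformE.
rewrite (eq_bigr (fun=> (-1) ^+ #|~: T|.+1 * (hsgn (~: T) * b (~: T)%SET x))).
  rewrite sumr_const; have [Tk|Tk] := eqVneq #|~: T| (n - k)%N; last first.
    by rewrite kb ?nk// !(mulr0, mul0rn) oppr0.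
  have -> : #|[pred i | i \notin T]| = (n - k)%N.
    by rewrite -Tk; apply: eq_card => i; rewrite !inE.
  by rewrite Tk -mulr_natl; ring.
move=> i iT; rewrite (starP1minusE _ Pa Pb) partial_affine/= mxE mxE.
have E : (i |: ~: (i |: T)) = ~: T.
  apply/setP => j; rewrite !inE negb_or.
  by have [->|] := eqVneq j i; rewrite ?iT.
have E' : ~: (i |: T) = (~: T) :\ i.
  by apply/setP => j; rewrite !inE negb_or.
have iT' : i \in ~: T by rewrite inE.
rewrite !inE eqxx/= E (hb _ 0 x) mulrCA !mulrA -(mulrA (hsgn _)).
by rewrite wsgn_setC E' (hsgn_setD1 iT') [hsgn _ * _]mulrC.
Qed.

Lemma extd_P0 k w : P1minus k w -> P0 k.+1 (extd w).
Proof.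
move=> [a Pa [b Pb <-]]; rewrite (extd_P1minus Pa Pb).
by apply: subspaceZ => //; exact: P0_subspace.
Qed.

Lemma extd_eq0 k w : P1minus k w -> extd w = 0 -> P0 k w.
Proof.
move=> [a Pa [b Pb <-]]; rewrite (extd_P1minus Pa Pb) => /eqP.
rewrite scaler_eq0 pnatr_eq0/= => /eqP ->.
by rewrite koszul0 addr0.
Qed.

Lemma extd_const k u : P0 k u -> extd u = 0.
Proof.
move=> Pu; have P00 : P0 k.+1 (0 : dform R n) by case: (P0_subspace k.+1).
by have := extd_P1minus Pu P00; rewrite koszul0 addr0 scaler0.
Qed.

Lemma cod_P0 k w : (k < n)%N -> P1starminus k.+1 w -> P0 k (cod w).
Proof.
move=> kn [_ [a Pa [b Pb <-]] <-]; rewrite (cod_starP1minus Pa Pb kn).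
apply: subspaceZ; first exact: P0_subspace.
have [kb hb] := Pb; split; last by move=> S x y; rewrite /= (hb _ x y).
move=> S x Sk; rewrite /= kb ?mulr0//; apply: contra Sk => /eqP Sn; apply/eqP.
by move: (cardsC S) Sn; rewrite card_ord; lia.
Qed.

Lemma cod_eq0 k w : (k < n)%N -> P1starminus k.+1 w -> cod w = 0 -> P0 k.+1 w.
Proof.
move=> kn [_ [a Pa [b Pb <-]] <-]; rewrite (cod_starP1minus Pa Pb kn) => /eqP.
rewrite scaler_eq0 oppr_eq0 mulf_eq0 signr_eq0/= pnatr_eq0.
rewrite (_ : (n - k == 0)%N = false); last by apply/eqP; lia.
move=> /= /eqP b0.
have -> : b = 0.
  apply/funext => T; apply/funext => x; have := congr1 (fun F => F (~: T)%SET x) b0.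
  rewrite /= finset.setCK => /(congr1 (fun y => hsgn T * y)).
  by rewrite mulr0 mulrA hsgn_sqr mul1r.
rewrite koszul0 addr0; have [ka ha] := Pa; split.
  by apply: star_kform.
by move=> S x y; rewrite /star (ha _ x y).
Qed.

End affine_forms.

(** * Square integrable forms *)

Section l2_forms.
Context {R : realType} {n : nat} (D : set 'rV[R]_n).
Hypothesis mD : measurable D.
Implicit Types (u v w : dform R n) (f g : 'rV[R]_n -> R) (S : {set 'I_n}).
Let mu := rV_lebesgue R n.

Definition L2fun : set ('rV[R]_n -> R) := [set f : 'rV[R]_n -> R | measurable_fun D f /\
  mu.-integrable D (fun x => (f x ^+ 2)%:E)].

Definition L2s : set (dform R n) := [set u | forall S, L2fun (u S)].

Lemma L2fun_mul f g : L2fun f -> L2fun g ->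
  mu.-integrable D (fun x => (f x * g x)%:E).
Proof.
move=> [mf f2] [mg g2].
have h : mu.-integrable D (fun x => (f x ^+ 2 + g x ^+ 2)%:E).
  have := integrableD mD f2 g2.
  by apply: eq_integrable => // x _; rewrite /= EFinD.
apply: le_integrable h => //.
  by apply/measurable_EFinP; exact: measurable_funM.
move=> x _; rewrite !abse_EFin lee_fin [leRHS]ger0_norm ?addr_ge0 ?sqr_ge0//.
rewrite ler_norml; apply/andP; split; nra.
Qed.

Lemma L2fun_lin (a : R) f g : L2fun f -> L2fun g ->
  L2fun (fun x => a * f x + g x).
Proof.
move=> Lf Lg; have [mf f2] := Lf; have [mg g2] := Lg; split.
  by apply: measurable_funD => //; exact: measurable_funM.
have fg := L2fun_mul Lf Lg.
have h := integrableD mD (integrableD mD (integrableZl mD (a ^+ 2) f2)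
  (integrableZl mD (2 * a) fg)) g2.
apply: eq_integrable h => // x _; rewrite /= -!EFinM -!EFinD; congr (_%:E); ring.
Qed.

Lemma L2s_subspace : subspace L2s.
Proof.
split.
  move=> S; split; first exact: measurable_cst.
  rewrite (_ : (fun=> _) = cst 0%E); first exact: integrable0.
  by apply/funext => x; rewrite dform0 expr0n.
by move=> a u v Lu Lv S; exact: L2fun_lin.
Qed.

Lemma L2ipE u v : L2s u -> L2s v ->
  L2ip D u v = \sum_S \int[mu]_(x in D) (u S x * v S x).
Proof.
move=> Lu Lv; rewrite /L2ip.
suff h (r : seq {set 'I_n}) :
    mu.-integrable D (EFin \o (fun x => \sum_(S <- r) u S x * v S x)) /\
    \int[mu]_(x in D) (\sum_(S <- r) u S x * v S x) =
    \sum_(S <- r) \int[mu]_(x in D) (u S x * v S x) by case: (h (index_enum _)).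
elim: r => [|S r [IH1 IH2]].
  split.
    rewrite (_ : EFin \o _ = cst 0%E); first exact: integrable0.
    by apply/funext => x /=; rewrite big_nil.
  under eq_Rintegral do rewrite big_nil; rewrite big_nil.
  by rewrite Rintegral_cst// mul0r.
have uv := L2fun_mul (Lu S) (Lv S).
split.
  have := integrableD mD uv IH1; apply: eq_integrable => // x _.
  by rewrite /= big_cons EFinD.
under eq_Rintegral do rewrite big_cons.
by rewrite RintegralD// big_cons IH2.
Qed.

Lemma L2ip_form_on : form_on L2s (@L2ip R n D).
Proof.
split.
- move=> a u v w Lu Lv Lw; have Luv : L2s (a *: u + v).
    by case: L2s_subspace => _; exact.
  rewrite !L2ipE// mulr_sumr -big_split/=; apply: eq_bigr => S _.
  have uw := L2fun_mul (Lu S) (Lw S); have vw := L2fun_mul (Lv S) (Lw S).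
  rewrite -RintegralZl// -RintegralD//; last first.
    by have := integrableZl mD a uw; exact: eq_integrable.
  by apply: eq_Rintegral => x _; rewrite dformD dformZ mulrDl mulrA.
- move=> u v _ _; apply: eq_Rintegral => x _.
  by apply: eq_bigr => S _; rewrite mulrC.
- move=> u _; apply: Rintegral_ge0 => x _.
  by apply: sumr_ge0 => S _; rewrite -expr2 sqr_ge0.
Qed.

Definition ae0 u := forall S, \forall x \ae mu, D x -> u S x = 0.

Lemma L2ip_ae0 u v : L2s u -> L2s v -> ae0 v -> L2ip D u v = 0.
Proof.
move=> Lu Lv v0; rewrite L2ipE// big1// => S _; rewrite /Rintegral.
have mf : measurable_fun D (fun x => (u S x * v S x)%:E).
  by case/integrableP: (L2fun_mul (Lu S) (Lv S)).
rewrite (ae_eq_integral (cst 0%E))//.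
  by rewrite integral_cst// mul0e.
by have := v0 S; apply: filterS => x h Dx; rewrite h// mulr0.
Qed.

Lemma L2ip_ae u v w : L2s u -> L2s v -> L2s w -> ae0 (v - w) ->
  L2ip D u v = L2ip D u w.
Proof.
move=> Lu Lv Lw vw; apply/eqP; rewrite -subr_eq0.
rewrite -(formBr L2s_subspace L2ip_form_on)//; apply/eqP/L2ip_ae0 => //.
exact: (subspaceB L2s_subspace Lv Lw).
Qed.

Lemma L2ip_eq0 u : L2s u -> L2ip D u u = 0 -> ae0 u.
Proof.
move=> Lu; rewrite L2ipE// => u0 S.
have uu := L2fun_mul (Lu S) (Lu S).
have : \int[mu]_(x in D) (u S x * u S x) = 0.
  move/eqP: u0; rewrite psumr_eq0 => [h|T _]; last first.
    by apply: Rintegral_ge0 => x _; rewrite -expr2 sqr_ge0.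
  by have /allP/(_ S (mem_index_enum S))/eqP := h.
move=> h0; have h : (\int[mu]_(x in D) (u S x * u S x)%:E = 0)%E.
  by rewrite -(fineK (integrable_fin_num mD uu)) -[fine _]/(Rintegral _ _ _) h0.
have mf : measurable_fun D (fun x => (u S x * u S x)%:E).
  by case/integrableP: uu.
have /(ae_eq_integral_abs mu mD mf) : (\int[mu]_(x in D) `|(u S x * u S x)%:E| = 0)%E.
  rewrite -h; apply: eq_integral => x _.
  by rewrite gee0_abs// lee_fin -expr2 sqr_ge0.
apply: filterS => x /= h' Dx; have := h' Dx; move=> -[/eqP].
by rewrite mulf_eq0 => /orP[] /eqP.
Qed.

Lemma ae0_subspace : subspace ae0.
Proof.
split; first by move=> S; exact: aeW.
move=> a u v hu hv S; have := hv S; have := hu S; apply: filterS2 => x h1 h2 Dx.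
by rewrite dformD dformZ h1// h2// mulr0 addr0.
Qed.

End l2_forms.

(** * Test forms *)

Section compact_support.
Context {R : realType} {n : nat} (U : set 'rV[R]_n).
Implicit Types (f g : 'rV[R]_n -> R) (i : 'I_n).
Let mu := rV_lebesgue R n.

Definition compact_supp f :=
  exists K, [/\ compact K, K `<=` U & forall x, ~ K x -> f x = 0].

Lemma rV_hausdorff : hausdorff_space 'rV[R]_n.
Proof. exact: norm_hausdorff. Qed.

Lemma compact_supp_partial f i : compact_supp f -> compact_supp (partial i f).
Proof.
move=> [K [cK KU f0]]; exists K; split=> // x Kx.
have : open (~` K) by exact: (closed_openC (compact_closed rV_hausdorff cK)).
rewrite openE => /(_ x Kx) nx.
rewrite /partial (@near_eq_derive _ _ _ _ (cst 0)) ?derive_cst//.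
by apply: filterS nx => y; exact: f0.
Qed.

Lemma compact_supp0 : compact_supp (cst 0).
Proof. by exists set0; split=> //; exact: compact0. Qed.

Lemma compact_suppD f g : compact_supp f -> compact_supp g ->
  compact_supp (fun x => f x + g x).
Proof.
move=> [K [cK KU f0]] [L [cL LU g0]]; exists (K `|` L); split.
- exact: compactU.
- by move=> x [/KU|/LU].
- by move=> x /not_orP[Kx Lx]; rewrite f0// g0// addr0.
Qed.

Lemma compact_suppMr f g : compact_supp f -> compact_supp (fun x => f x * g x).
Proof. by move=> [K [cK KU f0]]; exists K; split=> // x /f0 ->; rewrite mul0r. Qed.

Lemma compact_suppMl f g : compact_supp f -> compact_supp (fun x => g x * f x).
Proof. by move=> [K [cK KU f0]]; exists K; split=> // x /f0 ->; rewrite mulr0. Qed.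

Lemma compact_supp_sum (I : Type) (r : seq I) (P : pred I) (F : I -> 'rV[R]_n -> R) :
  (forall k, P k -> compact_supp (F k)) ->
  compact_supp (fun x => \sum_(k <- r | P k) F k x).
Proof.
move=> sF; elim: r => [|k r IH].
  rewrite [X in compact_supp X](_ : _ = cst 0); first exact: compact_supp0.
  by apply/funext => x; rewrite big_nil.
have [Pk|Pk] := boolP (P k).
  rewrite [X in compact_supp X](_ : _ = fun x => F k x + \sum_(k <- r | P k) F k x).
    exact: compact_suppD (sF _ Pk) IH.
  by apply/funext => x; rewrite big_cons Pk.
rewrite [X in compact_supp X](_ : _ = fun x => \sum_(k <- r | P k) F k x)//.
by apply/funext => x; rewrite big_cons (negbTE Pk).
Qed.

Lemma integral_partial_compact f i : smooth f -> compact_supp f ->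
  \int[mu]_(x in U) partial i f x = 0.
Proof.
move=> sf kf; have [K' [cK' K'U pf0]] := compact_supp_partial i kf.
have [K [cK KU f0]] := kf.
have /bounded_cbox[M M0 KM] : bounded_set K by exact: compact_bounded.
rewrite /Rintegral integral_mkcond.
have -> : ((fun x => (partial i f x)%:E) \_ U) = fun x => (partial i f x)%:E.
  apply/funext => x; rewrite patchE; case: ifPn => // /negP xU.
  by rewrite pf0// => /K'U Ux; apply: xU; rewrite inE.
rewrite (@integral_partial R n M f i)//.
- exact: smooth_continuous.
- by move=> x; exact: smooth_derivable.
- exact/smooth_continuous/smooth_partial.
- move=> x j xj; apply: f0 => /KM /(_ j); rewrite !mxE -ler_norml.
  by rewrite leNgt xj.
Qed.

End compact_support.

Section smooth_l2.
Context {R : realType} {n : nat} (U : set 'rV[R]_n).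
Hypotheses (mU : measurable U) (bU : bounded_set U).
Let mu := rV_lebesgue R n.

Lemma continuous_bounded_on (f : 'rV[R]_n -> R) : continuous f ->
  [bounded f x | x in U].
Proof.
move=> cf; have [M M0 UM] := bounded_cbox bU.
have [|N [Nr hN]] :=
    @compact_bounded R R^o (f @` cbox (const_mx (- M)) (const_mx M)).
  apply: continuous_compact; first exact: continuous_subspaceT.
  exact: compact_cbox.
by exists N; split=> // e Ne x Ux; apply: hN => //; exists x => //; exact: UM.
Qed.

Lemma continuous_L2fun (f : 'rV[R]_n -> R) : continuous f -> L2fun U f.
Proof.
move=> cf; split; first exact: measurable_continuous.
apply: (@measurable_bounded_integrable _ _ _ mu (fun x => f x ^+ 2)) => //.
- exact: lebesgue_bounded.
- by apply: measurable_continuous => //; exact: fun_continuousM.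
- by apply: continuous_bounded_on; exact: fun_continuousM.
Qed.

Lemma smooth_L2s : smooth_form `<=` @L2s R n U.
Proof. by move=> u su S; exact/continuous_L2fun/smooth_continuous. Qed.

Lemma cst_L2fun (c : R) : L2fun U (cst c).
Proof. by apply: continuous_L2fun; exact: cst_continuous. Qed.

Lemma L2fun_integrable f : L2fun U f -> mu.-integrable U (EFin \o f).
Proof.
move=> Lf; have := L2fun_mul mU Lf (cst_L2fun 1).
by apply: eq_integrable => // x _; rewrite /= mulr1.
Qed.

End smooth_l2.

Section test_forms.
Context {R : realType} {n : nat}.
Implicit Types (u v phi : dform R n) (S T : {set 'I_n}) (i j : 'I_n) (k : nat).

Lemma extd_smooth u : smooth_form u -> smooth_form (extd u).
Proof.
move=> su S; apply: smooth_sum => i _.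
exact: (smoothM (smooth_cst (wsgn i S)) (smooth_partial i (su (S :\ i)))).
Qed.

Lemma cod_smooth u : smooth_form u -> smooth_form (cod u).
Proof.
move=> su T; apply: smoothN; apply: smooth_sum => i _.
exact: (smoothM (smooth_cst (wsgn i (i |: T))) (smooth_partial i (su (i |: T)))).
Qed.

Lemma partial0 i : partial i (cst 0 : 'rV[R]_n -> R) = cst 0.
Proof. by apply/funext => x; rewrite /partial derive_cst. Qed.

Lemma kform_comp0 k u S : kform k u -> #|S| != k -> u S = cst 0.
Proof. by move=> ku Sk; apply/funext => x; exact: ku. Qed.

Lemma extd_kform k u : kform k u -> kform k.+1 (extd u).
Proof.
move=> ku S x Sk; rewrite /extd big1// => i iS.
rewrite (kform_comp0 ku) ?partial0 ?mulr0//.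
by apply: contra Sk => /eqP <-; rewrite (cardsD1 i S) iS.
Qed.

Lemma cod_kform k u : kform k.+1 u -> kform k (cod u).
Proof.
move=> ku S x Sk; rewrite /cod big1 ?oppr0// => i iS.
by rewrite (kform_comp0 ku) ?partial0 ?mulr0// cardsU1 iS add1n eqSS.
Qed.

Section support.
Context (U : set 'rV[R]_n).

Lemma test_form_smooth k : test_form U k `<=` @smooth_form R n.
Proof. by move=> u [_ hu] S; case: (hu S). Qed.

Lemma test_form_supp k u S : test_form U k u -> compact_supp U (u S).
Proof. by move=> [_ hu]; case: (hu S). Qed.

Lemma extd_test k u : test_form U k u -> test_form U k.+1 (extd u).
Proof.
move=> tu; split; first by apply: extd_kform; case: tu.
move=> S; split; first exact: extd_smooth (test_form_smooth tu) S.
apply: compact_supp_sum => i _; apply: compact_suppMl.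
exact/compact_supp_partial/(test_form_supp _ tu).
Qed.

Lemma cod_test k u : test_form U k.+1 u -> test_form U k (cod u).
Proof.
move=> tu; split; first by apply: cod_kform; case: tu.
move=> S; split; first exact: cod_smooth (test_form_smooth tu) S.
rewrite (_ : cod u S = fun x => -1 *
    \sum_(i | i \notin S) wsgn i (i |: S) * partial i (u (i |: S)) x).
  apply/compact_suppMl/compact_supp_sum => i _; apply: compact_suppMl.
  exact/compact_supp_partial/(test_form_supp _ tu).
by apply/funext => x; rewrite mulN1r.
Qed.

Lemma test_form_subspace k : subspace (@test_form R n U k).
Proof.
split.
  split; first by case: (@kform_subspace R n k).
  by move=> S; split; [exact: (smooth_cst 0)|exact: compact_supp0].
move=> a u v tu tv; have [ku hu] := tu; have [kv hv] := tv; split.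
  by case: (@kform_subspace R n k) => _; exact.
move=> S; split.
  exact: (smoothD (smoothM (smooth_cst a) (hu S).1) (hv S).1).
exact: (compact_suppD (compact_suppMl (cst a) (hu S).2) (hv S).2).
Qed.

End support.

Lemma partial_sum (I : Type) (r : seq I) (P : pred I) (F : I -> 'rV[R]_n -> R) i x :
  (forall l, P l -> smooth (F l)) ->
  partial i (fun y => \sum_(l <- r | P l) F l y) x =
  \sum_(l <- r | P l) partial i (F l) x.
Proof.
move=> sF; elim: r => [|k r IH].
  rewrite big_nil -[RHS](congr1 (fun f => f x) (partial0 i)).
  by congr (partial i _ x); apply/funext => y; rewrite big_nil.
rewrite big_cons -IH; case: ifPn => Pk; last first.
  by congr (partial i _ x); apply/funext => y; rewrite big_cons (negbTE Pk).
have sr := smooth_sum r sF.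
rewrite -[RHS]/((partial i (F k) + partial i (fun y => \sum_(l <- r | P l) F l y)) x).
rewrite -partialD.
- by congr (partial i _ x); apply/funext => y; rewrite big_cons Pk.
- by move=> y; exact/smooth_derivable/sF.
- by move=> y; exact: smooth_derivable.
Qed.

Lemma partialZ c (f : 'rV[R]_n -> R) i x : smooth f ->
  partial i (fun y => c * f y) x = c * partial i f x.
Proof.
move=> sf; transitivity (partial i (c *: f + cst 0) x).
  by congr (partial i _ x); apply/funext => y; rewrite fun_rVD /= addr0.
by rewrite (partial_lin c i sf (smooth_cst 0)) partial0 fun_rVD /= addr0.
Qed.

Lemma extd_extd u : smooth_form u -> extd (extd u) = 0.
Proof.
move=> su; apply/funext => S; apply/funext => x; rewrite dform0.
pose F i j := wsgn i S * (wsgn j (S :\ i) *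
  partial i (partial j (u (S :\ i :\ j))) x).
have E : extd (extd u) S x = \sum_(i in S) \sum_(j in S | j != i) F i j.
  apply: eq_bigr => i iS; rewrite /extd partial_sum => [|j _]; last first.
    by apply: (smoothM (smooth_cst (wsgn j (S :\ i)))); exact/smooth_partial/su.
  rewrite mulr_sumr; apply: eq_big => j; first by rewrite !inE andbC.
  by move=> _; rewrite partialZ//; exact/smooth_partial/su.
have FC i j : i \in S -> j \in S -> j != i -> F j i = - F i j.
  move=> iS jS ji; rewrite /F partialC; last exact: su.
  have -> : S :\ j :\ i = S :\ i :\ j.
    by apply/setP => l; rewrite !inE andbCA.
  rewrite !mulrA -mulNr; congr (_ * _).
  rewrite (wsgn_setD1_ne iS ji) (wsgn_setD1_ne jS) 1?eq_sym//.
  by case: ltngtP ji => [ij _|ij _|/val_inj ->]; rewrite ?eqxx// /=; ring.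
have : extd (extd u) S x = - extd (extd u) S x.
  rewrite {1}E [RHS](congr1 -%R E) -sumrN.
  rewrite (exchange_big_dep (mem S))/=; last by move=> i j _ /andP[].
  apply: eq_bigr => j jS; rewrite -sumrN.
  apply: eq_big => i; first by rewrite jS eq_sym.
  by move=> /andP[iS /andP[_ ji]]; rewrite [in RHS](FC i j)// opprK.
lra.
Qed.

End test_forms.

(** * Integration by parts for forms *)

Section parts.
Context {R : realType} {n : nat} (U : set 'rV[R]_n).
Hypotheses (mU : measurable U) (bU : bounded_set U).
Implicit Types (u v phi : dform R n) (S T : {set 'I_n}) (i j : 'I_n) (k : nat).
Let mu := rV_lebesgue R n.

Lemma Rintegral_sum (I : Type) (r : seq I) (P : pred I) (F : I -> 'rV[R]_n -> R) :
  (forall l, P l -> L2fun U (F l)) ->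
  L2fun U (fun x => \sum_(l <- r | P l) F l x) /\
  \int[mu]_(x in U) (\sum_(l <- r | P l) F l x) =
  \sum_(l <- r | P l) \int[mu]_(x in U) F l x.
Proof.
move=> hF; elim: r => [|l r [IH1 IH2]].
  split.
    rewrite [X in L2fun U X](_ : _ = cst 0); first exact: cst_L2fun.
    by apply/funext => x; rewrite big_nil.
  under eq_Rintegral do rewrite big_nil; rewrite big_nil.
  by rewrite Rintegral_cst// mul0r.
have [Pl|Pl] := boolP (P l); last first.
  have E : (fun x => \sum_(l0 <- l :: r | P l0) F l0 x) =
      (fun x => \sum_(l0 <- r | P l0) F l0 x).
    by apply/funext => x; rewrite big_cons (negbTE Pl).
  by rewrite E IH2 big_cons (negbTE Pl).
have E : (fun x => \sum_(l0 <- l :: r | P l0) F l0 x) =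
    (fun x => F l x + \sum_(l0 <- r | P l0) F l0 x).
  by apply/funext => x; rewrite big_cons Pl.
rewrite E big_cons Pl -IH2 -RintegralD//; last 2 first.
- exact: (L2fun_integrable mU bU (hF l Pl)).
- exact: (L2fun_integrable mU bU IH1).
split=> //; have := L2fun_lin mU 1 (hF l Pl) IH1.
by under eq_fun do rewrite mul1r.
Qed.

Lemma parts_reindex phi u x : \sum_T phi T x * cod u T x =
  - \sum_(S : {set 'I_n}) \sum_(i in S) wsgn i S * (phi (S :\ i) x * partial i (u S) x).
Proof.
pose G (i : 'I_n) (T S : {set 'I_n}) := wsgn i S * (phi T x * partial i (u S) x).
transitivity (- \sum_(T : {set 'I_n}) \sum_(i | i \notin T) G i T (i |: T)).
  rewrite -sumrN; apply: eq_bigr => T _; rewrite /cod mulrN mulr_sumr.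
  by congr (- _); apply: eq_bigr => i _; rewrite /G mulrCA.
congr (- _); rewrite (exchange_big_dep predT)//= [RHS](exchange_big_dep predT)//=.
apply: eq_bigr => i _.
rewrite [RHS](reindex_onto (fun T => i |: T) (fun S => S :\ i))/=; last first.
  by move=> S iS; rewrite finset.setD1K.
apply: eq_big => [T|T iT]; last by rewrite /G setU1K.
rewrite !inE eqxx/=; apply/idP/eqP => [iT|<-]; first by rewrite setU1K.
by rewrite !inE eqxx.
Qed.

Lemma extd_parts k phi u : test_form U k phi -> smooth_form u ->
  L2ip U (extd phi) u = L2ip U phi (cod u).
Proof.
move=> tphi su; have sphi := test_form_smooth tphi.
have L2 := smooth_L2s mU bU.
have spu i S : smooth (fun x => phi (S :\ i) x * u S x).
  exact: (smoothM (sphi (S :\ i)) (su S)).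
pose F (i : 'I_n) (S : {set 'I_n}) (x : 'rV[R]_n) := wsgn i S * partial i (fun x => phi (S :\ i) x * u S x) x.
have sF i S : smooth (F i S).
  exact: (smoothM (smooth_cst (wsgn i S)) (smooth_partial i (spu i S))).
have LF i S : L2fun U (F i S) by exact/(continuous_L2fun mU bU)/smooth_continuous.
have E x : \sum_S extd phi S x * u S x =
    \sum_(S : {set 'I_n}) \sum_(i in S) F i S x + \sum_S phi S x * cod u S x.
  rewrite parts_reindex -sumrN -big_split/=; apply: eq_bigr => S _.
  rewrite -sumrN -big_split/= /extd mulr_suml; apply: eq_bigr => i iS.
  rewrite /F (_ : (fun x => phi (S :\ i) x * u S x) = phi (S :\ i) * u S)//.
  rewrite partialM; last 2 first.
  - by move=> y; exact: smooth_derivable.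
  - by move=> y; exact: smooth_derivable.
  rewrite -[(phi (S :\ i) * partial i (u S) + u S * partial i (phi (S :\ i))) x]/
    (phi (S :\ i) x * partial i (u S) x + u S x * partial i (phi (S :\ i)) x).
  ring.
rewrite /L2ip; under eq_Rintegral do rewrite E.
have LS S : L2fun U (fun x => \sum_(i in S) F i S x).
  by have [] := Rintegral_sum (index_enum _) (P := mem S) (F := F^~ S) (fun i _ => LF i S).
have [LFF IFF] := Rintegral_sum (index_enum _) (P := predT) (fun S _ => LS S).
rewrite RintegralD//; last 2 first.
- exact: (L2fun_integrable mU bU LFF).
- apply: (L2fun_integrable mU bU); apply: (continuous_L2fun mU bU).
  apply: smooth_continuous; apply: smooth_sum => S _.
  exact: (smoothM (sphi S) (cod_smooth su S)).
rewrite IFF big1 ?add0r// => S _.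
have [_ ->] := Rintegral_sum (index_enum _) (P := mem S) (F := F^~ S) (fun i _ => LF i S).
rewrite big1// => i iS; rewrite /F RintegralZl//; last first.
  apply: (L2fun_integrable mU bU); apply: (continuous_L2fun mU bU).
  exact/smooth_continuous/smooth_partial/spu.
rewrite integral_partial_compact ?mulr0//.
exact/compact_suppMr/(test_form_supp _ tphi).
Qed.

End parts.

Section weak_uniqueness.
Context {R : realType} {n : nat} (U : set 'rV[R]_n).
Hypotheses (oU : open U) (bU : bounded_set U).
Implicit Types (u v phi : dform R n) (S T : {set 'I_n}) (i j : 'I_n) (k : nat).
Let mu := rV_lebesgue R n.
Let mU : measurable U. Proof. exact: measurable_open. Qed.

Lemma test_ae0 k v : kform k v -> L2s U v ->
  (forall phi, test_form U k phi -> L2ip U phi v = 0) -> ae0 U v.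
Proof.
move=> kv Lv h S; have [Sk|Sk] := eqVneq #|S| k; last first.
  by apply: aeW => x _; exact: kv.
apply: fundamental_lemma_ae => //; first exact: (L2fun_integrable mU bU).
move=> f sf kf.
pose phi : dform R n := fun T => if T == S then f else cst 0.
have tphi : test_form U k phi.
  split=> [T x Tk|T]; first by rewrite /phi; case: eqP => // TS; rewrite -Sk TS eqxx in Tk.
  rewrite /phi; case: eqP => _; first by split.
  by split; [exact: smooth_cst|exact: compact_supp0].
have := h phi tphi.
have Lphi : L2s U phi by exact/(smooth_L2s mU bU)/test_form_smooth/tphi.
rewrite L2ipE// (bigD1 S)//= big1 => [|T /negbTE TS].
  rewrite addr0 /phi eqxx => h0.
  have fv : mu.-integrable U (fun x => (f x * v S x)%:E).
    by have := L2fun_mul mU (Lphi S) (Lv S); rewrite /phi eqxx.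
  by rewrite -(fineK (integrable_fin_num mU fv)) -[fine _]/(Rintegral _ _ _) h0.
rewrite /phi TS; under eq_Rintegral do rewrite mul0r.
by rewrite Rintegral_cst// mul0r.
Qed.

End weak_uniqueness.

(** * The weak codifferential *)

Section codifferential.
Context {R : realType} {n : nat} (U : set 'rV[R]_n).
Hypotheses (oU : open U) (bU : bounded_set U).
Implicit Types (u v w phi : dform R n) (k : nat).
Let mU : measurable U. Proof. exact: measurable_open. Qed.
Let lL := @L2s_subspace R n U mU.
Let hip := @L2ip_form_on R n U mU.

Lemma L2form_subspace k : subspace (@L2form R n U k).
Proof. exact: (subspaceI (@kform_subspace R n k) lL). Qed.

Lemma test_L2s k : test_form U k `<=` @L2s R n U.
Proof. by move=> phi /test_form_smooth; exact: smooth_L2s. Qed.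

Lemma test_L2form k : test_form U k `<=` @L2form R n U k.
Proof. by move=> phi t; split; [case: t|exact: test_L2s t]. Qed.

Lemma L2norm_ge0 u : 0 <= L2norm U u. Proof. exact: sqrtr_ge0. Qed.

Lemma L2norm_ae u v : L2s U u -> L2s U v -> ae0 U (u - v) ->
  L2norm U u = L2norm U v.
Proof.
move=> Lu Lv uv; rewrite /L2norm; congr Num.sqrt.
rewrite (L2ip_ae mU Lu Lu Lv uv) (formC hip Lu Lv).
by rewrite (L2ip_ae mU Lv Lu Lv uv).
Qed.

Lemma L2norm_ae0 u : L2s U u -> ae0 U u -> L2norm U u = 0.
Proof. by move=> Lu u0; rewrite /L2norm (L2ip_ae0 mU Lu Lu u0) sqrtr0. Qed.

Lemma L2norm_triangle u v : L2s U u -> L2s U v ->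
  L2norm U (u + v) <= L2norm U u + L2norm U v.
Proof. by move=> Lu Lv; exact: (form_norm_triangle lL hip Lu Lv). Qed.

Lemma L2normZ a u : L2s U u -> L2norm U (a *: u) = `|a| * L2norm U u.
Proof. by move=> Lu; exact: (form_normZ lL hip a Lu). Qed.

Lemma is_codiff_unique k u v w : is_codiff U k u v -> is_codiff U k u w ->
  ae0 U (v - w).
Proof.
move=> [Lv hv] [Lw hw]; apply: (test_ae0 oU bU (k := k.-1)).
- exact: (subspaceB (kform_subspace k.-1) Lv.1 Lw.1).
- exact: (subspaceB lL Lv.2 Lw.2).
move=> phi tphi; rewrite (formBr lL hip Lv.2 Lw.2 (test_L2s tphi)).
by rewrite -hv// -hw// subrr.
Qed.

Lemma codiffP k u v : is_codiff U k u v -> is_codiff U k u (codiff U k u).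
Proof. by move=> h; apply: (@xgetPex _ 0 [set v | is_codiff U k u v]); exists v. Qed.

Lemma codiff_ae k u v : is_codiff U k u v -> ae0 U (codiff U k u - v).
Proof. by move=> h; exact: is_codiff_unique (codiffP h) h. Qed.

Lemma is_codiff_lin k a u u' v v' : L2s U u -> L2s U u' ->
  is_codiff U k u v -> is_codiff U k u' v' ->
  is_codiff U k (a *: u + u') (a *: v + v').
Proof.
move=> Lu Lu' [Lv hv] [Lv' hv']; split.
  by case: (L2form_subspace k.-1) => _; exact.
move=> phi tphi; have Lphi := test_L2s tphi.
have Ldphi := test_L2s (extd_test tphi).
have := form_linearr lL hip Ldphi; rewrite /linear_on => ->//.
have := form_linearr lL hip Lphi; rewrite /linear_on => ->//; last 2 first.
- exact: Lv.2.
- exact: Lv'.2.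
by rewrite hv// hv'.
Qed.

Lemma is_codiff_test k phi : test_form U k.+1 phi -> is_codiff U k.+1 phi (cod phi).
Proof.
move=> tphi; split; first exact/test_L2form/cod_test.
by move=> psi tpsi; exact: (extd_parts mU bU tpsi (test_form_smooth tphi)).
Qed.

Lemma is_codiff_codiff k u v : L2s U u -> is_codiff U k.+2 u v ->
  is_codiff U k.+1 v 0.
Proof.
move=> Lu [Lv hv]; split; first exact: (L2form_subspace k).1.
move=> phi tphi; have tdphi := extd_test tphi.
rewrite -hv// extd_extd; last exact: test_form_smooth tphi.
by rewrite (form0l lL hip Lu) (form0r lL hip (test_L2s tphi)).
Qed.

Lemma Hstar0P k u v : L2form U k.+1 u -> is_codiff U k.+1 u v ->
  Hstar0 U k.+1 u <-> forall e : R, 0 < e -> exists phi,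
    [/\ test_form U k.+1 phi, L2norm U (u - phi) < e & L2norm U (v - cod phi) < e].
Proof.
move=> Lu huv.
have cn phi : test_form U k.+1 phi -> codiff_norm U k.+1 (u - phi) =
    Num.sqrt (L2norm U (u - phi) ^+ 2 + L2norm U (v - cod phi) ^+ 2).
  move=> tphi; have h : is_codiff U k.+1 (u - phi) (v - cod phi).
    have := is_codiff_lin (-1) (test_L2s tphi) Lu.2 (is_codiff_test tphi) huv.
    by rewrite !scaleN1r [- phi + _]addrC [- cod phi + _]addrC.
  rewrite /codiff_norm (L2norm_ae _ _ (codiff_ae h))//; last by case: h => -[].
  by have [[]] := codiffP h.
split=> [[_ h] e e0|h].
  have [phi tphi] := h e e0; rewrite cn// => lt_e; exists phi; split=> //.
    apply: le_lt_trans lt_e; rewrite -[leLHS]ger0_norm ?L2norm_ge0//.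
    by rewrite -sqrtr_sqr ler_wsqrtr// lerDl sqr_ge0.
  apply: le_lt_trans lt_e; rewrite -[leLHS]ger0_norm ?L2norm_ge0//.
  by rewrite -sqrtr_sqr ler_wsqrtr// lerDr sqr_ge0.
split; first by split=> //; exists v.
move=> e e0; have [|phi [tphi h1 h2]] := h (e / 2); first by rewrite divr_gt0.
exists phi => //; rewrite cn//.
have a0 := L2norm_ge0 (u - phi); have b0 := L2norm_ge0 (v - cod phi).
move: (L2norm U _) (L2norm U _) h1 h2 a0 b0 => a b h1 h2 a0 b0.
rewrite -(ger0_norm (ltW e0)) -sqrtr_sqr ltr_sqrt ?exprn_gt0//; nra.
Qed.

Lemma Hstar0_subspace k : subspace (@Hstar0 R n U k.+1).
Proof.
have L0 : L2form U k.+1 (0 : dform R n) by case: (L2form_subspace k.+1).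
have t0 : test_form U k.+1 (0 : dform R n) by case: (test_form_subspace U k.+1).
split.
  apply/(Hstar0P L0 (is_codiff_test t0)) => e e0; exists 0; split=> //.
    by rewrite subrr L2norm_ae0//; [exact: L0.2|exact: (ae0_subspace U).1].
  by rewrite subrr L2norm_ae0//; [exact: L0.2|exact: (ae0_subspace U).1].
move=> a u u' hu hu'.
have [[Lu [v huv]] _] := hu; have [[Lu' [v' huv']] _] := hu'.
have huu := is_codiff_lin a Lu.2 Lu'.2 huv huv'.
have Luu : L2form U k.+1 (a *: u + u').
  by case: (L2form_subspace k.+1) => _; exact.
apply/(Hstar0P Luu huu) => e e0.
have a1 : 0 < `|a| + 1 by rewrite ltr_wpDl.
have d0 : 0 < e / (2 * (`|a| + 1)) by rewrite divr_gt0// mulr_gt0.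
have d1 : 0 < e / 2 by rewrite divr_gt0.
have /(Hstar0P Lu huv)/(_ _ d0)[phi [tphi h1 h2]] := hu.
have /(Hstar0P Lu' huv')/(_ _ d1)[psi [tpsi h3 h4]] := hu'.
have tt : test_form U k.+1 (a *: phi + psi).
  by case: (test_form_subspace U k.+1) => _; exact.
have est x y : L2s U x -> L2s U y -> L2norm U x < e / (2 * (`|a| + 1)) ->
    L2norm U y < e / 2 -> L2norm U (a *: x + y) < e.
  move=> Lx Ly hx hy; have Lax : L2s U (a *: x) by exact: (subspaceZ a lL Lx).
  rewrite (le_lt_trans (L2norm_triangle Lax Ly))// (L2normZ a Lx).
  rewrite [ltRHS](splitr e) ltr_leD// ?(ltW hy)//.
  rewrite (le_lt_trans (y := (`|a| + 1) * L2norm U x))//.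
    by rewrite ler_wpM2r ?L2norm_ge0// lerDl.
  rewrite -(@ltr_pM2l _ (`|a| + 1)^-1) ?invr_gt0// mulKf ?gt_eqF//.
  by rewrite mulrC -mulrA -invfM.
have lin x y x' y' : a *: x + y - (a *: x' + y') =
    a *: (x - x') + (y - y') :> dform R n.
  by rewrite scalerBr opprD addrACA.
exists (a *: phi + psi); split=> //.
  rewrite lin; apply: est => //.
  - exact: (subspaceB lL Lu.2 (test_L2s tphi)).
  - exact: (subspaceB lL Lu'.2 (test_L2s tpsi)).
rewrite (cod_linear a (test_form_smooth tphi) (test_form_smooth tpsi)) lin.
apply: est => //.
- exact: (subspaceB lL huv.1.2 (test_L2s (cod_test tphi))).
- exact: (subspaceB lL huv'.1.2 (test_L2s (cod_test tpsi))).
Qed.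

Lemma Hstar0_codiff k u v : Hstar0 U k.+2 u -> is_codiff U k.+2 u v ->
  Hstar0 U k.+1 v.
Proof.
move=> hu huv; have [[Lu _] _] := hu.
have hv0 := is_codiff_codiff Lu.2 huv.
apply/(Hstar0P huv.1 hv0) => e e0.
have /(Hstar0P Lu huv)/(_ _ e0)[phi [tphi _ h2]] := hu.
have tcphi := cod_test tphi.
exists (cod phi); split; [exact: tcphi|exact: h2|].
have L0 : L2s U (0 : dform R n) by case: lL.
have Lcc := test_L2s (cod_test tcphi).
have h0 := is_codiff_codiff (test_L2s tphi) (is_codiff_test tphi).
rewrite L2norm_ae0; [exact: e0|exact: (subspaceB lL L0 Lcc)|].
exact: (is_codiff_unique h0 (is_codiff_test tcphi)).
Qed.

End codifferential.

(** * Simplices *)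

Section simplex_geometry.
Context {R : realType} {n : nat} (V : 'M[R]_(n.+1, n)).
Hypothesis aV : affinely_independent V.
Let mu := rV_lebesgue R n.
Let A : 'M[R]_(n.+1, n + 1) := row_mx V (const_mx 1).
Let B := pinvmx A.

Let fullA : row_full A.
Proof. by rewrite /row_full (eqP aV) addn1. Qed.

Definition bary (x : 'rV[R]_n) : 'rV[R]_n.+1 := row_mx x (1%:M : 'M[R]_1) *m B.

Lemma baryK (t : 'rV[R]_n.+1) : \sum_i t ord0 i = 1 -> bary (t *m V) = t.
Proof.
move=> t1; rewrite /bary (_ : row_mx _ _ = t *m A).
  by rewrite -mulmxA mulmxVp// mulmx1.
rewrite mul_mx_row; congr row_mx; apply/matrixP => i j.
rewrite !mxE !ord1 eqxx; under [RHS]eq_bigr do rewrite mxE mulr1.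
by rewrite t1.
Qed.

Lemma bary_mul x : bary x *m V = x /\ \sum_i bary x ord0 i = 1.
Proof.
have : bary x *m A = row_mx x 1%:M by rewrite -mulmxA mulVpmx// mulmx1.
rewrite mul_mx_row => /eq_row_mx[-> /matrixP/(_ ord0 ord0)].
rewrite !mxE eqxx => h; split=> //; rewrite -[RHS]h.
by apply: eq_bigr => i _; rewrite !mxE mulr1.
Qed.

Lemma simplexE : simplex V = [set x | forall i, 0 <= bary x ord0 i].
Proof.
apply/seteqP; split=> [_ [t [t0 _ t1] <-] i|x x0].
  by rewrite baryK.
exists (bary x); last by case: (bary_mul x).
by split=> // [i|]; [rewrite inE|case: (bary_mul x)].
Qed.

Lemma bary_affine i : exists c (a : 'rV[R]_n),
  forall x, bary x ord0 i = c + \sum_j a ord0 j * x ord0 j.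
Proof.
exists (B (rshift n ord0) i), (\row_j B (lshift 1 j) i) => x.
rewrite mxE big_split_ord/= addrC big_ord1; congr (_ + _).
  by rewrite row_mxEr mxE eqxx mul1r.
by apply: eq_bigr => j _; rewrite row_mxEl mxE mulrC.
Qed.

Lemma bary_gt0_interior x : (forall i, 0 < bary x ord0 i) -> (simplex V)^° x.
Proof.
move=> hx; have oP : open [set x | forall i, 0 < bary x ord0 i].
  rewrite openE => y hy; apply: (@filter_forall _ _
    (fun i (z : 'rV[R]_n) => is_true (0 < bary z ord0 i)) (nbhs y) _) => i /=.
  have : open ((fun z => bary z ord0 i) @^-1` [set s | 0 < s]).
    apply: open_comp; last exact: open_gt.
    by move=> z _; apply: affine_continuous; exact: bary_affine.
  by rewrite openE => /(_ y); apply; exact: hy.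
rewrite simplexE.
apply: (filterS (P := [set x | forall i, 0 < bary x ord0 i])).
  by move=> y hy i; exact: ltW.
by apply: open_nbhs_nbhs; split.
Qed.

Lemma simplex_interior_nonempty : (simplex V)^° !=set0.
Proof.
pose t : 'rV[R]_n.+1 := const_mx n.+1%:R^-1.
have t1 : \sum_i t ord0 i = 1.
  under eq_bigr do rewrite mxE; rewrite sumr_const card_ord -[LHS]mulr_natr.
  by rewrite mulVf// pnatr_eq0.
exists (t *m V); apply: bary_gt0_interior => i.
by rewrite baryK// mxE invr_gt0 ltr0n.
Qed.

Lemma simplex_boundary_null : (0 < n)%N ->
  mu.-negligible (simplex V `\` (simplex V)^°).
Proof.
move=> n0.
pose Z (i : 'I_n.+1) := [set x | bary x ord0 i = 0].
have nZ i : mu.-negligible (Z i).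
  have [c [a h]] := bary_affine i.
  have -> : Z i = [set x | c + \sum_j a ord0 j * x ord0 j = 0].
    by apply/seteqP; split=> x; rewrite /Z/= h.
  have ca : continuous (fun x : 'rV[R]_n => c + \sum_j a ord0 j * x ord0 j).
    by apply: affine_continuous; exists c, a.
  have mZ : measurable ((fun x : 'rV[R]_n => c + \sum_j a ord0 j * x ord0 j)
      @^-1` [set (0 : R)]).
    by rewrite -[X in measurable X]setTI; exact: (measurable_continuous ca).
  apply/negligibleP; first exact: mZ.
  apply: lebesgue_hyperplane; apply/eqP => a0.
  have hc x : bary x ord0 i = c.
    by rewrite h a0 big1 ?addr0// => j _; rewrite mxE mul0r.
  have dl l : bary (delta_mx ord0 l *m V) = delta_mx ord0 l.
    rewrite baryK// (bigD1 l)//= big1 => [|j /negbTE jl].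
      by rewrite mxE !eqxx addr0.
    by rewrite mxE jl.
  have [l li] : exists l : 'I_n.+1, l != i.
    have [i0|i0] := eqVneq i ord0; last by exists ord0; rewrite eq_sym.
    by exists ord_max; rewrite i0 -(inj_eq val_inj)/= -lt0n.
  have := hc (delta_mx ord0 i *m V); have := hc (delta_mx ord0 l *m V).
  rewrite !dl !mxE !eqxx eq_sym (negbTE li) => /= <- /eqP.
  by rewrite oner_eq0.
have nU : mu.-negligible (\big[setU/set0]_(i < n.+1) Z i).
  elim/big_ind: _ => [|X Y|i _]; [exact: negligible_set0|exact: negligibleU|exact: nZ].
apply: negligibleS nU => x [xV nx]; rewrite -bigcup_seq.
apply: contrapT => h; apply: nx.
have pos i : 0 < bary x ord0 i.
  move: xV; rewrite simplexE => /(_ i); rewrite le_eqVlt => /orP[/eqP xi|//].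
  by exfalso; apply: h; exists i; [rewrite /= mem_index_enum|exact: esym xi].
exact: bary_gt0_interior.
Qed.

End simplex_geometry.

Section affine_ae.
Context {R : realType} {n : nat} (U : set 'rV[R]_n).
Hypotheses (oU : open U) (U0 : U !=set0).
Let mu := rV_lebesgue R n.

Lemma affine_ae0 (g : 'rV[R]_n -> R) : affine_fun g ->
  (\forall x \ae mu, U x -> g x = 0) -> g = cst 0.
Proof.
move=> ag h; have [c [a gE]] := ag; apply/funext => y.
have mU : measurable U by exact: measurable_open.
have mg := measurable_continuous (affine_continuous ag) measurableT.
have mZ : measurable (g @^-1` [set (0 : R)]).
  by rewrite -[X in measurable X]setTI; exact: mg.
have muU := lebesgue_open_gt0 oU U0.
have [Z0|Z0] := eqVneq a 0.
  have gc x : g x = c by rewrite gE Z0 big1 ?addr0// => i _; rewrite mxE mul0r.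
  rewrite gc; apply: contrapT => c0.
  have /negligibleP : mu.-negligible U.
    by apply: negligibleS h => x Ux /= /(_ Ux); rewrite gc.
  by move=> /(_ mU) E; move: muU; rewrite -/mu E ltxx.
exfalso.
have nZ : mu.-negligible (g @^-1` [set (0 : R)]).
  apply/negligibleP => //; rewrite -[RHS](lebesgue_hyperplane c Z0).
  by congr (rV_lebesgue R n _); apply/seteqP; split=> x /=; rewrite gE.
have /negligibleP : mu.-negligible U.
  have := negligibleU h nZ; apply: negligibleS => x Ux.
  by have [gx|gx] := eqVneq (g x) 0; [right|left => /(_ Ux)/eqP; exact/negP].
by move=> /(_ mU) E; move: muU; rewrite -/mu E ltxx.
Qed.

End affine_ae.

(** * Piecewise smooth forms *)

Section piecewise_forms.
Context {R : realType} {n : nat} (Om : set 'rV[R]_n).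
Context {T : finType} (vtx : T -> 'M[R]_(n.+1, n)).
Hypotheses (n_gt0 : (0 < n)%N) (oOm : open Om) (bOm : bounded_set Om).
Hypothesis subdiv : simplicial_subdivision Om vtx.
Let mu := rV_lebesgue R n.
Let mOm : measurable Om. Proof. exact: measurable_open. Qed.
Let cell t := (simplex (vtx t))^°.
Implicit Types (u v w : T -> dform R n) (t : T) (S : {set 'I_n}) (k : nat).
Local Notation pw := (pw_form vtx).

Let cell_open t : open (cell t). Proof. exact: open_interior. Qed.

Let cell_sub t : cell t `<=` Om. Proof. by case: subdiv => _ _ + _ _; exact. Qed.

Let cell_nonempty t : cell t !=set0.
Proof. by case: subdiv => + _ _ _ _ => /(_ t); exact: simplex_interior_nonempty. Qed.

Let cell_bounded t : bounded_set (cell t).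
Proof. by case: bOm => M [Mr h]; exists M; split=> // e /h he x /cell_sub /he. Qed.

Lemma pw_form_cell w t S x : cell t x -> pw w S x = w t S x.
Proof.
move=> tx; rewrite /pw_form (bigD1 t)//= big1 => [|t' t't].
  by rewrite indicE mem_set// mulr1 addr0.
rewrite indicE memNset ?mulr0// => t'x; case: subdiv => _ _ _ + _.
by move=> /(_ t' t t't)/seteqP[+ _] => /(_ x); exact.
Qed.

Lemma cells_ae : \forall x \ae mu, Om x -> exists t, cell t x.
Proof.
pose N := \big[setU/set0]_t (simplex (vtx t) `\` cell t).
have nN : mu.-negligible N.
  rewrite /N; elim/big_ind: _ => [|X Y|t _].
  - exact: negligible_set0.
  - exact: negligibleU.
  - by apply: simplex_boundary_null => //; case: subdiv.
apply: negligibleS nN => x /not_implyP[Omx nx]; rewrite /N -bigcup_seq.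
have : (\bigcup_t simplex (vtx t)) x.
  by case: subdiv => _ <- _ _ _; exact: subset_closure.
move=> [t _ tx]; exists t; first by rewrite /= mem_index_enum.
by split=> // ctx; apply: nx; exists t.
Qed.

Lemma pw_formD (a : R) u v : pw (a *: u + v) = a *: pw u + pw v.
Proof.
apply/funext => S; apply/funext => x; rewrite dformD dformZ /pw_form.
rewrite mulr_sumr -big_split/=; apply: eq_bigr => t _.
rewrite -[(a *: u + v) t S x]/(a * u t S x + v t S x); ring.
Qed.

Lemma pw_form0 : pw 0 = 0.
Proof.
apply/funext => S; apply/funext => x; rewrite dform0 /pw_form big1// => t _.
by rewrite -[(0 : T -> dform R n) t S x]/(0 : R) mul0r.
Qed.

Lemma L2fun_indic f (A : set 'rV[R]_n) : measurable A -> L2fun Om f ->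
  L2fun Om (fun x => f x * \1_A x).
Proof.
move=> mA [mf f2]; have mi : measurable_fun Om (\1_A : 'rV[R]_n -> R).
  exact: measurable_indic.
have mfi : measurable_fun Om (fun x => f x * \1_A x) by exact: measurable_funM.
split=> //; apply: le_integrable f2 => //.
  by apply/measurable_EFinP; exact: measurable_funM.
move=> x _; rewrite !abse_EFin lee_fin !ger0_norm ?sqr_ge0//.
by rewrite indicE; case: (_ \in _); rewrite ?mulr1// mulr0 expr0n sqr_ge0.
Qed.

Definition pw_smooth : set (T -> dform R n) := piecewise (@smooth_form R n).
Definition pw_affine : set (T -> dform R n) := piecewise (@affine_form R n).

Lemma pw_affine_smooth : pw_affine `<=` pw_smooth.
Proof. by move=> w aw t; exact/affine_smooth_form/aw. Qed.

Lemma piecewise_subspace (P : set (dform R n)) : subspace P ->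
  subspace (@piecewise R n T P).
Proof.
move=> [P0 hP]; split; first by move=> t; exact: P0.
by move=> a u v Pu Pv t; exact: (hP a _ _ (Pu t) (Pv t)).
Qed.

Lemma pw_smooth_L2s w : pw_smooth w -> L2s Om (pw w).
Proof.
move=> sw S; rewrite /pw_form.
have h t : L2fun Om (fun x => w t S x * \1_(cell t) x).
  apply: L2fun_indic; first exact: measurable_open.
  exact/(continuous_L2fun mOm bOm)/smooth_continuous/sw.
by have [] := Rintegral_sum mOm bOm (index_enum T) (P := predT) (fun t _ => h t).
Qed.

Lemma pw_kform k w : (forall t, kform k (w t)) -> kform k (pw w).
Proof.
move=> kw S x Sk; rewrite /pw_form big1// => t _.
by rewrite (kw t S x Sk) mul0r.
Qed.

Lemma L2ip_restrict (U : set 'rV[R]_n) (f g f' g' : dform R n) : U `<=` Om ->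
  (forall S x, Om x -> ~ U x -> f S x = 0) ->
  (forall S x, U x -> f' S x * g' S x = f S x * g S x) ->
  L2ip Om f g = L2ip U f' g'.
Proof.
move=> UOm f0 fg; rewrite /L2ip Rintegral_mkcond [RHS]Rintegral_mkcond.
apply: eq_Rintegral => x _; rewrite !patchE.
have [Ux|Ux] := pselect (U x).
  rewrite !mem_set//; last exact: UOm.
  by apply: eq_bigr => S _; rewrite fg.
rewrite (memNset Ux); case: ifPn => // /set_mem Omx.
by rewrite big1// => S _; rewrite f0// mul0r.
Qed.

Lemma pw_affine_definite w : pw_affine w -> ip Om vtx w w = 0 -> w = 0.
Proof.
move=> aw w0; have h := L2ip_eq0 mOm (pw_smooth_L2s (pw_affine_smooth aw)) w0.
apply/funext => t; apply/funext => S; transitivity (cst 0 : 'rV[R]_n -> R) => //.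
apply: (@affine_ae0 R n (cell t) (@cell_open t) (@cell_nonempty t)).
  exact: aw.
have := h S; apply: filterS => x hx tx.
by rewrite -(pw_form_cell w S tx); exact/hx/cell_sub/tx.
Qed.

Lemma pw_codiff_ae k w (v : dform R n) : pw_smooth w -> (forall t, kform k.+1 (w t)) ->
  is_codiff Om k.+1 (pw w) v -> ae0 Om (pw (fun t => cod (w t)) - v).
Proof.
move=> sw kw [[kv Lv] hv].
have ht t : ae0 (cell t) (cod (w t) - v).
  have mt : measurable (cell t) by exact: measurable_open.
  have Lvt : L2s (cell t) v.
    move=> S; have [mv v2] := Lv S; split.
      exact: measurable_funS (@cell_sub t) mv.
    exact: integrableS (@cell_sub t) v2.
  have Lc := smooth_L2s mt (@cell_bounded t) (cod_smooth (sw t)).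
  have kd := subspaceB (kform_subspace k) (cod_kform (kw t)) kv.
  have Ld := subspaceB (L2s_subspace mt) Lc Lvt.
  suff hd phi : test_form (cell t) k phi -> L2ip (cell t) phi (cod (w t) - v) = 0.
    exact: (test_ae0 (@cell_open t) (@cell_bounded t) kd Ld hd).
  move=> tphi.
  have Lphi := smooth_L2s mt (@cell_bounded t) (test_form_smooth tphi).
  have tOm : test_form Om k phi.
    case: tphi => kphi hphi; split=> // S; have [s [K [cK Kt f0]]] := hphi S.
    by split=> //; exists K; split=> // x /Kt/cell_sub.
  have out j (psi : dform R n) : test_form (cell t) j psi ->
      forall S x, Om x -> ~ cell t x -> psi S x = 0.
    by move=> [_ hp] S x _ tx; have [_ [K [_ Kt f0]]] := hp S; apply: f0 => /Kt.
  rewrite (formBr (L2s_subspace mt) (L2ip_form_on mt))//.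
  have <- : L2ip Om phi v = L2ip (cell t) phi v.
    by apply: L2ip_restrict (out _ _ tphi) _ => //; exact: cell_sub.
  rewrite -hv// (L2ip_restrict (U := cell t) (f' := extd phi) (g' := w t)).
  - by rewrite (extd_parts mt (@cell_bounded t) tphi (sw t)) subrr.
  - exact: cell_sub.
  - exact: out (extd_test tphi).
  - by move=> S x tx; rewrite (pw_form_cell w S tx).
move=> S.
have hall : \forall x \ae mu, forall t, cell t x -> (cod (w t) - v) S x = 0.
  by apply: filter_forall => t; exact: ht.
move: hall cells_ae; apply: filterS2 => x h1 h2 Omx.
have [t tx] := h2 Omx; rewrite -[RHS](h1 t tx).
rewrite -[LHS]/(pw (fun t => cod (w t)) S x - v S x).
by rewrite (pw_form_cell (fun t => cod (w t)) S tx).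
Qed.

End piecewise_forms.

Lemma finite_dim_finType {R : realType} {V : lmodType R} (J : finType)
    (e : J -> V) (D : set V) :
  (forall v, D v -> exists c : J -> R, v = \sum_j c j *: e j) -> finite_dim D.
Proof.
move=> h; exists #|J|, (fun i => e (enum_val i)) => v /h[c ->].
exists (fun i => c (enum_val i)).
by rewrite (reindex _ (onW_bij _ (@enum_val_bij J)))/=.
Qed.

Section affine_dimension.
Context {R : realType} {n : nat} {T : finType}.
Local Notation V := (T -> dform R n).

Let J : finType := (T * {set 'I_n} * option 'I_n)%type.

Let e (j : J) : V := fun t S x =>
  if (t == j.1.1) && (S == j.1.2) then oapp (fun i => x ord0 i) 1 j.2 else 0.

Lemma pw_sumE (I : finType) (F : I -> V) t S x :
  (\sum_i F i) t S x = \sum_i F i t S x.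
Proof. by elim/big_rec2: _ => // i y w _ <-. Qed.

Lemma pw_affine_finite_dim : finite_dim (@pw_affine R n T).
Proof.
apply: (finite_dim_finType (e := e)) => w aw.
have aw' (p : T * {set 'I_n}) : exists c : R * 'rV[R]_n,
    forall x, w p.1 p.2 x = c.1 + \sum_i c.2 ord0 i * x ord0 i.
  by have [c [a h]] := aw p.1 p.2; exists (c, a).
have [c hc] := choice aw'.
exists (fun j : J => oapp (fun i => (c j.1).2 ord0 i) (c j.1).1 j.2).
apply/funext => t; apply/funext => S; apply/funext => x; rewrite pw_sumE.
rewrite -(pair_bigA _ (fun (p : T * {set 'I_n}) (o : option 'I_n) =>
  (oapp (fun i => (c p).2 ord0 i) (c p).1 o *: e (p, o)) t S x))/=.
rewrite (bigD1 (t, S))//= [X in _ + X]big1 ?addr0 => [|[t' S'] ne]; last first.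
  apply: big1 => o _; rewrite -[LHS]/(_ * e _ t S x) /e/=.
  case: ifPn => [/andP[/eqP tt /eqP SS]|_]; last by rewrite mulr0.
  by rewrite tt SS eqxx in ne.
rewrite (hc (t, S)) (bigD1 None)//=; congr (_ + _).
  by rewrite -[RHS]/(_ * e _ t S x) /e/= !eqxx mulr1.
rewrite [RHS](reindex_omap Some id)/=; last by case.
apply: eq_big => [i|i _]; first by rewrite eqxx.
by rewrite -[RHS]/(_ * e _ t S x) /e/= !eqxx.
Qed.

End affine_dimension.

(** * Discrete spaces *)

Section discrete_spaces.
Context {R : realType} {n : nat} (Om : set 'rV[R]_n).
Context {T : finType} (vtx : T -> 'M[R]_(n.+1, n)).
Hypotheses (n_gt0 : (0 < n)%N) (oOm : open Om) (bOm : bounded_set Om).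
Hypothesis subdiv : simplicial_subdivision Om vtx.
Let mOm : measurable Om. Proof. exact: measurable_open. Qed.
Local Notation V := (T -> dform R n).
Implicit Types (u v w eta tau : V) (k : nat).
Local Notation pw := (pw_form vtx).
Local Notation G := (@pw_affine R n T).
Local Notation ipp := (ip Om vtx).
Let lL := @L2s_subspace R n Om mOm.
Let hL := @L2ip_form_on R n Om mOm.

Definition cod_h w : V := fun t => cod (w t).

Lemma pw_affine_subspace : subspace G.
Proof. exact: piecewise_subspace (@affine_form_subspace R n). Qed.

Lemma pw_affine_L2s w : G w -> L2s Om (pw w).
Proof. by move=> /pw_affine_smooth; exact: pw_smooth_L2s. Qed.

Lemma ip_form_on : form_on G ipp.
Proof.
have [h1 h2 h3] := hL; split.
- move=> a u v w Gu Gv Gw; rewrite /ip pw_formD.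
  exact: (h1 _ _ _ _ (pw_affine_L2s Gu) (pw_affine_L2s Gv) (pw_affine_L2s Gw)).
- by move=> u v Gu Gv; exact: (h2 _ _ (pw_affine_L2s Gu) (pw_affine_L2s Gv)).
- by move=> u Gu; exact: (h3 _ (pw_affine_L2s Gu)).
Qed.

Lemma ip_definite_on : definite_on G ipp.
Proof. by move=> u Gu; exact: pw_affine_definite oOm bOm subdiv _ Gu. Qed.

Let lG := pw_affine_subspace.
Let fG := @pw_affine_finite_dim R n T.
Let hip := ip_form_on.
Let dip := ip_definite_on.

Lemma pw_ip_linear (f : dform R n) : L2s Om f ->
  linear_on G (W := R^o) (fun mu => L2ip Om f (pw mu)).
Proof.
move=> Lf a u v Gu Gv; rewrite pw_formD.
exact: (form_linearr lL hL Lf a (pw_affine_L2s Gu) (pw_affine_L2s Gv)).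
Qed.

Lemma P0h_subspace k : subspace (@P0h R n T k).
Proof. exact: piecewise_subspace (@P0_subspace R n k). Qed.

Lemma P0h_sub k : @P0h R n T k `<=` G.
Proof. by move=> w Pw t; exact/P1minus_affine/P0_sub_P1minus/Pw. Qed.

Lemma Wstar0_sub k : Wstar0 Om vtx k `<=` G.
Proof. by move=> w [Pw _] t; exact/P1starminus_affine/Pw. Qed.

Lemma Wnc_sub k : Wnc Om vtx k `<=` G.
Proof. by move=> w [Pw _] t; exact/P1minus_affine/Pw. Qed.

Lemma Wstar0_subspace k : subspace (Wstar0 Om vtx k.+1).
Proof.
have lP := piecewise_subspace (T := T) (@P1starminus_subspace R n k.+1).
have lH := Hstar0_subspace oOm bOm k.
split; first by split; [exact: subspace0|rewrite pw_form0; exact: (subspace0 lH)].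
move=> a u v [Pu Hu] [Pv Hv]; split; first exact: (lP.2 a u v Pu Pv).
by rewrite pw_formD; exact: (lH.2 a _ _ Hu Hv).
Qed.

Lemma extd_h_linear : linear_on G (W := V) (@extd_h R n T).
Proof.
move=> a u v Gu Gv; apply/funext => t.
by exact: (extd_linear a (affine_smooth_form (Gu t)) (affine_smooth_form (Gv t))).
Qed.

Lemma cod_h_linear : linear_on G (W := V) cod_h.
Proof.
move=> a u v Gu Gv; apply/funext => t.
by exact: (cod_linear a (affine_smooth_form (Gu t)) (affine_smooth_form (Gv t))).
Qed.

Lemma extd_h_P0h k w : Wnc Om vtx k w -> P0h k.+1 (extd_h w).
Proof. by move=> [Pw _] t; exact: extd_P0 (Pw t). Qed.

Lemma cod_h_P0h k w : (k < n)%N -> Wstar0 Om vtx k.+1 w -> P0h k (cod_h w).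
Proof. by move=> kn [Pw _] t; exact: cod_P0 kn (Pw t). Qed.

Section weak_codifferential.
Context (k : nat) (kn : (k < n)%N).

Lemma codiff_h_is_codiff eta : Wstar0 Om vtx k.+1 eta ->
  is_codiff Om k.+1 (pw eta) (codiff_h Om vtx k.+1 eta).
Proof. by move=> [_ [[_ [v hv]] _]]; exact: codiffP hv. Qed.

Lemma codiff_h_ae eta : Wstar0 Om vtx k.+1 eta ->
  ae0 Om (pw (cod_h eta) - codiff_h Om vtx k.+1 eta).
Proof.
move=> We; have [Pe _] := We.
apply: (pw_codiff_ae n_gt0 oOm bOm subdiv _ _ (codiff_h_is_codiff We)).
  exact: pw_affine_smooth (Wstar0_sub We).
by move=> t; exact: P1starminus_kform kn _ (Pe t).
Qed.

Lemma codiff_h_L2s eta : Wstar0 Om vtx k.+1 eta ->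
  L2s Om (codiff_h Om vtx k.+1 eta).
Proof. by move=> /codiff_h_is_codiff[[]]. Qed.

Lemma cod_h_L2s eta : Wstar0 Om vtx k.+1 eta -> L2s Om (pw (cod_h eta)).
Proof. by move=> We; exact/pw_affine_L2s/P0h_sub/(cod_h_P0h kn We). Qed.

Lemma codiff_h_ip (f : dform R n) eta : L2s Om f -> Wstar0 Om vtx k.+1 eta ->
  L2ip Om f (codiff_h Om vtx k.+1 eta) = L2ip Om f (pw (cod_h eta)).
Proof.
move=> Lf We; apply/esym.
exact: (L2ip_ae mOm Lf (cod_h_L2s We) (codiff_h_L2s We) (codiff_h_ae We)).
Qed.

Lemma codiff_h_norm eta : Wstar0 Om vtx k.+1 eta ->
  L2ip Om (codiff_h Om vtx k.+1 eta) (codiff_h Om vtx k.+1 eta) =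
  ipp (cod_h eta) (cod_h eta).
Proof.
move=> We; have Lc := codiff_h_L2s We; have Ld := cod_h_L2s We.
by rewrite (codiff_h_ip Lc We) (formC hL Lc Ld) (codiff_h_ip Ld We).
Qed.

Lemma pw_cod_h_is_codiff eta : Wstar0 Om vtx k.+1 eta ->
  is_codiff Om k.+1 (pw eta) (pw (cod_h eta)).
Proof.
move=> We; have [_ h] := codiff_h_is_codiff We; split.
  split; last exact: cod_h_L2s.
  apply: pw_kform => t; apply: cod_kform.
  by exact: P1starminus_kform kn _ (We.1 t).
move=> phi tphi; rewrite h// codiff_h_ip//; exact: test_L2s tphi.
Qed.

Lemma Wnc_subspace : subspace (Wnc Om vtx k).
Proof.
have lP := piecewise_subspace (T := T) (@P1minus_subspace R n k).
split.
  split=> [|eta We]; first exact: subspace0 lP.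
  rewrite pw_form0 (form0l lL hL (codiff_h_L2s We)).
  rewrite (linear_on0 lG extd_h_linear) (form0l lG hip (Wstar0_sub We)).
  by rewrite subrr.
move=> a u v Wu Wv; split=> [|eta We]; first exact: (lP.2 a _ _ Wu.1 Wv.1).
have Gu := Wnc_sub Wu; have Gv := Wnc_sub Wv; have Ge := Wstar0_sub We.
have Gdu := P0h_sub (extd_h_P0h Wu); have Gdv := P0h_sub (extd_h_P0h Wv).
rewrite pw_formD (extd_h_linear a Gu Gv); have [h _ _] := hip.
rewrite (h a _ _ _ Gdu Gdv Ge); have [h' _ _] := hL.
rewrite (h' a _ _ _ (pw_affine_L2s Gu) (pw_affine_L2s Gv) (codiff_h_L2s We)).
by rewrite opprD addrACA -mulrBr (Wu.2 _ We) (Wv.2 _ We) mulr0 addr0.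
Qed.

Lemma Wnc_ip w eta : Wnc Om vtx k w -> Wstar0 Om vtx k.+1 eta ->
  ipp w (cod_h eta) = ipp (extd_h w) eta.
Proof.
move=> Ww We; apply/eqP; rewrite -subr_eq0; apply/eqP.
rewrite -[X in _ = X](Ww.2 _ We); congr (_ - _).
by rewrite (codiff_h_ip (pw_affine_L2s (Wnc_sub Ww)) We).
Qed.

Lemma cod_h_eq0 w : Wstar0 Om vtx k.+1 w -> cod_h w = 0 -> P0h k.+1 w.
Proof.
by move=> [Pw _] w0 t; apply: cod_eq0 kn (Pw t) _; exact: (congr1 (@^~ t) w0).
Qed.

End weak_codifferential.

Lemma extd_h_eq0 k w : Wnc Om vtx k w -> extd_h w = 0 -> P0h k w.
Proof. by move=> [Pw _] w0 t; apply: extd_eq0 (Pw t) _; exact: (congr1 (@^~ t) w0). Qed.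

Lemma cod_h_extd_h_orth k eta tau : (k.+1 < n)%N ->
  Wstar0 Om vtx k.+2 eta -> Wnc Om vtx k tau -> ipp (cod_h eta) (extd_h tau) = 0.
Proof.
move=> kn We Wt; have kn' := ltnW kn.
have Ge := Wstar0_sub We; have Gt := Wnc_sub Wt.
have hc := pw_cod_h_is_codiff kn We.
have Gc := P0h_sub (cod_h_P0h kn We).
have Wc : Wstar0 Om vtx k.+1 (cod_h eta).
  split; last exact: (Hstar0_codiff oOm bOm We.2 hc).
  by move=> t; exact/(P0_sub_P1starminus kn')/(cod_h_P0h kn We).
rewrite (formC hip Gc (P0h_sub (extd_h_P0h Wt))).
rewrite -(Wnc_ip kn' Wt Wc).
apply: (L2ip_ae0 mOm (pw_affine_L2s Gt) (cod_h_L2s kn' Wc)).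
have := is_codiff_unique oOm bOm (pw_cod_h_is_codiff kn' Wc)
  (is_codiff_codiff oOm bOm (pw_affine_L2s Ge) hc).
by rewrite subr0.
Qed.

Section projection.
Context (k : nat).
Local Notation proj := (proj_h Om vtx k).
Local Notation P := (@P0h R n T k).
Let lP := P0h_subspace k.

Lemma proj_hP w : G w -> P (proj w) /\ forall q, P q -> ipp (proj w) q = ipp w q.
Proof.
move=> Gw; apply: (@xgetPex _ 0 [set p | P p /\ forall q, P q -> ipp p q = ipp w q]).
have [r Pr hr] := riesz lP (sub_finite_dim (@P0h_sub k) fG)
  (sub_form_on (@P0h_sub k) hip) (sub_definite_on (@P0h_sub k) dip)
  (linear_on_sub (@P0h_sub k) (form_linearr lG hip Gw)).
by exists r.
Qed.

Lemma proj_h_unique w p : G w -> P p -> (forall q, P q -> ipp p q = ipp w q) ->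
  proj w = p.
Proof.
move=> Gw Pp hp; have [Pw hw] := proj_hP Gw.
have Pd := subspaceB lP Pw Pp.
apply/eqP; rewrite -subr_eq0; apply/eqP/dip; first exact: P0h_sub Pd.
by rewrite (formBl lG hip (P0h_sub Pw) (P0h_sub Pp) (P0h_sub Pd)) hw// hp// subrr.
Qed.

Lemma proj_h_id w : P w -> proj w = w.
Proof. by move=> Pw; apply: proj_h_unique => //; exact: P0h_sub. Qed.

Lemma proj_h_linear : linear_on G (W := V) proj.
Proof.
move=> a u v Gu Gv; have [Pu hu] := proj_hP Gu; have [Pv hv] := proj_hP Gv.
apply: proj_h_unique; [exact: (lG.2 a _ _ Gu Gv)|exact: (lP.2 a _ _ Pu Pv)|].
move=> q Pq; have [h _ _] := hip; have Gq := P0h_sub Pq.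
by rewrite (h _ _ _ _ (P0h_sub Pu) (P0h_sub Pv) Gq) (h _ _ _ _ Gu Gv Gq) hu// hv.
Qed.

Lemma proj_h_ip u v : G u -> P v -> ipp (proj u) (proj v) = ipp u v.
Proof. by move=> Gu Pv; rewrite (proj_h_id Pv); exact: (proj_hP Gu).2. Qed.

Lemma proj_h_sub w : G w -> G (proj w).
Proof. by move=> /proj_hP[/P0h_sub]. Qed.

Lemma proj_h_norm w : G w ->
  Num.sqrt (ipp (proj w) (proj w)) <= Num.sqrt (ipp w w).
Proof.
move=> Gw; have [Pw hw] := proj_hP Gw; have Gp := P0h_sub Pw.
have e : ipp (proj w) (proj w) = ipp w (proj w) by exact: hw.
apply: le_of_sqr_le; first exact: sqrtr_ge0.
rewrite -expr2 sqr_sqrtr ?(form_ge0 hip Gp)// {1}e.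
exact: le_trans (ler_norm _) (cauchy_schwarz lG hip Gw Gp).
Qed.

Lemma proj_h_form_linearr u : G u ->
  linear_on G (W := R^o) (fun v => ipp (proj u) (proj v)).
Proof.
move=> Gu a v w Gv Gw; rewrite (proj_h_linear a Gv Gw).
exact: (form_linearr lG hip (proj_h_sub Gu) a (proj_h_sub Gv) (proj_h_sub Gw)).
Qed.

Lemma proj_h_form_linearl u : G u ->
  linear_on G (W := R^o) (fun v => ipp (proj v) (proj u)).
Proof.
move=> Gu a v w Gv Gw; rewrite (proj_h_linear a Gv Gw).
exact: (form_linearl hip (proj_h_sub Gu) a (proj_h_sub Gv) (proj_h_sub Gw)).
Qed.

Lemma proj_h_form_le u v : G u -> G v ->
  `|ipp (proj u) (proj v)| <= Num.sqrt (ipp u u) * Num.sqrt (ipp v v).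
Proof.
move=> Gu Gv.
rewrite (le_trans (cauchy_schwarz lG hip (proj_h_sub Gu) (proj_h_sub Gv)))//.
by rewrite ler_pM ?sqrtr_ge0// proj_h_norm.
Qed.

End projection.

End discrete_spaces.

(** * The discrete problem *)

Lemma sup_nneg_ge0 {R : realType} (A : set R) : (forall x, A x -> 0 <= x) -> 0 <= sup A.
Proof.
move=> A0; have [sA|/sup_out ->//] := pselect (has_sup A).
have [x Ax] := sA.1; by apply: le_trans (A0 x Ax) _; exact: sup_upper_bound.
Qed.

Lemma icr_ge0 {R : realType} (V W : Type) (ipX : V -> V -> R) (ipY : W -> W -> R)
  (op : V -> W) (D : set V) : 0 <= icr ipX ipY op D.
Proof. by apply: sup_nneg_ge0 => _ [v _ <-]; rewrite divr_ge0 ?sqrtr_ge0. Qed.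

Lemma sqrtr_sqrD_le {R : realType} (x y : R) : 0 <= x -> 0 <= y ->
  Num.sqrt (x ^+ 2 + y ^+ 2) <= x + y.
Proof.
move=> x0 y0; rewrite -[leRHS]ger0_norm ?addr_ge0// -sqrtr_sqr ler_wsqrtr//.
by rewrite sqrrD lerD2r lerDl mulrn_wge0// mulr_ge0.
Qed.

Section discrete_problem.
Context {R : realType} {n : nat} (Om : set 'rV[R]_n).
Context {T : finType} (vtx : T -> 'M[R]_(n.+1, n)).
Hypotheses (n_gt0 : (0 < n)%N) (oOm : open Om) (bOm : bounded_set Om).
Hypothesis subdiv : simplicial_subdivision Om vtx.
Context (k : nat) (kn : (k.+1 < n)%N).
Let mOm : measurable Om. Proof. exact: measurable_open. Qed.
Local Notation V := (T -> dform R n).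
Local Notation pw := (pw_form vtx).
Local Notation G := (@pw_affine R n T).
Local Notation ipp := (ip Om vtx).
Local Notation P := (@P0h R n T k.+1).
Local Notation D := (Wstar0 Om vtx k.+2).
Local Notation B := (Wnc Om vtx k).
Let lL := @L2s_subspace R n Om mOm.
Let hL := @L2ip_form_on R n Om mOm.
Let lG : subspace G := @pw_affine_subspace R n T.
Let fG : finite_dim G := @pw_affine_finite_dim R n T.
Let hip : form_on G ipp := ip_form_on vtx oOm bOm.
Let dip : definite_on G ipp := ip_definite_on oOm bOm subdiv.
Let lP : subspace P := P0h_subspace k.+1.
Let lD : subspace D := Wstar0_subspace vtx oOm bOm k.+1.
Let lB : subspace B := Wnc_subspace vtx oOm bOm k.
Let PG : P `<=` G := @P0h_sub R n T k.+1.
Let DG : D `<=` G := @Wstar0_sub R n Om T vtx k.+2.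
Let BG : B `<=` G := @Wnc_sub R n Om T vtx k.
Let lS : linear_on D (W := V) cod_h := linear_on_sub DG (@cod_h_linear R n T).
Let lT : linear_on B (W := V) (@extd_h R n T) := linear_on_sub BG (@extd_h_linear R n T).
Let SP v : D v -> P (cod_h v). Proof. exact: cod_h_P0h kn. Qed.
Let TP v : B v -> P (extd_h v). Proof. exact: extd_h_P0h. Qed.
Let SG v (h : D v) : G (cod_h v) := PG (SP h).
Let TG v (h : B v) : G (extd_h v) := PG (TP h).
Let ST u v : D u -> B v -> ipp (cod_h u) (extd_h v) = 0.
Proof. exact: cod_h_extd_h_orth. Qed.
Let p (u v : V) := ipp (proj_h Om vtx k.+2 u) (proj_h Om vtx k.+2 v).
Let q (u v : V) := ipp (proj_h Om vtx k u) (proj_h Om vtx k v).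
Let nrm (u : V) := Num.sqrt (ipp u u).

Let pG u v : D u -> D v -> cod_h v = 0 -> p u v = ipp u v.
Proof.
move=> Du Dv v0.
exact: (proj_h_ip oOm bOm subdiv (DG Du) (cod_h_eq0 kn Dv v0)).
Qed.

Let qG u v : B u -> B v -> extd_h v = 0 -> q u v = ipp u v.
Proof.
move=> Bu Bv v0.
exact: (proj_h_ip oOm bOm subdiv (BG Bu) (extd_h_eq0 Bv v0)).
Qed.

Let p_linr u : D u -> linear_on D (W := R^o) (p u).
Proof.
by move=> Du; exact: linear_on_sub DG (proj_h_form_linearr oOm bOm subdiv k.+2 (DG Du)).
Qed.

Let p_linl u : D u -> linear_on D (W := R^o) (p^~ u).
Proof.
by move=> Du; exact: linear_on_sub DG (proj_h_form_linearl oOm bOm subdiv k.+2 (DG Du)).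
Qed.

Let q_linr u : B u -> linear_on B (W := R^o) (q u).
Proof.
by move=> Bu; exact: linear_on_sub BG (proj_h_form_linearr oOm bOm subdiv k (BG Bu)).
Qed.

Let q_linl u : B u -> linear_on B (W := R^o) (q^~ u).
Proof.
by move=> Bu; exact: linear_on_sub BG (proj_h_form_linearl oOm bOm subdiv k (BG Bu)).
Qed.

Let p_le u v : D u -> D v -> `|p u v| <= nrm u * nrm v.
Proof.
by move=> Du Dv; exact: (proj_h_form_le oOm bOm subdiv k.+2 (DG Du) (DG Dv)).
Qed.

Let q_le u v : B u -> B v -> `|q u v| <= nrm u * nrm v.
Proof.
by move=> Bu Bv; exact: (proj_h_form_le oOm bOm subdiv k (BG Bu) (BG Bv)).
Qed.

Local Notation harm :=
  (harmonic_on (ip := ipp) (P := P) (D := D) (B := B) (S := cod_h) (T := @extd_h R n T)).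

Lemma harmonic_ncE h : harmonic_nc Om vtx k.+1 h <-> harm h.
Proof.
split=> [[Wh h0 hh]|[Ph hS hT]].
  split; [exact: extd_h_eq0 Wh h0| |exact: hh].
  move=> u Du; rewrite (Wnc_ip n_gt0 oOm bOm subdiv kn Wh Du) h0.
  exact: (form0l lG hip (DG Du)).
have dh : extd_h h = 0 by apply/funext => t; exact: extd_const (Ph t).
split=> //; split=> [t|eta De]; first exact: P0_sub_P1minus (Ph t).
rewrite (codiff_h_ip n_gt0 oOm bOm subdiv kn (pw_affine_L2s _ oOm bOm (PG Ph)) De).
rewrite dh (form0l lG hip (DG De)) subr0; exact: hS De.
Qed.

Local Notation msol := (mixed_sol (ip := ipp) (P := P) (D := D) (B := B)
  (S := cod_h) (T := @extd_h R n T) (p := p) (q := q)).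

Lemma mixed_solutionE f w z s h : L2s Om f ->
  mixed_solution Om vtx k.+1 f w z s h <->
  msol (fun mu => L2ip Om f (pw mu)) w z s h.
Proof.
move=> Lf.
have H0 : harm 0 by exact: subspace0 (harmonic_on_subspace lG hip lP PG SP TP).
have nH0 : harmonic_nc Om vtx k.+1 0 by apply/harmonic_ncE.
have P0' := subspace0 lP; have D0 := subspace0 lD; have B0 := subspace0 lB.
have cE x : D x -> G w -> L2ip Om (pw w) (codiff_h Om vtx k.+2 x) = ipp w (cod_h x).
  move=> Dx Gw.
  exact: (codiff_h_ip n_gt0 oOm bOm subdiv kn (pw_affine_L2s _ oOm bOm Gw) Dx).
have cE' x : P x -> D z -> L2ip Om (codiff_h Om vtx k.+2 z) (pw x) = ipp (cod_h z) x.
  move=> Px Dz; have Lx := pw_affine_L2s vtx oOm bOm (PG Px).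
  rewrite (formC hL (codiff_h_L2s Dz) Lx).
  rewrite (codiff_h_ip n_gt0 oOm bOm subdiv kn Lx Dz).
  exact: (formC hip (PG Px) (SG Dz)).
split=> [[[Pw Dz Bs Hh] e]|[[Pw Dz Bs Hh] [e1 e2 e3 e4]]].
  split; split=> //; first exact/harmonic_ncE.
  - move=> x /harmonic_ncE Hx.
    by have [] := e 0 0 0 x (And4 P0' D0 B0 Hx).
  - move=> x Dx; have [_ e2 _ _] := e 0 x 0 0 (And4 P0' Dx B0 nH0).
    by rewrite -(cE _ Dx (PG Pw)); apply/eqP; rewrite -subr_eq0; apply/eqP.
  - move=> x Bx; have [_ _ e3 _] := e 0 0 x 0 (And4 P0' D0 Bx nH0).
    by apply/eqP; rewrite -subr_eq0; apply/eqP.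
  - move=> x Px; have [_ _ _ e4] := e x 0 0 0 (And4 Px D0 B0 nH0).
    by rewrite -e4 (cE' _ Px Dz).
split; first by split; [exact: Pw|exact: Dz|exact: Bs|exact/harmonic_ncE].
move=> mu eta tau vs [Pm De Bt /harmonic_ncE Hv]; split.
- exact: e1.
- rewrite (cE _ De (PG Pw)) -(e2 _ De); exact: subrr.
- rewrite -(e3 _ Bt); exact: subrr.
- by rewrite (cE' _ Pm Dz); exact: e4.
Qed.

Lemma icr_codiff_bound v :
  kernel_perp (ip := ipp) (D := D) (T := cod_h) v ->
  nrm v <= icr_codiff Om vtx k.+2 * nrm (cod_h v).
Proof.
move=> kv; suff -> : icr_codiff Om vtx k.+2 = sup [set nrm u / nrm (cod_h u) |
    u in [set u | kernel_perp (ip := ipp) (D := D) (T := cod_h) u /\ ipp u u != 0]].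
  exact: (kernel_perp_icr lG fG hip dip lD DG lS SG kv).
have N x : D x -> L2ip Om (codiff_h Om vtx k.+2 x) (codiff_h Om vtx k.+2 x) =
    ipp (cod_h x) (cod_h x) by exact: codiff_h_norm.
have kerE x : D x -> (cod_h x = 0 <->
    L2ip Om (codiff_h Om vtx k.+2 x) (codiff_h Om vtx k.+2 x) = 0).
  move=> Dx; rewrite N//; split=> [->|]; last exact: dip (SG Dx).
  exact: (form0l lG hip (subspace0 lG)).
have perpE x : kernel_perp (ip := ipp) (D := D) (T := cod_h) x <->
    ker_complement ipp (L2ip Om) (codiff_h Om vtx k.+2) D x.
  by split=> -[Dx hx]; split=> // u Du u0; apply: hx => //; apply/(kerE u Du).
congr sup; apply/seteqP; split=> _ [u [ku uu] <-]; exists u.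
- by split; [exact/(perpE u)|exact: uu].
- by rewrite (N u ku.1).
- by split; [exact/(perpE u)|exact: uu].
- by rewrite (N u ku.1).
Qed.

Lemma icr_extd_bound v :
  kernel_perp (ip := ipp) (D := B) (T := @extd_h R n T) v ->
  nrm v <= icr_extd Om vtx k * nrm (extd_h v).
Proof.
move=> kv; suff -> : icr_extd Om vtx k = sup [set nrm u / nrm (extd_h u) |
    u in [set u | kernel_perp (ip := ipp) (D := B) (T := @extd_h R n T) u /\
      ipp u u != 0]].
  exact: (kernel_perp_icr lG fG hip dip lB BG lT TG kv).
have kerE x : B x -> (extd_h x = 0 <-> ipp (extd_h x) (extd_h x) = 0).
  move=> Bx; split=> [->|]; last exact: dip (TG Bx).
  exact: (form0l lG hip (subspace0 lG)).
have perpE x : kernel_perp (ip := ipp) (D := B) (T := @extd_h R n T) x <->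
    ker_complement ipp ipp (@extd_h R n T) B x.
  by split=> -[Bx hx]; split=> // u Bu u0; apply: hx => //; apply/(kerE u Bu).
congr sup; apply/seteqP; split=> _ [u [ku uu] <-]; exists u.
- by split; [exact/(perpE u)|exact: uu].
- exact: erefl.
- by split; [exact/(perpE u)|exact: uu].
- exact: erefl.
Qed.

Let a := icr_codiff Om vtx k.+2.
Let b := icr_extd Om vtx k.
Let a_ge0 : 0 <= a. Proof. exact: icr_ge0. Qed.
Let b_ge0 : 0 <= b. Proof. exact: icr_ge0. Qed.

Lemma mixed_solution_well_posed (f : dform R n) : L2form Om k.+1 f ->
  exists w z s h : T -> dform R n,
    [/\ mixed_solution Om vtx k.+1 f w z s h,
        forall w' z' s' h', mixed_solution Om vtx k.+1 f w' z' s' h' ->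
          [/\ w' = w, z' = z, s' = s & h' = h] &
        L2norm Om (pw w) + codiff_norm Om k.+2 (pw z)
          + extd_h_norm Om vtx s + L2norm Om (pw h)
        <= (a * a + b * b + (a + 1) + (b + 1) + 1) * L2norm Om f].
Proof.
move=> [_ Lf].
have lF : linear_on P (W := R^o) (fun mu => L2ip Om f (pw mu)).
  exact: linear_on_sub PG (pw_ip_linear vtx oOm bOm Lf).
have [w [z [s [h sol]]]] := mixed_sol_exists lG fG hip dip lP PG lD DG lB BG
  lS SP lT TP ST p_linr q_linr pG qG lF.
have unq := mixed_sol_unique lG fG hip dip lP PG lD DG lB BG lS SP lT TP ST
  pG qG a_ge0 b_ge0 icr_codiff_bound icr_extd_bound p_le q_le p_linl q_linl.
have bnd := mixed_sol_bound lG fG hip dip lP PG lD DG lB BG lS SP lT TP ST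
  pG qG a_ge0 b_ge0 icr_codiff_bound icr_extd_bound p_le q_le.
exists w, z, s, h; split.
- exact/(mixed_solutionE w z s h Lf).
- move=> w' z' s' h' /(mixed_solutionE w' z' s' h' Lf); exact: unq sol.
have N0 := L2norm_ge0 Om f.
have [|h1 h2 h3 [h4 h5] h6] := bnd _ _ _ _ _ _ N0 _ sol.
  move=> x Px; exact: (cauchy_schwarz lL hL Lf (pw_affine_L2s vtx oOm bOm (PG Px))).
have Dz : D z by case: sol => -[].
have cz : L2norm Om (codiff Om k.+2 (pw z)) = nrm (cod_h z).
  by congr Num.sqrt; exact: (codiff_h_norm n_gt0 oOm bOm subdiv kn Dz).
have hz : codiff_norm Om k.+2 (pw z) <= a * L2norm Om f + L2norm Om f.
  rewrite /codiff_norm cz.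
  exact: le_trans (sqrtr_sqrD_le (L2norm_ge0 _ _) (sqrtr_ge0 _)) (lerD h2 h3).
have hs : extd_h_norm Om vtx s <= b * L2norm Om f + L2norm Om f.
  exact: le_trans (sqrtr_sqrD_le (L2norm_ge0 _ _) (L2norm_ge0 _ _)) (lerD h4 h5).
have e (x y N : R) : (x * x + y * y + (x + 1) + (y + 1) + 1) * N =
    (x * x + y * y) * N + (x * N + N) + (y * N + N) + N by ring.
rewrite e; exact: lerD (lerD (lerD h1 hz) hs) h6.
Qed.

End discrete_problem.

Theorem lemma4p3 (R : realType) :
  exists C : R -> R -> R,
  forall (n : nat) (Om : set 'rV[R]_n)
    (T : finType) (vtx : T -> 'M[R]_(n.+1, n)) (k : nat) (f : dform R n),
  (2 <= n)%N -> bounded_polyhedral_domain Om -> simplicial_subdivision Om vtx ->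
  (1 <= k <= n - 1)%N -> L2form Om k f ->
  exists w z s h : T -> dform R n,
    [/\ mixed_solution Om vtx k f w z s h,
        forall w' z' s' h', mixed_solution Om vtx k f w' z' s' h' ->
          [/\ w' = w, z' = z, s' = s & h' = h] &
        L2norm Om (pw_form vtx w) + codiff_norm Om k.+1 (pw_form vtx z)
          + extd_h_norm Om vtx s + L2norm Om (pw_form vtx h)
        <= C (icr_codiff Om vtx k.+1) (icr_extd Om vtx k.-1) * L2norm Om f].
Proof.
exists (fun a b => a * a + b * b + (a + 1) + (b + 1) + 1).
move=> n Om T vtx [//|k] f n2 [_ oOm _ bOm _] subdiv /= kn.
apply: mixed_solution_well_posed => //; first exact: ltnW.
by rewrite subn1 ltn_predRL in kn.
Qed.
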